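(* Let $w$ be the solution of the closed-loop system described in the context, and suppose that assumptions (A1) and (A2) of the context hold. Let $0\le\alpha\le\frac12\min\{\nu,\delta,c_0+w_d,c_1+w_d\}$ be such that $\beta=\min\{\nu-2\alpha,\delta-2\alpha,c_0+w_d-2\alpha,c_1+w_d-2\alpha\}>0$. Then there exist positive constants $C$ and $C(\|w_0\|_1)$, independent of $t$, where $C$ is also independent of $w_0$ and $C(\|w_0\|_1)$ depends on $w_0$ only through $\|w_0\|_1$, such that for all $t>0$ $$\|w_{xx}(t)\|^2\le C(\|w_0\|_1)\,e^{-2\alpha t}\,\|w_0\|_2^2\,e^{C\|w_0\|^2}.$$
   Context: Notation: $(\cdot,\cdot)$ and $\|\cdot\|$ are the inner product and norm of $L^2(0,1)$; $\|\cdot\|_m$ is the norm of the Sobolev space $H^m(0,1)$; $\||f|\|:=\sqrt{\|f_x\|^2+f^2(0)+f^2(1)}$. Parameters: $\nu,\rho,\delta,c_0,c_1>0$ and $w_d\ge 0$ are constants. $C$ is a generic positive constant. Closed-loop system: for $x\in(0,1)$, $t>0$, $$w_t-\nu w_{xx}+ww_x+w_dw_x=\rho z_x,\qquad z_t+\delta z=w_x,$$ $w_x(0,t)=v_0(t)$, $w_x(1,t)=v_1(t)$, $w(x,0)=w_0(x)$, $z(x,0)=0$, so that $z(x,t)=\int_0^te^{-\delta(t-s)}w_x(x,s)\,ds$, with feedback laws $$v_0(t)=\tfrac1\nu\Big((c_0+w_d)w(0,t)+\tfrac{2}{9c_0}w^3(0,t)-\rho z(0,t)\Big),\qquad v_1(t)=-\tfrac1\nu\Big((c_1+w_d)w(1,t)+\tfrac{2}{9c_1}w^3(1,t)+\rho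 z(1,t)\Big).$$ Weak form: for all $\phi\in H^1(0,1)$, $$(w_t,\phi)+\nu(w_x,\phi_x)+w_d(w_x,\phi)+(ww_x,\phi)+\rho(z,\phi_x)+\sum_{i=0}^1\Big((c_i+w_d)w(i,t)+\tfrac{2}{9c_i}w^3(i,t)\Big)\phi(i)=0,\quad w(\cdot,0)=w_0.$$ Assumption (A1): $w_0\in H^3(0,1)$ and the compatibility conditions $w_{0x}(0)=v_0(0)$, $w_{0x}(1)=v_1(0)$, $w_{0xt}(0)=v_{0t}(0)$, $w_{0xt}(1)=v_{1t}(0)$ hold at $t=0$ (here $w_{0xt}(i)$ means $w_{xt}(i,0)$). Assumption (A2): for $w_0\in H^3(0,1)$ there is a unique weak solution $w$ and it satisfies, with a positive constant $C$, $\|w\|_2^2+\|w_t\|_1^2+\|z\|^2+\int_0^t(\||w(s)|\|^2+\|w_t(s)\|_2^2+\|z(s)\|^2)ds\le C\|w_0\|_3^2$. *)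

(* Defs.v *)
From mathcomp Require Import all_boot all_order all_algebra.
From mathcomp Require Import all_classical all_reals all_analysis.

Set Implicit Arguments.
Unset Strict Implicit.
Unset Printing Implicit Defensive.

Import Order.TTheory GRing.Theory Num.Theory.
Import numFieldNormedType.Exports.

Local Open Scope classical_set_scope.
Local Open Scope ring_scope.

Notation leb R := (@lebesgue_measure R).

(* Functions on (0,1) are total functions [R -> R] of which only the values on
   [0,1] matter; functions of (x,t) are written with time first, [w t x]. *)

Definition L2 (R : realType) (f : R -> R) : Prop :=
  measurable_fun (`[0, 1]%classic : set R) f /\
  (leb R).-integrable (`[0, 1]%classic : set R) (fun x => (f x ^+ 2)%:E).

Definition inner (R : realType) (f g : R -> R) : R :=
  \int[leb R]_(x in `[0, 1]) (f x * g x).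

Definition L2norm (R : realType) (f : R -> R) : R := Num.sqrt (inner f f).

(* [H^m(0,1)] is the space of functions whose derivatives of order [< m] are
   absolutely continuous and whose [m]-th derivative is in [L^2].  Elements of
   [H^1] are thus represented by their continuous version, so that boundary
   values are plain evaluations at [0] and [1].  [sobolev_jet m f F] says that
   [F 0 = f], [F 1], ..., [F m] are the successive derivatives of [f]. *)
Definition sobolev_jet (R : realType) (m : nat) (f : R -> R)
    (F : nat -> R -> R) : Prop :=
  [/\ F 0%N = f,
      (forall k, (k <= m)%N -> L2 (F k)) &
      (forall k, (k < m)%N -> forall x, 0 <= x <= 1 ->
         F k x = F k 0 + \int[leb R]_(y in `[0, x]) F k.+1 y)].

Definition in_H (R : realType) (m : nat) (f : R -> R) : Prop :=
  exists F, sobolev_jet m f F.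

(* The [k]-th derivative of [f \in H^k]; for [k > 0] it is only determined up
   to a null set, so it must not be evaluated at points. *)
Definition Dx (R : realType) (k : nat) (f : R -> R) : R -> R :=
  xget (fun _ _ => 0) [set F | sobolev_jet k f F] k.

(* [g] is (a version of) the derivative of [f \in H^1]. *)
Definition is_Dx (R : realType) (f g : R -> R) : Prop :=
  exists2 F, sobolev_jet 1 f F & F 1%N = g.

Definition Hnorm (R : realType) (m : nat) (f : R -> R) : R :=
  Num.sqrt (\sum_(k < m.+1) L2norm (Dx k f) ^+ 2).

(* The norm written [||| f |||]. *)
Definition triple_norm (R : realType) (f : R -> R) : R :=
  Num.sqrt (L2norm (Dx 1 f) ^+ 2 + f 0 ^+ 2 + f 1 ^+ 2).

Record params (R : realType) := Params {
  nu : R; rho : R; delta : R; c0 : R; c1 : R; wd : R }.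

Definition admissible (R : realType) (p : params R) : Prop :=
  [/\ 0 < nu p, 0 < rho p & 0 < delta p] /\
  [/\ 0 < c0 p, 0 < c1 p & 0 <= wd p].

(* The variable [z], with [wx] standing for [w_x]. *)
Definition memory (R : realType) (p : params R) (wx : R -> R -> R) :
    R -> R -> R :=
  fun t x => \int[leb R]_(s in `[0, t]) (expR (- delta p * (t - s)) * wx s x).

Definition control0 (R : realType) (p : params R) (w wx : R -> R -> R)
    (t : R) : R :=
  (nu p)^-1 * ((c0 p + wd p) * w t 0 + 2 / (9 * c0 p) * w t 0 ^+ 3
               - rho p * memory p wx t 0).

Definition control1 (R : realType) (p : params R) (w wx : R -> R -> R)
    (t : R) : R :=
  - ((nu p)^-1 * ((c1 p + wd p) * w t 1 + 2 / (9 * c1 p) * w t 1 ^+ 3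
                  + rho p * memory p wx t 1)).

(* [w] is a weak solution with initial datum [w0], with [wx] and [wt] versions
   of [w_x] and [w_t].  The functions [w_x] and [w_t] are jointly measurable,
   [w] is in [L^2(0,T; H^1)] and [w_t] in [L^2(0,T; L^2)] for every [T]; that
   [w_t] is the time derivative of [w] is expressed by integration in time. *)
Definition weak_solution (R : realType) (p : params R) (w0 : R -> R)
    (w wx wt : R -> R -> R) : Prop :=
  let z := memory p wx in
  let Q : set (R * R) := [set q | 0 <= q.1 /\ 0 <= q.2 <= 1] in
  (measurable_fun Q (fun q : R * R => wx q.1 q.2) /\
   measurable_fun Q (fun q : R * R => wt q.1 q.2)) /\
  [/\ (forall t, 0 <= t -> is_Dx (w t) (wx t)),
      (forall t, 0 < t -> L2 (wt t)),
      (forall T, 0 < T ->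
         (\int[leb R]_(s in `[0%R, T])
            (Hnorm 1 (w s) ^+ 2 + L2norm (wt s) ^+ 2)%R%:E < +oo)%E) &
      (forall t, 0 <= t -> {ae leb R, forall x, 0 <= x <= 1 ->
         w t x = w 0 x + \int[leb R]_(s in `[0, t]) wt s x})] /\
  (forall t, 0 < t -> forall phi phix, is_Dx phi phix ->
     inner (wt t) phi + nu p * inner (wx t) phix + wd p * inner (wx t) phi
     + inner (fun x => w t x * wx t x) phi + rho p * inner (z t) phix
     + ((c0 p + wd p) * w t 0 + 2 / (9 * c0 p) * w t 0 ^+ 3) * phi 0
     + ((c1 p + wd p) * w t 1 + 2 / (9 * c1 p) * w t 1 ^+ 3) * phi 1 = 0) /\
  (forall x, 0 <= x <= 1 -> w 0 x = w0 x).

Definition right_derivative0 (R : realType) (f : R -> R) (l : R) : Prop :=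
  h^-1 * (f h - f 0) @[h --> 0^'+] --> l.

(* [w_{0xt}(i) = v_{it}(0)] is read as: [w_x(i,.)] and [v_i] have the same
   time derivative at [t = 0]. *)
Definition assumption_A1 (R : realType) (p : params R) (w0 : R -> R)
    (w wx : R -> R -> R) : Prop :=
  [/\ in_H 3 w0,
      wx 0 0 = control0 p w wx 0 /\ wx 0 1 = control1 p w wx 0,
      (exists l, right_derivative0 (fun t => wx t 0) l /\
                 right_derivative0 (control0 p w wx) l) &
      (exists l, right_derivative0 (fun t => wx t 1) l /\
                 right_derivative0 (control1 p w wx) l)].

(* The solution is in [H^2] at every time; requiring [wx t] itself to be in
   [H^1] selects the continuous version of [w_x], which is the one evaluated at
   the end points in [control0], [control1] and [assumption_A1]. *)
Definition assumption_A2 (R : realType) (p : params R) (w0 : R -> R)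
    (w wx wt : R -> R -> R) : Prop :=
  let z := memory p wx in
  [/\ weak_solution p w0 w wx wt,
      (forall w' wx' wt', weak_solution p w0 w' wx' wt' ->
         forall t x, 0 <= t -> 0 <= x <= 1 -> w' t x = w t x),
      (forall t, 0 <= t -> in_H 1 (wx t)),
      (forall t, 0 < t -> in_H 1 (wt t)) /\
      {ae leb R, forall t, 0 < t -> in_H 2 (wt t)} &
      exists2 C : R, 0 < C & forall t, 0 < t ->
        ((Hnorm 2 (w t) ^+ 2 + Hnorm 1 (wt t) ^+ 2 + L2norm (z t) ^+ 2)%R%:E
         + \int[leb R]_(s in `[0%R, t])
             (triple_norm (w s) ^+ 2 + Hnorm 2 (wt s) ^+ 2
              + L2norm (z s) ^+ 2)%R%:E
         <= (C * Hnorm 3 w0 ^+ 2)%R%:E)%E].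

(* Main.v *)
Require Import Defs.
From mathcomp Require Import all_boot all_order all_algebra.
From mathcomp Require Import all_classical all_reals all_analysis.
From mathcomp Require Import measurable_realfun ring lra.

(** For [phi] in [H^1] the map [t |-> (w(t), phi)] is [C^1] on [t > 0], so
    the weak form yields classical derivatives of the energies.
    Young's inequality absorbs the cubic boundary terms and gives
    [E0' <= - 2 alpha E0 - beta P] with [E0 = |w|^2 + rho |z|^2] and
    [P = |w_x|^2 + w(0)^2 + w(1)^2].  The energy [Y] of the time increments
    [w(t + h) - w(t)], [z(t + h) - z(t)] satisfies
    [Y' <= (- 2 alpha + (32 / beta) (P(t) + P(t + h))) Y].  Hence
    [e^(2 alpha t) Y exp ((32 / beta^2) (E0(t) + E0(t + h)))] is nonincreasing,
    a form of Gronwall's argument in which [P] need not be integrated in time.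
    The compatibility conditions bound [Y(0)] by [h^2] times the data, so
    letting [h] tend to [0] gives the decay of [|w_t|], and testing the equation
    with [w] then gives the decay of [P].
    Finally, for [phi] in [H^1_0], [y = (z, phi_x)] solves
    [y' + (delta + rho / nu) y = - (g, phi) / nu] with
    [g = w_t + w w_x + w_d w_x], which bounds [(w_xx, phi)] by
    [C e^(- alpha t) |phi|]; since [H^1_0] is dense in [L^2], this bounds [w_xx].
    The factor [exp (64 |w0|^2 / beta^2)] depends on [w0] through [|w0|_1]
    only, and is part of [C1 |w0|_1]. *)

Set Implicit Arguments.
Unset Strict Implicit.
Unset Printing Implicit Defensive.

Import Order.TTheory GRing.Theory Num.Theory.
Import numFieldNormedType.Exports.

Local Open Scope classical_set_scope.
Local Open Scope ring_scope.

(** * Derivatives of real functions *)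

(** Two obstacles shape the proof. First, the bound supplied by (A2) is a multiple of [|w0|_3],
    while the final constants may depend on [w0] only through [|w0|_1]. Increments replace a
    differentiation of the equation in time for a similar reason: the weak forms at [t] and [t + h]
    can be subtracted and tested with the increment, an element of [H^1], and no [w_tt] appears.
    Second, [w_xx] is only a version chosen separately at each time, with no joint measurability in
    time and space, so [z_x] cannot be formed as a time integral of [w_xx]. Both are reached by
    duality, through the pairings [(z, phi_x)] and [(w_x, phi_x)], and [phi] in [H^1_0] removes the
    boundary terms as well. *)

Section real_calculus.
Context {R : realType}.
Implicit Types (f g : R -> R) (a b c k x t : R).

(** The casts to [R^o] fix the structure of [R] as a normed module over itself, so that the
    derivation rules apply to plain functions. Existence and value of the derivative travel as one
    statement. *)
Definition dat f x a := is_derive (x : R^o) (1 : R^o) (f : R^o -> R^o) a.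

Lemma dat_eq f x a b : dat f x a -> a = b -> dat f x b.
Proof. by move=> ? <-. Qed.

Lemma datD f g x a b : dat f x a -> dat g x b -> dat (fun t => f t + g t) x (a + b).
Proof. by rewrite /dat => hf hg; exact: is_deriveD. Qed.

Lemma datB f g x a b : dat f x a -> dat g x b -> dat (fun t => f t - g t) x (a - b).
Proof. by rewrite /dat => hf hg; exact: is_deriveB. Qed.

Lemma datZ k f x a : dat f x a -> dat (fun t => k * f t) x (k * a).
Proof. by rewrite /dat => hf; exact: is_deriveZ. Qed.

Lemma datM f g x a b : dat f x a -> dat g x b ->
  dat (fun t => f t * g t) x (a * g x + f x * b).
Proof.
rewrite /dat => hf hg; apply: (@is_derive_eq _ _ _ _ _ _ _ _ (is_deriveM hf hg)).
by rewrite addrC /GRing.scale/= [g x * a]mulrC.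
Qed.

Lemma dat_cst k x : dat (fun=> k) x 0.
Proof. exact: is_derive_cst. Qed.

Lemma dat_id x : dat (fun t => t) x 1.
Proof. exact: is_derive_id. Qed.

Lemma dat_comp f g x a b : dat f (g x) a -> dat g x b -> dat (fun t => f (g t)) x (a * b).
Proof.
rewrite /dat => hf hg; apply: (@is_derive_eq _ _ _ _ _ _ _ _ (is_derive1_comp hf hg)).
by rewrite /GRing.scale/= mulrC.
Qed.

Lemma dat_shift f x h a : dat f (x + h) a -> dat (fun t => f (t + h)) x a.
Proof.
move=> hf; rewrite -(mulr1 a); apply: (@dat_comp f (fun t => t + h)) => //.
by apply: dat_eq (datD (dat_id x) (dat_cst h x)) _; rewrite addr0.
Qed.

Lemma dat_expR k x : dat (fun t => expR (k * t)) x (k * expR (k * x)).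
Proof.
apply: dat_eq (dat_comp (is_derive_expR _) (datZ k (dat_id x))) _.
by rewrite mulr1 mulrC.
Qed.

Lemma dat_cont f x a : dat f x a -> {for x, continuous f}.
Proof.
by move=> [+ _] => /derivable1_diffP; exact: differentiable_continuous.
Qed.

(** Mean value theorem with derivatives in the open interval only: the weak form is available for
    [t > 0], and at [t = 0] the energies are merely continuous. *)
Lemma dat_nonincr f x y : x <= y ->
  (forall t, x < t < y -> exists2 d, dat f t d & d <= 0) ->
  {within `[x, y], continuous f} -> f y <= f x.
Proof.
move=> xy hd hc; have [<-//|nxy] := eqVneq x y.
have lxy : x < y by rewrite lt_neqAle nxy.
have [c cxy e] : exists2 c, c \in `]x, y[%R & f y - f x = 'D_1 f c * (y - x).
  apply: MVT => // t; rewrite in_itv/= => /hd[d [hd' _] _].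
  exact: DeriveDef.
move: cxy; rewrite in_itv/= => /hd[d [_ dE] d0]; rewrite -subr_le0 e dE.
by apply: mulr_le0_ge0 => //; rewrite subr_ge0.
Qed.

Lemma dat_bound f f' x y B : x <= y ->
  (forall t, x < t < y -> dat f t (f' t)) ->
  (forall t, x < t < y -> `|f' t| <= B) ->
  {within `[x, y], continuous f} -> `|f y - f x| <= B * (y - x).
Proof.
move=> xy hd hn hc.
have [<-|nxy] := eqVneq x y; first by rewrite !subrr mulr0 normr0.
have lxy : x < y by rewrite lt_neqAle nxy.
have [d dxy e] : exists2 c, c \in `]x, y[%R & f y - f x = f' c * (y - x).
  by apply: MVT => // t; rewrite in_itv/=; exact: hd.
move: dxy; rewrite in_itv/= => /hn h; rewrite e normrM [`|y - x|]ger0_norm ?subr_ge0//.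
by rewrite ler_wpM2r ?subr_ge0.
Qed.

(** A sequential form, so that bounds on quotients with specially chosen small steps pass to the
    derivative. *)
Lemma dat_quotient f x a (u : nat -> R) : dat f x a -> (forall n, u n != 0) ->
  u @ \oo --> 0 -> (u n)^-1 * (f (x + u n) - f x) @[n --> \oo] --> a.
Proof.
move=> [hd <-] un0 u0.
have {hd} : (fun h : R => h^-1 *: (f (h *: 1 + x) - f x)) h @[h --> 0^'] --> 'D_1 f x by exact: hd.
move=> /cvgr_dnbhsP /(_ u (conj un0 u0)); apply: cvg_trans; apply: near_eq_cvg.
by apply: nearW => n; rewrite /GRing.scale/= mulr1 (addrC x).
Qed.

Lemma dat_near f g x a : (\forall y \near x, f y = g y) -> dat f x a -> dat g x a.
Proof. exact: near_eq_is_derive. Qed.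

Lemma dat_pos f g x a : 0 < x -> (forall y, 0 < y -> f y = g y) -> dat f x a -> dat g x a.
Proof.
by move=> x0 fg; apply: dat_near; near=> y; apply: fg; near: y; exact: lt_nbhsr.
Unshelve. all: by end_near. Qed.

(** The remainder [|v s - v t|^2] of a Lipschitz curve is of this kind, which is how it drops out of
    the derivative of [|v s|^2]. *)
Lemma dat_sq0 f t C : 0 < t ->
  (forall s, 0 < s < t + 1 -> `|f s| <= C * (s - t) ^+ 2) -> dat f t 0.
Proof.
move=> t0 hf.
have C0 : 0 <= C.
  have : `|f (t + 2^-1)| <= C * (t + 2^-1 - t) ^+ 2 by apply: hf; lra.
  rewrite (addrC t) addrK => /(le_trans (normr_ge0 _)).
  by rewrite pmulr_lge0// exprn_gt0// invr_gt0.
have ft : f t = 0.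
  have : `|f t| <= C * (t - t) ^+ 2 by apply: hf; lra.
  by rewrite subrr expr0n mulr0 normr_le0 => /eqP.
have cv : h^-1 *: (f (h *: 1 + t) - f t) @[h --> 0^'] --> (0 : R).
  apply/cvgrPdist_le => e e0; near=> h.
  rewrite sub0r normrN ft subr0 /GRing.scale/= mulr1 normrM normfV.
  have hn0 : h != 0 by near: h; exact: nbhs_dnbhs_neq.
  have hp : 0 < `|h| by rewrite normr_gt0.
  have h1 : `|h| < Num.min t 1.
    near: h; apply: dnbhs0_lt; by rewrite lt_min t0 ltr01.
  have h2 : `|h| <= e / (C + 1).
    near: h; apply: dnbhs0_le; by rewrite divr_gt0// ltr_wpDl.
  rewrite ler_pdivrMl//.
  move: h1; rewrite lt_min !ltr_norml => /andP[/andP[h3 h4] /andP[h5 h6]].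
  have : `|f (h + t)| <= C * (h + t - t) ^+ 2 by apply: hf; lra.
  rewrite addrK -(real_normK (num_real h)) => /le_trans; apply.
  have C1 : 0 < C + 1 by rewrite ltr_wpDl.
  rewrite ler_pdivlMr// in h2; rewrite expr2 mulrCA ler_wpM2l//.
  by apply: le_trans h2; rewrite mulrC ler_wpM2l// lerDl.
split; last exact: (cvg_lim (@Rhausdorff R) cv).
by apply/cvg_ex; exists 0; exact: cv.
Unshelve. all: by end_near. Qed.

Lemma modulus_continuous f (om : R -> R) t : 0 < t -> om d @[d --> 0] --> 0 ->
  (forall s, 0 < s < t + 1 -> `|f s - f t| <= om (s - t)) ->
  {for t, continuous f}.
Proof.
move=> t0 om0 hf; apply/cvgrPdist_le => e e0; near=> s.
rewrite distrC; apply: (@le_trans _ _ (om (s - t))).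
  apply: hf; apply/andP; split; near: s; first exact: lt_nbhsr.
  by apply: lt_nbhsl; rewrite ltrDl.
apply: le_trans (ler_norm _) _; rewrite -[X in `|X|]opprK normrN -sub0r; near: s.
have st : s - t @[s --> t] --> 0.
  by rewrite -(subrr t); apply: cvgB; [exact: cvg_id|exact: cvg_cst].
have := cvg_comp _ _ st om0.
by move=> /cvgrPdist_le /(_ e e0).
Unshelve. all: by end_near. Qed.

Lemma lipschitz_within f L x y :
  (forall s t, x <= s <= y -> x <= t <= y -> `|f s - f t| <= L * `|s - t|) ->
  {within `[x, y], continuous f}.
Proof.
move=> hf; have [xy|yx] := leP x y; last first.
  by rewrite set_itv_ge ?bnd_simp -?ltNge//; exact: continuous_subspace0.
apply/subspace_continuousP => t; rewrite /= in_itv/= => txy.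
apply/cvgrPdist_le => e e0; near=> s.
have sxy : x <= s <= y by near: s; apply: withinT.
have L0 : 0 < `|L| + 1 by rewrite ltr_wpDl.
apply: (@le_trans _ _ ((`|L| + 1) * `|t - s|)).
  apply: le_trans (hf _ _ txy sxy) _; rewrite ler_wpM2r//.
  by apply: le_trans (ler_norm L) _; rewrite lerDl.
rewrite mulrC -ler_pdivlMr//; near: s; apply: cvg_within.
apply/nbhs_ballP; exists (e / (`|L| + 1)); first by rewrite /= divr_gt0.
by move=> z; rewrite /ball/=; exact: ltW.
Unshelve. all: by end_near. Qed.

End real_calculus.

(** * The space L2(0,1) *)

Section L2_kit.
Context {R : realType}.
Implicit Types (f g h : R -> R) (a b B : R).
Local Notation mu := (leb R).
Local Notation I01 := (`[0, 1]%classic : set R).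

Lemma mI01 : (R.-ocitv.-measurable).-sigma.-measurable I01.
Proof. exact: measurable_itv. Qed.

Definition int01 f := mu.-integrable I01 (EFin \o f).

Lemma mu01 : mu I01 = 1%E.
Proof. by rewrite lebesgue_measure_itv/= lte01 oppr0 adde0. Qed.

Lemma in01_0 : (0 : R) <= (0 : R) <= (1 : R).
Proof. by rewrite lexx ler01. Qed.

Lemma in01_1 : (0 : R) <= (1 : R) <= (1 : R).
Proof. by rewrite lexx ler01. Qed.

Lemma L2_mul_integrable f g : L2 f -> L2 g -> int01 (fun x => f x * g x).
Proof.
move=> [mf if2] [mg ig2].
have i2 : mu.-integrable I01 (EFin \o (fun x => f x ^+ 2 + g x ^+ 2)).
  have := integrableD mI01 if2 ig2.
  by apply: eq_integrable.
apply: (le_integrable _ _ _ i2) => //=.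
  exact/measurable_EFinP/measurable_funM.
move=> x _; rewrite lee_fin normrM [leRHS]ger0_norm ?addr_ge0 ?sqr_ge0//.
rewrite -(real_normK (num_real (f x))) -(real_normK (num_real (g x))).
have := sqr_ge0 (`|f x| - `|g x|).
by have := sqr_ge0 (`|f x| + `|g x|); nra.
Qed.

Lemma int01Z a f : int01 f -> int01 (fun x => a * f x).
Proof. by move=> h; have := @integrableZl _ _ _ mu _ mI01 a _ h. Qed.

Lemma int01D f g : int01 f -> int01 g -> int01 (fun x => f x + g x).
Proof. by move=> hf hg; have := integrableD mI01 hf hg. Qed.

Lemma int01_bounded f B : measurable_fun I01 f ->
  (forall x, 0 <= x <= 1 -> `|f x| <= B) -> int01 f.
Proof.
move=> mf hB; apply: measurable_bounded_integrable => //.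
  suff: (mu I01 < +oo)%E by [].
  by rewrite mu01 ltry.
exists B; split; first exact: num_real.
move=> M BM x /=; rewrite in_itv/= => x01.
exact: (le_trans (hB _ x01) (ltW BM)).
Qed.

Lemma L2_bounded f B : measurable_fun I01 f ->
  (forall x, 0 <= x <= 1 -> `|f x| <= B) -> L2 f.
Proof.
move=> mf hB; split=> //.
apply: (@int01_bounded _ (B ^+ 2)); first exact: measurable_funX.
move=> x x01; rewrite normrX ler_sqr ?nnegrE ?hB//.
exact: le_trans (hB _ x01).
Qed.

Lemma L2_cst a : L2 (fun=> a).
Proof. by apply: (@L2_bounded _ `|a|) => //; exact: measurable_cst. Qed.

Lemma L2D f g : L2 f -> L2 g -> L2 (fun x => f x + g x).
Proof.
move=> hf hg; split; first exact: measurable_funD hf.1 hg.1.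
have := int01D (int01D hf.2 hg.2) (int01Z 2 (L2_mul_integrable hf hg)).
by apply: eq_integrable => // x _ /=; congr EFin; ring.
Qed.

Lemma L2Z a f : L2 f -> L2 (fun x => a * f x).
Proof.
move=> hf; split; first exact: measurable_funM (measurable_cst _) hf.1.
have := int01Z (a ^+ 2) hf.2.
by apply: eq_integrable => // x _ /=; congr EFin; ring.
Qed.

Lemma L2N f : L2 f -> L2 (fun x => - f x).
Proof.
move=> /(L2Z (-1)); congr L2; apply/funext => x; ring.
Qed.

Lemma L2B f g : L2 f -> L2 g -> L2 (fun x => f x - g x).
Proof. by move=> hf /L2N; exact: L2D. Qed.

Lemma L2_mul_bounded f g B : L2 f -> measurable_fun I01 g ->
  (forall x, 0 <= x <= 1 -> `|g x| <= B) -> L2 (fun x => g x * f x).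
Proof.
move=> hf mg hB; split; first exact: measurable_funM mg hf.1.
apply: (le_integrable _ _ _ (int01Z (B ^+ 2) hf.2)) => //=.
  apply/measurable_EFinP/measurable_funX; exact: measurable_funM mg hf.1.
move=> x; rewrite /= in_itv/= => x01.
rewrite lee_fin exprMn !(ger0_norm (mulr_ge0 (sqr_ge0 _) (sqr_ge0 _))).
apply: ler_wpM2r; first exact: sqr_ge0.
rewrite -(real_normK (num_real (g x))) ler_sqr ?nnegrE ?hB//.
exact: le_trans (hB _ x01).
Qed.

Lemma L2_int f : L2 f -> int01 f.
Proof.
move=> hf; have := L2_mul_integrable hf (L2_cst 1).
by apply: eq_integrable => // x _ /=; rewrite mulr1.
Qed.

Lemma innerC f g : inner f g = inner g f.
Proof. by rewrite /inner; apply: eq_Rintegral => x _; rewrite mulrC. Qed.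

Lemma eq_inner f f' g g' : (forall x, 0 <= x <= 1 -> f x = f' x) ->
  (forall x, 0 <= x <= 1 -> g x = g' x) -> inner f g = inner f' g'.
Proof.
move=> hf hg; rewrite /inner; apply: eq_Rintegral => x.
by rewrite inE/= in_itv/= => x01; rewrite hf// hg.
Qed.

Lemma innerDl f g h : L2 f -> L2 g -> L2 h ->
  inner (fun x => f x + g x) h = inner f h + inner g h.
Proof.
move=> hf hg hh; rewrite /inner -RintegralD//.
- by apply: eq_Rintegral => x _; rewrite mulrDl.
- exact: L2_mul_integrable.
- exact: L2_mul_integrable.
Qed.

Lemma innerZl a f g : L2 f -> L2 g -> inner (fun x => a * f x) g = a * inner f g.
Proof.
move=> hf hg; rewrite /inner -RintegralZl//; last exact: L2_mul_integrable.
by apply: eq_Rintegral => x _; rewrite mulrA.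
Qed.

Lemma innerNl f g : L2 f -> L2 g -> inner (fun x => - f x) g = - inner f g.
Proof.
move=> hf hg; rewrite -mulN1r -innerZl//; apply: eq_inner => // x _; ring.
Qed.

Lemma innerBl f g h : L2 f -> L2 g -> L2 h ->
  inner (fun x => f x - g x) h = inner f h - inner g h.
Proof. by move=> hf hg hh; rewrite innerDl ?innerNl//; exact: L2N. Qed.

Lemma innerDr f g h : L2 f -> L2 g -> L2 h ->
  inner h (fun x => f x + g x) = inner h f + inner h g.
Proof. by move=> *; rewrite innerC innerDl// !(innerC h). Qed.

Lemma innerBr f g h : L2 f -> L2 g -> L2 h ->
  inner h (fun x => f x - g x) = inner h f - inner h g.
Proof. by move=> *; rewrite innerC innerBl// !(innerC h). Qed.

Lemma innerZr a f g : L2 f -> L2 g -> inner f (fun x => a * g x) = a * inner f g.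
Proof. by move=> *; rewrite innerC innerZl// innerC. Qed.

Lemma innerNr f g : L2 f -> L2 g -> inner f (fun x => - g x) = - inner f g.
Proof. by move=> *; rewrite innerC innerNl// innerC. Qed.

Lemma inner_ge0 f : 0 <= inner f f.
Proof. by apply: Rintegral_ge0 => x _; rewrite -expr2 sqr_ge0. Qed.

Lemma L2norm_ge0 f : 0 <= L2norm f.
Proof. exact: sqrtr_ge0. Qed.

Lemma L2norm_sqr f : L2norm f ^+ 2 = inner f f.
Proof. by rewrite sqr_sqrtr// inner_ge0. Qed.

Lemma L2_norm f : L2 f -> L2 (fun x => `|f x|).
Proof.
move=> hf; split; first by apply: measurableT_comp => //; exact: hf.1.
by apply: eq_integrable hf.2 => // x _; rewrite real_normK ?num_real.
Qed.

Lemma L2norm_norm f : L2norm (fun x => `|f x|) = L2norm f.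
Proof.
rewrite /L2norm; congr Num.sqrt; apply: eq_Rintegral => x _.
by rewrite -!expr2 real_normK ?num_real.
Qed.

(** Discriminant criterion, from the minimiser [- b / a]. The degenerate case [a = 0] is included so
    that Cauchy-Schwarz also covers functions of norm zero. *)
Lemma quadratic_ge0 a b (c : R) : (forall t, 0 <= a * t ^+ 2 + 2 * b * t + c :> R) ->
  0 <= a -> b ^+ 2 <= a * c.
Proof.
move=> h a0.
have [a00|an0] := eqVneq a 0.
  rewrite a00 in h *.
  have [->|bn0] := eqVneq b 0; first by rewrite expr0n/= mul0r.
  (* For [a = 0] the polynomial is affine, and this point gives it the value [-1]. *)
  have := h (- (c + 1) / (2 * b)).
  have -> : 0 * (- (c + 1) / (2 * b)) ^+ 2 + 2 * b * (- (c + 1) / (2 * b)) + c = -1.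
    by field.
  by rewrite ler0N1.
have ap : 0 < a by rewrite lt0r an0.
have := h (- b / a).
have -> : a * (- b / a) ^+ 2 + 2 * b * (- b / a) + c = (a * c - b ^+ 2) / a by field.
by rewrite pmulr_lge0 ?invr_gt0// subr_ge0.
Qed.

(** Discriminant of the polynomial [|t f + g|^2] in [t], which is nonnegative. *)
Lemma cauchy_schwarz f g : L2 f -> L2 g -> `|inner f g| <= L2norm f * L2norm g.
Proof.
move=> hf hg.
rewrite -(@ler_sqr _ `|_|) ?nnegrE ?mulr_ge0 ?L2norm_ge0//.
rewrite exprMn !L2norm_sqr real_normK ?num_real//.
apply: quadratic_ge0 (inner_ge0 _) => t.
have := inner_ge0 (fun x => t * f x + g x).
rewrite innerDl ?innerDr ?innerZl ?innerZr//; try by do ?[exact: L2Z|apply: L2D].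
by rewrite (innerC g f) => /le_trans; apply; rewrite le_eqVlt; apply/orP; left; apply/eqP; ring.
Qed.

Lemma L2norm_triangle f g : L2 f -> L2 g ->
  L2norm (fun x => f x + g x) <= L2norm f + L2norm g.
Proof.
move=> hf hg; rewrite -ler_sqr ?nnegrE ?addr_ge0 ?L2norm_ge0//.
rewrite L2norm_sqr innerDl ?innerDr//; try exact: L2D.
rewrite (innerC g f) -!L2norm_sqr.
have := cauchy_schwarz hf hg; have := ler_norm (inner f g).
nra.
Qed.

Lemma L2norm_eq f g : (forall x, 0 <= x <= 1 -> f x = g x) -> L2norm f = L2norm g.
Proof. by move=> h; rewrite /L2norm (eq_inner h h). Qed.

Lemma L2normZ a f : L2 f -> L2norm (fun x => a * f x) = `|a| * L2norm f.
Proof.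
move=> hf; rewrite /L2norm innerZl ?innerZr//; last exact: L2Z.
by rewrite mulrA -expr2 sqrtrM ?sqr_ge0// sqrtr_sqr.
Qed.

Lemma L2normN f : L2 f -> L2norm (fun x => - f x) = L2norm f.
Proof.
by move=> hf; rewrite /L2norm innerNl ?innerNr ?opprK//; exact: L2N.
Qed.

Lemma L2normB f g : L2 f -> L2 g ->
  L2norm (fun x => f x - g x) = L2norm (fun x => g x - f x).
Proof.
move=> hf hg; rewrite -L2normN; last exact: L2B.
by apply: L2norm_eq => x _; rewrite opprB.
Qed.

Lemma L2norm_dist f g : L2 f -> L2 g ->
  `|L2norm f - L2norm g| <= L2norm (fun x => f x - g x).
Proof.
move=> hf hg; rewrite ler_norml; apply/andP; split.
  have := L2norm_triangle (L2B hg hf) hf.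
  rewrite (@L2norm_eq _ g); last by move=> x _; ring.
  by rewrite (L2normB hg hf); lra.
have := L2norm_triangle (L2B hf hg) hg.
rewrite (@L2norm_eq _ f); last by move=> x _; ring.
by lra.
Qed.

Lemma inner_le_bound f g B : L2 f -> L2 g -> (forall x, 0 <= x <= 1 -> `|f x * g x| <= B) ->
  `|inner f g| <= B.
Proof.
move=> hf hg h; have ii := L2_mul_integrable hf hg.
apply: le_trans (le_normr_Rintegral _ ii) _ => //.
have -> : B = \int[mu]_(x in I01) B.
  rewrite Rintegral_cst//.
  by rewrite (_ : fine _ = 1) ?mulr1//; exact: (congr1 fine mu01).
apply: le_Rintegral => //.
- exact: (integrable_norm ii).
- exact: L2_int (L2_cst _).
Qed.

Lemma L2norm_le_bound f B : L2 f -> 0 <= B -> (forall x, 0 <= x <= 1 -> `|f x| <= B) ->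
  L2norm f <= B.
Proof.
move=> hf B0 h; rewrite -ler_sqr ?nnegrE ?L2norm_ge0// L2norm_sqr.
apply: le_trans (ler_norm _) _; apply: inner_le_bound => // x x01.
by rewrite normrM expr2 ler_pM// h.
Qed.

Lemma L2norm_mul_le f g B : L2 f -> measurable_fun I01 g -> 0 <= B ->
  (forall x, 0 <= x <= 1 -> `|g x| <= B) ->
  L2norm (fun x => g x * f x) <= B * L2norm f.
Proof.
move=> hf mg B0 hB; rewrite -ler_sqr ?nnegrE ?mulr_ge0 ?L2norm_ge0//.
have hgf := L2_mul_bounded hf mg hB.
rewrite exprMn !L2norm_sqr -innerZl//; apply: le_Rintegral => //.
- exact: L2_mul_integrable.
- by apply: L2_mul_integrable => //; exact: L2Z.
move=> x; rewrite /= in_itv/= => x01.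
have : g x ^+ 2 <= B ^+ 2.
  rewrite -(real_normK (num_real (g x))) ler_sqr ?nnegrE ?hB//.
have := sqr_ge0 (f x); nra.
Qed.

End L2_kit.

(** * Fubini's theorem on boxes and products of primitives *)

Section fubini_box.
Context {R : realType}.
Local Notation mu := (leb R).

Lemma ae_imp (P Q : R -> Prop) : (forall x, P x -> Q x) ->
  {ae mu, forall x, P x} -> {ae mu, forall x, Q x}.
Proof.
by move=> PQ; apply: filterS PQ; exact: (ae_filter_ringOfSetsType mu).
Qed.

Lemma integrable_fine_EFin (D : set R) (F : R -> \bar R) :
  measurable D -> mu.-integrable D F -> mu.-integrable D (EFin \o (fun s => fine (F s))).
Proof.
move=> mD iF; apply: (le_integrable _ _ _ iF) => //.
  apply: measurableT_comp => //; apply: measurableT_comp => //.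
  exact: measurable_int iF.
by move=> s _ /=; case: (F s) => [r| |] //=; rewrite normr0 leey.
Qed.

(** Fubini's theorem on the plane, applied to the extension of [f] by zero outside the box. The
    sections are integrable only almost everywhere, hence the null sets in the conclusion. *)
Lemma fubini_box (D E : set R) (f : R -> R -> R) :
  measurable D -> measurable E ->
  measurable_fun (D `*` E) (fun q : R * R => f q.1 q.2) ->
  (\int[mu]_(s in D) \int[mu]_(r in E) `|f s r|%:E < +oo)%E ->
  [/\ {ae mu, forall s, D s -> mu.-integrable E (EFin \o f s)},
      {ae mu, forall r, E r -> mu.-integrable D (EFin \o f^~ r)},
      mu.-integrable D (EFin \o (fun s => \int[mu]_(r in E) f s r)),
      mu.-integrable E (EFin \o (fun r => \int[mu]_(s in D) f s r)) &
      \int[mu]_(s in D) \int[mu]_(r in E) f s r =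
      \int[mu]_(r in E) \int[mu]_(s in D) f s r].
Proof.
move=> mD mE mf fin.
pose T := g_sigma_algebraType (R.-ocitv.-measurable).
pose g : R * R -> \bar R := (fun q : R * R => (f q.1 q.2)%:E) \_ (D `*` E).
have gE s r : g (s, r) = if (s \in D) && (r \in E) then (f s r)%:E else 0%E.
  rewrite /g patchE /=; congr (if _ then _ else _).
  by apply/idP/andP => [|[]]; rewrite !inE.
have mg : measurable_fun setT g.
  apply/(measurable_restrictT _ _).1; first exact: measurableX.
  exact/measurable_EFinP.
have g1 s : D s -> g \o pair s = (EFin \o f s) \_ E.
  by move=> Ds; apply/funext => r /=; rewrite gE patchE mem_set.
have g1' s : ~ D s -> g \o pair s = cst 0%E.
  by move=> Ds; apply/funext => r /=; rewrite gE memNset.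
have g2 r : E r -> (fun s => g (s, r)) = (EFin \o f^~ r) \_ D.
  by move=> Er; apply/funext => s /=; rewrite gE patchE (mem_set Er) andbT.
have g2' r : ~ E r -> (fun s => g (s, r)) = cst 0%E.
  by move=> Er; apply/funext => s /=; rewrite gE (memNset Er) andbF.
have ig : (mu \x mu)%E.-integrable setT g.
  apply/integrable12ltyP => //.
  rewrite (_ : (\int[mu]_x _)%E = (\int[mu]_(s in D) \int[mu]_(r in E) `|f s r|%:E)%E)//.
  rewrite [RHS]integral_mkcond; apply: eq_integral => s _.
  rewrite patchE; case: ifPn => [/set_mem Ds|/negP sD].
    rewrite [RHS]integral_mkcond; apply: eq_integral => r _.
    by rewrite gE !patchE mem_set//=; case: ifP; rewrite ?abse0.
  under eq_integral => r _.
    rewrite gE (_ : s \in D = false) ?abse0; last exact/negP.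
    over.
  by rewrite integral0.
have [a1 a2] := (ae_integrable1 ig, ae_integrable2 ig).
have b1 : {ae mu, forall s, D s -> mu.-integrable E (EFin \o f s)}.
  apply: ae_imp a1 => s /= + Ds; rewrite -/(g \o pair s) g1// => h.
  by apply/integrable_mkcond.
have b2 : {ae mu, forall r, E r -> mu.-integrable D (EFin \o f^~ r)}.
  apply: ae_imp a2 => r /= + Er; rewrite g2// => h.
  by apply/integrable_mkcond.
have i1 := integrable_fubini_F ig.
(* Integrability of the second marginal: Tonelli for [|g|] gives measurability, and the iterated
   integral in the other order is finite. *)
have i2 : mu.-integrable setT (fubini_G mu g).
  have mgT : measurable_fun (setT : set (T * T)) (g : T * T -> _) by exact: mg.
  have ag : measurable_fun (setT : set (T * T)) (abse \o g : T * T -> _).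
    exact: measurableT_comp mgT.
  apply/integrableP; split; first exact: measurable_fubini_G ig.
  have fy : (\int[mu]_y \int[mu]_x `|g (x, y)| < +oo)%E by apply/integrable21ltyP.
  apply: le_lt_trans fy.
  apply: ge0_le_integral => //.
  - by apply: measurableT_comp => //; exact: measurable_fubini_G ig.
  - have h := @measurable_fun_fubini_tonelli_G _ _ T T R mu (abse \o g : T * T -> _) ag.
    by apply: h => ?; exact: abse_ge0.
  - move=> r _; apply: le_abse_integral => //.
    exact: measurableT_comp mg _.
have F := Fubini ig.
have c1 s : fubini_F mu g s = ((fun s => \int[mu]_(r in E) (f s r)%:E)%E \_ D) s.
  rewrite /fubini_F patchE; case: ifPn => [/set_mem Ds|/negP sD].
    by rewrite -/(g \o pair s) g1// -integral_mkcond.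
  by rewrite -/(g \o pair s) g1' ?integral0// => /mem_set.
have c2 r : fubini_G mu g r = ((fun r => \int[mu]_(s in D) (f s r)%:E)%E \_ E) r.
  rewrite /fubini_G patchE; case: ifPn => [/set_mem Er|/negP rE].
    by rewrite g2// -integral_mkcond.
  by rewrite g2' ?integral0// => /mem_set.
have j1 : mu.-integrable D (fun s => \int[mu]_(r in E) (f s r)%:E)%E.
  by apply/integrable_mkcond => //; move: i1; apply: eq_integrable => // s _; exact: c1.
have j2 : mu.-integrable E (fun r => \int[mu]_(s in D) (f s r)%:E)%E.
  by apply/integrable_mkcond => //; move: i2; apply: eq_integrable => // s _; exact: c2.
(* Off these sets of full measure the extended inner integral may be infinite, and [fine] would send
   it to [0]. *)
have [e1 e2] : {ae mu, forall s, D s ->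
      (\int[mu]_(r in E) (f s r)%:E)%E = (\int[mu]_(r in E) f s r)%:E} /\
    {ae mu, forall r, E r ->
      (\int[mu]_(s in D) (f s r)%:E)%E = (\int[mu]_(s in D) f s r)%:E}.
  split; [apply: ae_imp b1|apply: ae_imp b2] => s /= + Ds => /(_ Ds) h.
  - by rewrite fineK//; exact: integrable_fin_num h.
  - by rewrite fineK//; exact: integrable_fin_num h.
have k1 : mu.-integrable D (EFin \o (fun s => \int[mu]_(r in E) f s r)).
  exact: integrable_fine_EFin j1.
have k2 : mu.-integrable E (EFin \o (fun r => \int[mu]_(s in D) f s r)).
  exact: integrable_fine_EFin j2.
split => //; rewrite /Rintegral; congr fine.
transitivity (\int[mu]_(s in D) \int[mu]_(r in E) (f s r)%:E)%E.
  apply: ae_eq_integral => //; [exact: measurable_int k1|exact: measurable_int j1|].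
  by apply: ae_imp e1 => s /= h Ds; rewrite h.
transitivity (\int[mu]_(r in E) \int[mu]_(s in D) (f s r)%:E)%E; last first.
  apply: ae_eq_integral => //; [exact: measurable_int j2|exact: measurable_int k2].
rewrite [LHS]integral_mkcond [RHS]integral_mkcond.
transitivity (\int[mu]_s \int[mu]_r g (s, r))%E.
  by apply: eq_integral => s _; exact/esym/c1.
by rewrite F; apply: eq_integral => r _; exact: c2.
Qed.

(** The integral of a nonnegative function is a supremum over the simple functions below it, and
    those below [f] lie below [g]; measurability does not enter. This serves for inner integrals,
    whose measurability in the outer variable is not known in advance. *)
Lemma le_integral_ge0 (D : set R) (f g : R -> \bar R) :
  (forall x, D x -> 0 <= f x)%E -> (forall x, D x -> f x <= g x)%E ->
  (\int[mu]_(x in D) f x <= \int[mu]_(x in D) g x)%E.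
Proof.
move=> f0 fg; have g0 x : D x -> (0 <= g x)%E by move=> Dx; exact: le_trans (f0 _ Dx) (fg _ Dx).
rewrite [leLHS]integral_mkcond [leRHS]integral_mkcond !ge0_integralTE; last 2 first.
- by move=> x; rewrite patchE; case: ifPn => // /set_mem /g0.
- by move=> x; rewrite patchE; case: ifPn => // /set_mem /f0.
apply: ereal_sup_le => _ [h hf <-]; exists h => // x.
apply: le_trans (hf x) _; rewrite !patchE; case: ifPn => // /set_mem; exact: fg.
Qed.

Lemma fubini_box_dom (D E : set R) (f : R -> R -> R) (c : R -> R) :
  measurable D -> measurable E ->
  measurable_fun (D `*` E) (fun q : R * R => f q.1 q.2) ->
  mu.-integrable D (EFin \o c) ->
  (forall s, D s -> \int[mu]_(r in E) `|f s r|%:E <= (c s)%:E)%E ->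
  [/\ {ae mu, forall s, D s -> mu.-integrable E (EFin \o f s)},
      {ae mu, forall r, E r -> mu.-integrable D (EFin \o f^~ r)},
      mu.-integrable D (EFin \o (fun s => \int[mu]_(r in E) f s r)),
      mu.-integrable E (EFin \o (fun r => \int[mu]_(s in D) f s r)) &
      \int[mu]_(s in D) \int[mu]_(r in E) f s r =
      \int[mu]_(r in E) \int[mu]_(s in D) f s r].
Proof.
move=> mD mE mf ic hc; apply: fubini_box => //.
apply: (@le_lt_trans _ _ (\int[mu]_(s in D) (c s)%:E)%E).
  by apply: le_integral_ge0 => // s _; apply: integral_ge0 => r _; rewrite lee_fin.
by rewrite ltey_eq integrable_fin_num.
Qed.

End fubini_box.

(** * Primitives of integrable functions on [[0, 1]] *)

Section primitive.
Context {R : realType}.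
Implicit Types (f g h : R -> R) (x y : R).
Local Notation mu := (leb R).
Local Notation I01 := (`[0, 1]%classic : set R).

Definition prim f x := \int[mu]_(y in `[0, x]) f y.

Lemma sub01 x : x <= 1 -> `[0, x]%classic `<=` I01.
Proof. by move=> x1; apply: subset_itvl; rewrite bnd_simp. Qed.

Lemma int0x f x : int01 f -> x <= 1 -> mu.-integrable `[0, x]%classic (EFin \o f).
Proof. by move=> hf x1; apply: integrableS hf => //; exact: sub01. Qed.

Lemma prim0 f : prim f 0 = 0.
Proof. by rewrite /prim set_itv1 Rintegral_set1. Qed.

Lemma primB f x y : int01 f -> 0 <= x -> x <= y -> y <= 1 ->
  prim f y - prim f x = \int[mu]_(t in `]x, y]) f t.
Proof.
move=> hf x0 xy y1; rewrite /prim Rintegral_itvB//; exact: int0x.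
Qed.

Lemma prim_dist f x y : int01 f -> 0 <= x <= 1 -> 0 <= y <= 1 ->
  `|prim f y - prim f x| <= \int[mu]_(t in I01) `|f t|.
Proof.
move=> hf.
wlog xy : x y / x <= y.
  by move=> h x01 y01; case: (leP x y) => [|/ltW] xy; [exact: h|rewrite distrC; exact: h].
move=> /andP[x0 _] /andP[_ y1]; rewrite primB//.
have sub : `]x, y]%classic `<=` I01.
  by move=> t /=; rewrite !in_itv/= => /andP[xt ty]; rewrite (le_trans x0 (ltW xt)) (le_trans ty y1).
have hi : mu.-integrable `]x, y]%classic (EFin \o f) by apply: integrableS hf.
apply: le_trans (le_normr_Rintegral _ hi) _ => //.
rewrite /Rintegral fine_le//.
- by apply: integrable_fin_num => //; exact: integrable_norm hi.
- by apply: integrable_fin_num => //; exact: integrable_norm hf.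
apply: ge0_subset_integral => //.
by apply/measurable_EFinP; apply: measurableT_comp => //; apply/measurable_EFinP; exact: measurable_int hf.
Qed.

Lemma prim_bound f x : int01 f -> 0 <= x <= 1 -> `|prim f x| <= \int[mu]_(t in I01) `|f t|.
Proof.
move=> hf x01; have := @prim_dist f 0 x hf.
by rewrite prim0 subr0; apply => //; rewrite lexx ler01.
Qed.

Lemma prim_cont f : int01 f -> {within I01, continuous (prim f)}.
Proof. by move=> hf; exact: parameterized_integral_continuous. Qed.

Lemma within_cont_measurable f : {within I01, continuous f} -> measurable_fun I01 f.
Proof. by apply: subspace_continuous_measurable_fun. Qed.

Lemma prim_meas f : int01 f -> measurable_fun I01 (prim f).
Proof. by move=> /prim_cont /within_cont_measurable. Qed.

Lemma measurable_fun_fst (D E : set R) f : measurable D ->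
  measurable_fun D f -> measurable_fun (D `*` E) (fun q : R * R => f q.1).
Proof.
move=> mD mf; apply: (measurable_comp mD _ mf) => //.
- by move=> _ [[s r] [/= Ds _] <-].
- exact: measurable_funTS.
Qed.

Lemma measurable_fun_snd (D E : set R) f : measurable E ->
  measurable_fun E f -> measurable_fun (D `*` E) (fun q : R * R => f q.2).
Proof.
move=> mE mf; apply: (measurable_comp mE _ mf) => //.
- by move=> _ [[s r] [/= _ Er] <-].
- exact: measurable_funTS.
Qed.

(** Integration by parts without pointwise derivatives. Fubini's theorem for [f s * g r] on the
    triangle [s <= r] equates the integral of [f s * (prim g x - prim g s)] with that of
    [prim f r * g r]. *)
Lemma prim_mul f g x : int01 f -> int01 g -> 0 <= x <= 1 ->
  prim f x * prim g x = prim (fun t => f t * prim g t + prim f t * g t) x.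
Proof.
move=> hf hg /andP[x0 x1].
pose D := `[0, x]%classic : set R.
have hfx := int0x hf x1; have hgx := int0x hg x1.
have mf : measurable_fun D f by apply/measurable_EFinP; exact: measurable_int hfx.
have mg : measurable_fun D g by apply/measurable_EFinP; exact: measurable_int hgx.
pose F s r := if s <= r then f s * g r else 0.
have mD : measurable D by exact: measurable_itv.
have mF : measurable_fun (D `*` D) (fun q : R * R => F q.1 q.2).
  apply: measurable_fun_if.
  - exact: measurableX.
  - apply: measurable_fun_ler; apply: measurable_funTS; [exact: measurable_fst|exact: measurable_snd].
  - apply: (@measurable_funS _ _ _ _ (D `*` D)) => //.
      exact: measurableX.
    by apply: measurable_funM; [exact: measurable_fun_fst|exact: measurable_fun_snd].
  - exact: measurable_cst.
have hgn : mu.-integrable D (EFin \o (fun r => `|g r|)) by exact: integrable_norm hgx.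
pose c s := `|f s| * \int[mu]_(r in D) `|g r|.
have ic : mu.-integrable D (EFin \o c).
  have hfn : mu.-integrable D (EFin \o (fun r => `|f r|)) by exact: integrable_norm hfx.
  have : mu.-integrable D (fun s => (\int[mu]_(r in D) `|g r|)%:E * (`|f s|)%:E)%E.
    exact: integrableZl hfn.
  by apply: eq_integrable => // s _ /=; rewrite /c mulrC EFinM.
have Fc s : D s -> (\int[mu]_(r in D) `|F s r|%:E <= (c s)%:E)%E.
  move=> Ds; apply: (@le_trans _ _ (\int[mu]_(r in D) (`|f s| * `|g r|)%:E)%E).
    apply: le_integral_ge0 => r Dr; rewrite lee_fin// /F.
    by case: ifP => _; rewrite ?normrM// normr0 mulr_ge0.
  rewrite /c EFinM fineK; last exact: integrable_fin_num hgn.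
  have -> : (`|f s|%:E * \int[mu]_(r in D) `|g r|%:E = \int[mu]_(r in D) (`|f s|%:E * `|g r|%:E))%E.
    by rewrite integralZl.
  by [].
have [_ _ i1 i2 e] := @fubini_box_dom _ D D F c mD mD mF ic Fc.
have e1 s : D s -> \int[mu]_(r in D) F s r = f s * (prim g x - prim g s).
  rewrite /D/= in_itv/= => /andP[s0 sx].
  have sub : `[s, x]%classic `<=` D by apply: subset_itvr; rewrite bnd_simp.
  have gi : mu.-integrable `[s, x]%classic (EFin \o g) by apply: integrableS hgx.
  have gi' : mu.-integrable `]s, x]%classic (EFin \o g).
    by apply: integrableS gi => //; exact: subset_itv_oc_cc.
  rewrite primB// Rintegral_itv_obnd_cbnd// -RintegralZl//.
  transitivity (\int[mu]_(r in D) ((fun r => f s * g r) \_ `[s, x]) r).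
    apply: eq_Rintegral => r; rewrite inE/D/= in_itv/= => /andP[r0 rx].
    rewrite patchE /F; case: ifPn => [sr|sr]; first by rewrite mem_set//= in_itv/= sr rx.
    by rewrite memNset//= in_itv/= (negbTE sr).
  by rewrite -Rintegral_mkcondr; congr Rintegral; exact: setIidr.
have e2 r : D r -> \int[mu]_(s in D) F s r = prim f r * g r.
  rewrite /D/= in_itv/= => /andP[r0 rx].
  have sub : `[0, r]%classic `<=` D by apply: subset_itvl; rewrite bnd_simp.
  have fi : mu.-integrable `[0, r]%classic (EFin \o f) by apply: integrableS hfx.
  rewrite /prim -RintegralZr//.
  transitivity (\int[mu]_(s in D) ((fun s => f s * g r) \_ `[0, r]) s).
    apply: eq_Rintegral => s; rewrite inE/D/= in_itv/= => /andP[s0 sx].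
    rewrite patchE /F; case: ifPn => [sr|sr]; first by rewrite mem_set//= in_itv/= sr s0.
    by rewrite memNset//= in_itv/= (negbTE sr) andbF.
  by rewrite -Rintegral_mkcondr; congr Rintegral; exact: setIidr.
have {}i1 : mu.-integrable D (EFin \o (fun s => f s * (prim g x - prim g s))).
  apply: eq_integrable i1 => // s; rewrite inE => Ds /=.
  by rewrite e1.
have {}i2 : mu.-integrable D (EFin \o (fun r => prim f r * g r)).
  apply: eq_integrable i2 => // s; rewrite inE => Ds /=.
  by rewrite e2.
have i3 : mu.-integrable D (EFin \o (fun s => f s * prim g x)).
  by have := integrableZr _ (prim g x) hfx; exact.
have i4 : mu.-integrable D (EFin \o (fun s => f s * prim g s)).
  have := integrableB _ i3 i1; move/(_ (measurable_itv _)).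
  by apply: eq_integrable => // s _ /=; rewrite -EFinB; congr EFin; ring.
rewrite {3}/prim RintegralD//.
have {}e : \int[mu]_(s in D) (f s * (prim g x - prim g s)) = \int[mu]_(r in D) (prim f r * g r).
  transitivity (\int[mu]_(s in D) \int[mu]_(r in D) F s r).
    by apply: eq_Rintegral => s /set_mem /e1.
  by rewrite e; apply: eq_Rintegral => s /set_mem /e2.
rewrite -e {1}/prim -RintegralZr// -RintegralD//.
by apply: eq_Rintegral => s _; ring.
Qed.

End primitive.

(** * The spaces H1 and H10 *)

Section H1_kit.
Context {R : realType}.
Implicit Types (f g h : R -> R) (a B x y : R).
Local Notation mu := (leb R).
Local Notation I01 := (`[0, 1]%classic : set R).

(** Reduces a jet of order one to the primitive formula. That [f] is in [L^2] comes for free, a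
    primitive on [[0, 1]] being bounded and measurable. *)
Lemma is_DxP f g : is_Dx f g <->
  L2 g /\ (forall x, 0 <= x <= 1 -> f x = f 0 + prim g x).
Proof.
split=> [[F [F0 hL hD] <-]|[hg hD]].
  by split=> [|x x01]; [exact: hL|rewrite -F0; exact: hD].
have hi := L2_int hg.
exists (fun k => if k == 0%N then f else g) => //; split=> // k.
  case: k => [|k _] //= _.
  apply: (@L2_bounded _ _ (`|f 0| + \int[mu]_(t in I01) `|g t|)).
    apply: (@eq_measurable_fun _ _ _ _ _ (fun x => f 0 + prim g x)).
      by move=> x; rewrite inE/= in_itv/= => /hD.
    by apply: measurable_funD; [exact: measurable_cst|exact: prim_meas].
  move=> x x01; rewrite hD//; apply: le_trans (ler_normD _ _) _.
  by rewrite lerD2l prim_bound.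
by case: k.
Qed.

Lemma is_Dx_L2 f g : is_Dx f g -> L2 f.
Proof. by move=> [F [<- h _] _]; exact: h. Qed.

Lemma is_Dx_L2' f g : is_Dx f g -> L2 g.
Proof. by move=> /is_DxP[]. Qed.

Lemma is_DxE f g x : is_Dx f g -> 0 <= x <= 1 -> f x = f 0 + prim g x.
Proof. by move=> /is_DxP[_]; exact. Qed.

Lemma is_Dx_meas f g : is_Dx f g -> measurable_fun I01 f.
Proof. by move=> /is_Dx_L2[]. Qed.

Lemma eq_is_Dx f f' g : (forall x, 0 <= x <= 1 -> f x = f' x) -> is_Dx f g -> is_Dx f' g.
Proof.
move=> ff' /is_DxP[hg hD]; apply/is_DxP; split=> // x x01.
by rewrite -!ff' ?lexx ?ler01// hD.
Qed.

Lemma int01_norm_le f : L2 f -> \int[mu]_(t in I01) `|f t| <= L2norm f.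
Proof.
move=> hf.
have := cauchy_schwarz (L2_norm hf) (L2_cst 1); rewrite L2norm_norm.
have -> : L2norm (fun=> 1 : R) = 1.
  rewrite /L2norm /inner mulr1 Rintegral_cst//.
  by rewrite (_ : fine _ = 1) ?mulr1 ?sqrtr1//; exact: (congr1 fine mu01).
rewrite mulr1; apply: le_trans; apply: le_trans (ler_norm _).
by rewrite /inner le_eqVlt; apply/orP; left; apply/eqP; apply: eq_Rintegral => x _; rewrite mulr1.
Qed.

Lemma is_Dx_dist f g x y : is_Dx f g -> 0 <= x <= 1 -> 0 <= y <= 1 ->
  `|f x - f y| <= L2norm g.
Proof.
move=> fg x01 y01; rewrite (is_DxE fg x01) (is_DxE fg y01).
have -> : f 0 + prim g x - (f 0 + prim g y) = prim g x - prim g y by ring.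
have hg := is_Dx_L2' fg.
apply: le_trans (int01_norm_le hg).
by apply: prim_dist => //; exact: L2_int.
Qed.

Lemma is_DxD f f' g g' : is_Dx f f' -> is_Dx g g' ->
  is_Dx (fun x => f x + g x) (fun x => f' x + g' x).
Proof.
move=> /is_DxP[hf ef] /is_DxP[hg eg]; apply/is_DxP; split; first exact: L2D.
move=> x x01; rewrite ef// eg// /prim RintegralD//; first ring.
- by apply: int0x; [exact: L2_int|case/andP: x01].
- by apply: int0x; [exact: L2_int|case/andP: x01].
Qed.

Lemma is_DxZ a f f' : is_Dx f f' -> is_Dx (fun x => a * f x) (fun x => a * f' x).
Proof.
move=> /is_DxP[hf ef]; apply/is_DxP; split; first exact: L2Z.
move=> x x01; rewrite ef// /prim RintegralZl//; first ring.
by apply: int0x; [exact: L2_int|case/andP: x01].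
Qed.

Lemma is_DxN f f' : is_Dx f f' -> is_Dx (fun x => - f x) (fun x => - f' x).
Proof.
move=> /(is_DxZ (-1)); congr is_Dx; apply/funext => x; ring.
Qed.

Lemma is_DxB f f' g g' : is_Dx f f' -> is_Dx g g' ->
  is_Dx (fun x => f x - g x) (fun x => f' x - g' x).
Proof. by move=> hf /is_DxN; exact: is_DxD. Qed.

Lemma is_Dx_bounded f f' : is_Dx f f' -> exists2 B, 0 <= B & forall x, 0 <= x <= 1 -> `|f x| <= B.
Proof.
move=> ff'; exists (`|f 0| + L2norm f'); first by rewrite addr_ge0 ?L2norm_ge0.
move=> x x01; have -> : f x = f 0 + (f x - f 0) by ring.
apply: le_trans (ler_normD _ _) _; rewrite lerD2l.
by apply: is_Dx_dist => //; exact: in01_0.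
Qed.

Lemma is_Dx_L2_mul f f' g : is_Dx f f' -> L2 g -> L2 (fun x => f x * g x).
Proof.
move=> ff' hg; have [B _ hB] := is_Dx_bounded ff'.
by apply: L2_mul_bounded hg _ hB; exact: is_Dx_meas ff'.
Qed.

Lemma is_DxM f f' g g' : is_Dx f f' -> is_Dx g g' ->
  is_Dx (fun x => f x * g x) (fun x => f' x * g x + f x * g' x).
Proof.
move=> Df Dg; have hf := is_Dx_L2' Df; have hg := is_Dx_L2' Dg.
have hfg : L2 (fun x => f x * g' x) by exact: is_Dx_L2_mul Df hg.
have hgf : L2 (fun x => f' x * g x).
  by have := is_Dx_L2_mul Dg hf; congr L2; apply/funext => x; rewrite mulrC.
apply/is_DxP; split; first exact: L2D.
move=> x x01; have /andP[x0 x1] := x01.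
have xi (k : R -> R) : int01 k -> mu.-integrable `[0, x]%classic (EFin \o k) by move=> ?; exact: int0x.
(* [prim g'] differs from [g] by a constant, and likewise for [f], so this integrand is
   [f' g + f g'] up to multiples of [f'] and [g']. *)
have i0 : int01 (fun x => f' x * prim g' x + prim f' x * g' x).
  have : int01 (fun x => (f' x * g x + f x * g' x) + (- g 0 * f' x + - f 0 * g' x)).
    apply: int01D; first by apply: L2_int; exact: L2D.
    by apply: int01D; apply: int01Z; exact: L2_int.
  apply: eq_integrable => // y; rewrite inE/= in_itv/= => y01.
  by congr EFin; rewrite (is_DxE Df y01) (is_DxE Dg y01); ring.
transitivity (f 0 * g 0 + (f 0 * prim g' x + (g 0 * prim f' x + prim f' x * prim g' x))).
  by rewrite (is_DxE Df x01) (is_DxE Dg x01); ring.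
congr (_ + _); rewrite prim_mul//; try exact: L2_int.
rewrite /prim -!RintegralZl//; try by apply: xi; exact: L2_int.
rewrite -RintegralD//; last 2 first.
- by apply: xi; apply: int01Z; exact: L2_int.
- exact: xi.
rewrite -RintegralD//; last 2 first.
- by apply: xi; apply: int01Z; exact: L2_int.
- by apply: xi; apply: int01D => //; apply: int01Z; exact: L2_int.
apply: eq_Rintegral => y; rewrite inE/= in_itv/= => /andP[y0 yx].
have y01 : 0 <= y <= 1 by rewrite y0 (le_trans yx).
by rewrite (is_DxE Df y01) (is_DxE Dg y01) /prim; ring.
Qed.

Lemma integration_by_parts_H1 f f' g g' : is_Dx f f' -> is_Dx g g' ->
  inner f' g + inner f g' = f 1 * g 1 - f 0 * g 0.
Proof.
move=> Df Dg; have := is_DxE (is_DxM Df Dg) in01_1 => -> /=.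
rewrite addrAC subrr add0r /prim RintegralD//.
- by apply: L2_mul_integrable; [exact: is_Dx_L2' Df|exact: is_Dx_L2 Dg].
- by apply: L2_mul_integrable; [exact: is_Dx_L2 Df|exact: is_Dx_L2' Dg].
Qed.

Lemma inner_cst a : inner (fun=> a) (fun=> 1) = a :> R.
Proof.
rewrite /inner Rintegral_cst// (_ : fine _ = 1) ?mulr1//; exact: (congr1 fine mu01).
Qed.

(** The difference [f x ^+ 2 - f y ^+ 2] is an integral of [2 f f'], hence at most [2 |f| |f'|];
    averaging over [y] gives the bound. It makes point values small together with the [L^2] norm. *)
Lemma agmon f f' x : is_Dx f f' -> 0 <= x <= 1 ->
  f x ^+ 2 <= L2norm f ^+ 2 + 2 * L2norm f * L2norm f'.
Proof.
move=> Df x01; have hf := is_Dx_L2 Df; have hf' := is_Dx_L2' Df.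
have hff : L2 (fun x => f x * f' x) by exact: is_Dx_L2_mul Df hf'.
have h2ff : L2 (fun x => f' x * f x + f x * f' x).
  by have := L2Z 2 hff; congr L2; apply/funext => y; ring.
have h2n : \int[mu]_(t in I01) `|f' t * f t + f t * f' t| <= 2 * (L2norm f * L2norm f').
  have := cauchy_schwarz (L2_norm hf) (L2_norm hf'); rewrite !L2norm_norm => cs.
  apply: le_trans (ler_wpM2l _ (le_trans (ler_norm _) cs)) => //.
  rewrite -innerZl//; try exact: L2_norm.
  rewrite le_eqVlt; apply/orP; left; apply/eqP; apply: eq_Rintegral => y _.
  have -> : f' y * f y + f y * f' y = 2 * (f y * f' y) by ring.
  by rewrite normrM ger0_norm// normrM mulrA.
have key y : 0 <= y <= 1 -> f x ^+ 2 - 2 * (L2norm f * L2norm f') <= f y ^+ 2.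
  move=> y01; have D2 := is_DxM Df Df.
  have := prim_dist (L2_int h2ff) y01 x01.
  have := is_DxE D2 x01; have := is_DxE D2 y01; rewrite -!expr2 => ey ex.
  by move=> /(le_trans (ler_norm _)) /le_trans /(_ h2n); lra.
rewrite L2norm_sqr -lerBlDr -mulrA -(inner_cst (_ - _)); apply: le_Rintegral => //.
- by apply: L2_mul_integrable; exact: L2_cst.
- exact: L2_mul_integrable.
- by move=> y; rewrite /= in_itv/= mulr1 -expr2; exact: key.
Qed.

(** [2 f(x)] is [f(0) + f(1)] plus the integral of [f'] over [[0, x]] minus that over [[x, 1]], and
    these two integrals together are at most [|f'|]. Squaring a sum of three terms costs a factor
    [3], less than the [4] on the left. *)
Lemma triple_bound f f' x : is_Dx f f' -> 0 <= x <= 1 ->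
  f x ^+ 2 <= L2norm f' ^+ 2 + f 0 ^+ 2 + f 1 ^+ 2.
Proof.
move=> Df x01; have hf' := L2_int (is_Dx_L2' Df).
have /andP[x0 x1] := x01.
have ex := is_DxE Df x01; have e1 := is_DxE Df in01_1.
have h : `|prim f' x - (prim f' 1 - prim f' x)| <= L2norm f'.
  apply: le_trans (int01_norm_le (is_Dx_L2' Df)).
  have fx : mu.-integrable `[0, x]%classic (EFin \o f') by exact: int0x.
  have f1 : mu.-integrable `]x, 1]%classic (EFin \o f').
    apply: integrableS hf' => //; apply: subset_itvr; rewrite bnd_simp//.
  rewrite (primB hf' x0 x1 (lexx _)).
  apply: le_trans (ler_normB _ _) _.
  apply: le_trans (lerD (le_normr_Rintegral _ fx) (le_normr_Rintegral _ f1)) _ => //.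
  have n1 := integrable_norm hf'.
  have := Rintegral_itvB n1 (_ : (BLeft 0 <= BRight x)%O) (_ : (BRight x <= BRight 1)%O).
  rewrite !bnd_simp => /(_ x0 x1) <-.
  by rewrite addrCA subrr addr0.
have {}h : `|2 * f x - (f 0 + f 1)| <= L2norm f'.
  by apply: le_trans h; rewrite le_eqVlt; apply/orP; left; apply/eqP; congr `|_|; rewrite ex e1; ring.
have n0 := L2norm_ge0 f'; move: h; rewrite ler_norml => /andP[h1 h2].
set n := L2norm f' in n0 h1 h2 *.
have : (2 * f x) ^+ 2 <= (`|f 0| + `|f 1| + n) ^+ 2.
  rewrite -[leLHS]real_normK ?num_real// ler_sqr ?nnegrE ?addr_ge0//.
  rewrite ler_norml; have := ler_norm (f 0); have := ler_norm (f 1).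
  have := ler_norm (- f 0); have := ler_norm (- f 1); rewrite !normrN; lra.
rewrite -(real_normK (num_real (f 0))) -(real_normK (num_real (f 1))).
have := sqr_ge0 (`|f 0| - `|f 1|); have := sqr_ge0 (`|f 0| - n); have := sqr_ge0 (`|f 1| - n).
have := sqr_ge0 n; have := sqr_ge0 `|f 0|; have := sqr_ge0 `|f 1|.
nra.
Qed.

End H1_kit.

(** * Density of [H^1_0] in [L^2], in dual form *)

Section density.
Context {R : realType}.
Implicit Types (f g h phi : R -> R) (a b M N x y : R).
Local Notation mu := (leb R).
Local Notation I01 := (`[0, 1]%classic : set R).

Lemma C1_is_Dx phi phi' :
  (forall x, 0 <= x <= 1 -> is_derive x 1 phi (phi' x)) ->
  (forall x, 0 <= x <= 1 -> {for x, continuous phi'}) -> is_Dx phi phi'.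
Proof.
move=> hd hc.
have cw : {within I01, continuous phi'}.
  apply: continuous_in_subspaceT => x; rewrite inE/= in_itv/=; exact: hc.
have i01 : int01 phi' by apply: continuous_compact_integrable => //; exact: segment_compact.
apply/is_DxP; split.
  have [M [_ hM]] : bounded_set (phi' @` I01).
    apply: compact_bounded; apply: continuous_compact => //; exact: segment_compact.
  apply: (@L2_bounded _ _ (M + 1)); first exact: within_cont_measurable.
  by move=> x x01; apply: hM; [rewrite ltrDl|exists x => //=; rewrite in_itv].
move=> x /andP[]; rewrite le_eqVlt => /predU1P[<- _|x0 x1]; first by rewrite prim0 addr0.
have yx01 y : 0 <= y <= x -> 0 <= y <= 1 by move=> /andP[-> /le_trans]; exact.
have dphi y : 0 <= y <= x -> derivable phi y 1.
  by move=> /yx01 /hd [].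
have cphi y : 0 <= y <= x -> {for y, continuous phi}.
  by move=> /dphi /derivable1_diffP; exact: differentiable_continuous.
have := @continuous_FTC2 R phi' phi 0 x x0.
rewrite /prim /Rintegral => -> /=.
- by rewrite subrKC.
- apply: continuous_subspaceW cw; exact: sub01.
- split.
  + by move=> y; rewrite in_itv/= => /andP[y0 yx]; apply: dphi; rewrite !ltW.
  + by apply: cvg_at_right_filter; apply: cphi; rewrite lexx ltW.
  + by apply: cvg_at_left_filter; apply: cphi; rewrite lexx ltW.
- move=> y; rewrite in_itv/= => /andP[y0 yx].
  by rewrite derive1E; have [] := hd y _; rewrite // yx01// !ltW.
Qed.

(** Convergence is asked in the open interval only, because approximants in [H^1_0] stay [0] at the
    end points, which form a null set. *)
Lemma Rdominated (f_ : nat -> R -> R) f G :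
  (forall n, measurable_fun I01 (f_ n)) -> measurable_fun I01 f -> int01 G ->
  (forall x, 0 < x < 1 -> f_ ^~ x @ \oo --> f x) ->
  (forall n x, 0 <= x <= 1 -> `|f_ n x| <= G x) ->
  (\int[mu]_(x in I01) f_ n x) @[n --> \oo] --> \int[mu]_(x in I01) f x.
Proof.
move=> mf_ mf iG cf hG.
have [] := @dominated_convergence _ _ _ mu I01 mI01
  (fun n => EFin \o f_ n) (EFin \o f) (EFin \o G).
- move=> n; have h : measurable_fun I01 (EFin \o f_ n) by exact/measurable_EFinP.
  exact: h.
- have h : measurable_fun I01 (EFin \o f) by exact/measurable_EFinP.
  exact: h.
- exists ([set 0] `|` [set 1]); split.
  + by apply: measurableU; exact: measurable_set1.
  + rewrite null_set_setU//; try exact: measurable_set1; exact: lebesgue_measure_set1.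
  + move=> x /= /not_implyP[]; rewrite in_itv/= => /andP[x0 x1] h.
    apply: contrapT => /not_orP[/eqP xn0 /eqP xn1]; apply: h.
    apply: cvg_EFin; first exact: nearW.
    by apply: cf; rewrite !lt_neqAle x0 x1 eq_sym xn0 xn1.
- exact: iG.
- by apply: aeW => x n /=; rewrite in_itv/= lee_fin => /hG.
move=> i1 _; have fi : (\int[mu]_(x in I01) (EFin \o f) x)%E \is a fin_num.
  exact: integrable_fin_num i1.
by rewrite -(fineK fi) => h; exact: (fine_cvg h).
Qed.

Lemma is_Dx_cst a : is_Dx (fun=> a : R) (fun=> 0).
Proof.
by apply: C1_is_Dx => x _; exact: cvg_cst.
Qed.

Lemma is_Dx_id : is_Dx (fun x : R => x) (fun=> 1).
Proof.
by apply: C1_is_Dx => x _; exact: cvg_cst.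
Qed.

Lemma is_Dx_exp f f' n : is_Dx f f' -> exists g, is_Dx (fun x => f x ^+ n) g.
Proof.
move=> Df; elim: n => [|n [g Dg]].
  by exists (fun=> 0); exact: (is_Dx_cst 1).
have Dk := is_DxM Df Dg; eexists.
by apply: eq_is_Dx Dk => x _; rewrite exprS.
Qed.

(* The moving averages of a continuous function, cut off by the polynomials
   [1 - (1 - 2x)^(2n)], which tend to [1] inside the interval and vanish at its
   end points. *)
Lemma continuous_H10_approx g N : continuous g -> (forall x, `|g x| <= N) ->
  exists phi_ : nat -> R -> R,
  [/\ forall n, exists psi, is_Dx (phi_ n) psi,
      forall n, phi_ n 0 = 0 /\ phi_ n 1 = 0,
      forall n x, 0 <= x <= 1 -> `|phi_ n x| <= N &
      forall x, 0 < x < 1 -> phi_ ^~ x @ \oo --> g x].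
Proof.
move=> cg gN.
have N0 : 0 <= N by apply: le_trans (gN 0).
(* The base point [-1] makes [G] differentiable at the end point [0] as well. *)
pose G x := \int[mu]_(t in `[-1, x]) g t.
have dG x : -1 < x -> dat G x (g x).
  move=> x1; have ig : mu.-integrable `[-1, x + 1]%classic (EFin \o g).
    apply: continuous_compact_integrable; first exact: segment_compact.
    exact: continuous_subspaceT.
  have xx1 : x < x + 1 by rewrite ltrDl.
  have [d e] := continuous_FTC1_closed xx1 ig x1 (cg x).
  by split => //; rewrite -derive1E.
pose u n : R := n.+1%:R^-1.
have u0 n : 0 < u n by rewrite invr_gt0.
pose av n x := (u n)^-1 * (G (x + u n) - G x).
have dav n x : -1 < x -> dat (av n) x ((u n)^-1 * (g (x + u n) - g x)).
  move=> x1; apply: datZ; apply: datB; last exact: dG.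
  by apply: dat_shift; apply: dG; rewrite ltr_wpDr// ltW.
have Dav n : is_Dx (av n) (fun x => (u n)^-1 * (g (x + u n) - g x)).
  apply: C1_is_Dx => x /andP[x0 _].
    by apply: dav; rewrite (lt_le_trans _ x0)// ltrN10.
  apply: cvgM; first exact: cvg_cst.
  apply: cvgB; last exact: cg.
  apply: (@continuous_comp _ _ _ (fun x => x + u n) g); last exact: cg.
  by apply: cvgD; [exact: cvg_id|exact: cvg_cst].
have avN n x : 0 <= x <= 1 -> `|av n x| <= N.
  move=> /andP[x0 x1].
  have xx : x <= x + u n by rewrite lerDl ltW.
  have : `|G (x + u n) - G x| <= N * (x + u n - x).
    apply: (@dat_bound _ _ g) => //.
    - by move=> t /andP[xt _]; apply: dG; rewrite (lt_trans _ xt)// (lt_le_trans _ x0)// ltrN10.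
    - apply: continuous_in_subspaceT => t; rewrite inE/= in_itv/= => /andP[xt _].
      by apply: dat_cont (dG t _); rewrite (lt_le_trans _ xt)// (lt_le_trans _ x0)// ltrN10.
  rewrite (addrC x) addrK => h.
  rewrite /av normrM ger0_norm ?invr_ge0 ?(ltW (u0 n))// mulrC ler_pdivrMr//.
  by rewrite (addrC x).
pose chi n (x : R) := 1 - ((1 - 2 * x) ^+ 2) ^+ n.
have Dchi n : exists psi, is_Dx (chi n) psi.
  have D1 := is_DxB (is_Dx_cst 1) (is_DxZ 2 is_Dx_id).
  have [g2 D2] := is_Dx_exp 2 D1.
  have [g3 D3] := is_Dx_exp n D2.
  by have D4 := is_DxB (is_Dx_cst 1) D3; eexists; exact: D4.
have q01 (x : R) : 0 <= x <= 1 -> 0 <= (1 - 2 * x) ^+ 2 <= 1.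
  move=> /andP[x0 x1]; rewrite sqr_ge0/=; nra.
have chi01 n x : 0 <= x <= 1 -> 0 <= chi n x <= 1.
  move=> /q01 /andP[q0 q1]; rewrite subr_ge0 lerBlDr lerDl exprn_ge0// andbT.
  by rewrite exprn_ile1.
exists (fun n x => chi n x * av n x); split.
- move=> n; have [psi Dpsi] := Dchi n.
  by have D := is_DxM Dpsi (Dav n); eexists; exact: D.
- move=> n; rewrite /chi; have -> : 1 - 2 * 1 = -1 :> R by ring.
  by rewrite mulr0 subr0 sqrrN !expr1n subrr !mul0r.
- move=> n x x01; have /andP[c0 c1] := chi01 n x x01.
  rewrite normrM ger0_norm// -(mul1r N) ler_pM//; exact: avN.
- move=> x /andP[x0 x1].
  rewrite -(mul1r (g x)); apply: cvgM.
    rewrite -[X in _ --> X]subr0; apply: cvgB; first exact: cvg_cst.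
    apply: cvg_expr; rewrite ger0_norm ?sqr_ge0//; nra.
  apply: dat_quotient; first by apply: dG; rewrite (lt_trans _ x0)// ltrN10.
  + by move=> n; rewrite gt_eqF.
  + exact: cvg_harmonic.
Qed.

(** The functional [(F, .)] on [H^1_0] has norm at most [M] with respect to [L^2]. The next lemmas
    extend the bound to continuous, then to bounded test functions, and finally to [F] itself. *)
Definition H10_bound F M := forall phi psi, is_Dx phi psi -> phi 0 = 0 ->
  phi 1 = 0 -> `|inner F phi| <= M * L2norm phi.

Lemma H10_bound_continuous F M g N : L2 F -> H10_bound F M ->
  continuous g -> (forall x, `|g x| <= N) -> `|inner F g| <= M * L2norm g.
Proof.
move=> hF hM cg gN; have [phi_ [Dphi phi0 phiN phig]] := continuous_H10_approx cg gN.
have mphi n : measurable_fun I01 (phi_ n).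
  by have [psi D] := Dphi n; exact: is_Dx_meas D.
have mg : measurable_fun I01 g.
  by apply: within_cont_measurable; exact: continuous_subspaceT.
have N0 : 0 <= N by apply: le_trans (gN 0).
have l1 : inner F (phi_ n) @[n --> \oo] --> inner F g.
  apply: (@Rdominated _ _ (fun x => N * `|F x|)).
  - by move=> n; exact: measurable_funM hF.1 (mphi n).
  - exact: measurable_funM hF.1 mg.
  - by apply: int01Z; exact: integrable_norm (L2_int hF).
  - by move=> x x01; apply: cvgM; [exact: cvg_cst|exact: phig].
  - by move=> n x x01; rewrite normrM mulrC ler_wpM2r// phiN.
have l2 : inner (phi_ n) (phi_ n) @[n --> \oo] --> inner g g.
  apply: (@Rdominated _ _ (fun x => N * N)).
  - by move=> n; exact: measurable_funM.
  - exact: measurable_funM.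
  - exact: L2_int (L2_cst _).
  - by move=> x x01; apply: cvgM; exact: phig.
  - by move=> n x x01; rewrite normrM ler_pM// phiN.
have l1' : `|inner F (phi_ n)| @[n --> \oo] --> `|inner F g| by exact: cvg_norm l1.
have l2' : M * L2norm (phi_ n) @[n --> \oo] --> M * L2norm g.
  apply: cvgM; first exact: cvg_cst.
  exact: (@continuous_cvg _ _ _ _ _ _ Num.sqrt _ (@sqrt_continuous _ _) l2).
apply: (ler_cvg_to l1' l2').
by apply: nearW => n; have [psi D] := Dphi n; have [? ?] := phi0 n; exact: hM D _ _.
Qed.

Lemma H10_bound_bounded F M (b : R -> R) N : L2 F -> 0 <= M -> H10_bound F M ->
  measurable_fun I01 b -> (forall x, 0 <= x <= 1 -> `|b x| <= N) ->
  `|inner F b| <= M * L2norm b.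
Proof.
move=> hF M0 hM mb bN; have N0 : 0 <= N by apply: le_trans (bN 0 in01_0).
have hb : L2 b := L2_bounded mb bN.
have f01 : (mu I01 < +oo)%E by rewrite mu01 ltry.
have [g_ [cg ig eg]] := approximation_continuous_integrable mI01 f01 (L2_int hb).
(* [g_ k] clamped to [[- N, N]], written with absolute values so that continuity is immediate. *)
pose c_ k x := 2^-1 * (`|g_ k x + N| - `|g_ k x - N|).
have cE k x : c_ k x = Num.max (- N) (Num.min N (g_ k x)).
  rewrite /c_; case: (leP N (g_ k x)) => gN.
    rewrite max_r ?(le_trans _ N0) ?oppr_le0// !ger0_norm; lra.
  rewrite (ltr0_norm (_ : _ - N < 0)) ?subr_lt0//.
  by case: (leP (- N) (g_ k x)) => gN'; [rewrite ger0_norm|rewrite ltr0_norm]; lra.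
have cN k x : `|c_ k x| <= N.
  by rewrite cE ler_norml le_max lexx/= ge_max ge_min lexx/= andbT lerNl (le_trans _ N0)// oppr_le0.
have cc k : continuous (c_ k).
  move=> x; apply: cvgM; first exact: cvg_cst.
  apply: cvgB; apply: cvg_norm.
    by apply: cvgD; [exact: cg|exact: cvg_cst].
  by apply: cvgB; [exact: cg|exact: cvg_cst].
have hc k : L2 (c_ k).
  apply: (@L2_bounded _ _ N) => // ; apply: within_cont_measurable.
  exact: continuous_subspaceT.
(* Since [|b x - c_ k x| <= 2 * N], the [L^1] convergence of [g_] gives [L^2] convergence of
   [c_]. *)
have cb k x : 0 <= x <= 1 -> (b x - c_ k x) ^+ 2 <= 2 * N * `|b x - g_ k x|.
  move=> /bN; rewrite ler_norml => /andP[b1 b2].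
  have : `|b x - c_ k x| <= `|b x - g_ k x|.
    rewrite cE; case: (leP N (g_ k x)) => gN.
      rewrite max_r ?(le_trans _ N0) ?oppr_le0// [leRHS]ler0_norm ?subr_le0 ?(le_trans b2)//.
      by rewrite ler0_norm ?subr_le0//; lra.
    case: (leP (- N) (g_ k x)) => // gN'.
    rewrite [leRHS]ger0_norm ?subr_ge0 ?(le_trans (ltW gN'))//.
    by rewrite ger0_norm ?subr_ge0//; lra.
  have : `|b x - c_ k x| <= 2 * N.
    have := cN k x; rewrite !ler_norml; lra.
  rewrite -(real_normK (num_real (b x - c_ k x))).
  have := normr_ge0 (b x - c_ k x); nra.
pose e_ k := \int[mu]_(x in I01) `|b x - g_ k x|.
have ib k : int01 (fun x => `|b x - g_ k x|).
  have h : int01 (fun x => b x - g_ k x) by have := integrableB mI01 (L2_int hb) (ig k).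
  exact: integrable_norm h.
have e0 : e_ k @[k --> \oo] --> 0.
  have := eg; rewrite -[0%E]/((0:R)%:E) => /fine_cvg; apply: cvg_trans.
  by apply: near_eq_cvg; apply: nearW => k.
have dk k : L2norm (fun x => b x - c_ k x) <= Num.sqrt (2 * N * e_ k).
  rewrite /L2norm ler_sqrt; last first.
    by rewrite !mulr_ge0//; apply: Rintegral_ge0.
  rewrite /e_ -RintegralZl//; last exact: ib.
  apply: le_Rintegral => //.
  - by apply: L2_mul_integrable; exact: L2B.
  - exact: int01Z.
  - by move=> x; rewrite /= in_itv/= -expr2; exact: cb.
have key k : `|inner F b| <= M * L2norm b + (M + L2norm F) * Num.sqrt (2 * N * e_ k).
  have -> : inner F b = inner F (c_ k) + inner F (fun x => b x - c_ k x).
    by rewrite innerBr//; lra.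
  have h1 := H10_bound_continuous hF hM (cc k) (cN k).
  have h2 := cauchy_schwarz hF (L2B hb (hc k)).
  have h3 := L2norm_dist hb (hc k); move: h3; rewrite ler_norml => /andP[h3 _].
  have h4 := ler_normD (inner F (c_ k)) (inner F (fun x => b x - c_ k x)).
  have F0 := L2norm_ge0 F; have d0 := L2norm_ge0 (fun x => b x - c_ k x).
  have := dk k; nra.
have l2 : M * L2norm b + (M + L2norm F) * Num.sqrt (2 * N * e_ k) @[k --> \oo] --> M * L2norm b.
  rewrite -[X in _ --> X]addr0; apply: cvgD; first exact: cvg_cst.
  rewrite -[X in _ --> X](mulr0 (M + L2norm F)); apply: cvgM; first exact: cvg_cst.
  have h : 2 * N * e_ k @[k --> \oo] --> 2 * N * 0 by apply: cvgM; first exact: cvg_cst.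
  rewrite -[X in _ --> X]sqrtr0 -(mulr0 (2 * N)).
  exact: (@continuous_cvg _ _ _ _ _ _ Num.sqrt _ (@sqrt_continuous _ _) h).
by apply: (cvgr_to_ge l2); exact: nearW.
Qed.

(** Duality with the truncations [b_ n] of [F]: as [(F, b_ n) = |b_ n|^2], the bound gives
    [|b_ n| <= M], and dominated convergence recovers [|F|]. Truncating is needed because [F] itself
    is not a bounded test function. *)
Lemma L2norm_le_H10_bound F M : L2 F -> 0 <= M -> H10_bound F M -> L2norm F <= M.
Proof.
move=> hF M0 hM.
pose b_ n x := if `|F x| <= n%:R then F x else 0.
have mb n : measurable_fun I01 (b_ n).
  apply: measurable_fun_if => //.
  - apply: measurable_fun_ler; last exact: measurable_cst.
    by apply: measurableT_comp => //; exact: hF.1.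
  - by apply: (@measurable_funS _ _ _ _ I01) => //; exact: hF.1.
have bn n x : `|b_ n x| <= n%:R by rewrite /b_; case: ifP => //; rewrite normr0.
have hb n : L2 (b_ n) by exact: (L2_bounded (mb n) (fun x _ => bn n x)).
have bM n : inner (b_ n) (b_ n) <= M ^+ 2.
  have e : inner F (b_ n) = inner (b_ n) (b_ n).
    by apply: eq_Rintegral => x _; rewrite /b_; case: ifP => //; rewrite !mulr0.
  have := H10_bound_bounded hF M0 hM (mb n) (fun x _ => bn n x).
  rewrite e ger0_norm ?inner_ge0// -L2norm_sqr.
  have := L2norm_ge0 (b_ n); set l := L2norm (b_ n) => l0 h.
  suff : l <= M by move=> lM; nra.
  have [->//|ln0] := eqVneq l 0.
  by move: h; rewrite expr2 ler_pM2r// lt_neqAle eq_sym ln0.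
rewrite -ler_sqr ?nnegrE ?L2norm_ge0// L2norm_sqr.
have l : inner (b_ n) (b_ n) @[n --> \oo] --> inner F F.
  apply: (@Rdominated _ _ (fun x => F x ^+ 2)).
  - by move=> n; exact: measurable_funM.
  - exact: measurable_funM hF.1 hF.1.
  - exact: hF.2.
  - move=> x _; suff h : (fun n => b_ n x * b_ n x) @ \oo --> F x * F x by exact: h.
    apply: cvg_near_cst; near=> n.
    by rewrite /b_ ifT//; near: n; exact: nbhs_infty_ger.
  - move=> n x _; rewrite /b_; case: ifP => _; last by rewrite mul0r normr0 sqr_ge0.
    by rewrite -expr2 ger0_norm ?sqr_ge0.
by apply: (cvgr_to_le l); apply: nearW => n; exact: bM.
Unshelve. all: by end_near. Qed.

End density.

(** * Independence of derivatives and Sobolev norms from the chosen jet *)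

Section jets.
Context {R : realType}.
Implicit Types (f g h phi : R -> R) (x : R).

(** Fundamental lemma of the calculus of variations: for [phi] in [H^1_0],
    [(g, phi) = - (prim g, phi') = 0], so [g] has dual bound [0]. *)
Lemma L2norm_prim_eq0 g : L2 g -> (forall x, 0 <= x <= 1 -> prim g x = 0) ->
  L2norm g = 0.
Proof.
move=> hg g0; apply/eqP; rewrite eq_le L2norm_ge0 andbT.
apply: L2norm_le_H10_bound => // phi psi Dphi p0 p1.
have Dg : is_Dx (prim g) g.
  by apply/is_DxP; split=> // x _; rewrite prim0 add0r.
have := integration_by_parts_H1 Dg Dphi.
rewrite p0 p1 !mulr0 subrr.
have hpsi := is_Dx_L2' Dphi.
have -> : inner (prim g) psi = 0.
  rewrite (@eq_inner _ _ (fun x => 0 * psi x) _ psi)//; first by rewrite innerZl// mul0r.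
  by move=> x x01; rewrite g0// mul0r.
by rewrite addr0 => ->; rewrite normr0 mul0r.
Qed.

Lemma is_Dx_unique f f' g g' : is_Dx f g -> is_Dx f' g' ->
  (forall x, 0 <= x <= 1 -> f x = f' x) -> L2norm (fun x => g x - g' x) = 0.
Proof.
move=> D D' ff'; have DB := is_DxB D D'.
apply: L2norm_prim_eq0; first exact: is_Dx_L2' DB.
by move=> x x01; have := is_DxE DB x01; rewrite !ff' ?in01_0// !subrr add0r.
Qed.

Lemma eq_L2norm_sub f g : L2 f -> L2 g -> L2norm (fun x => f x - g x) = 0 ->
  L2norm f = L2norm g.
Proof.
move=> hf hg e; have := L2norm_dist hf hg.
by rewrite e normr_le0 subr_eq0 => /eqP.
Qed.

(** Agmon's inequality turns a vanishing [L^2] distance into equality at every point, end points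
    included. *)
Lemma H1_ae_eq f f' g g' x : is_Dx f g -> is_Dx f' g' ->
  L2norm (fun x => f x - f' x) = 0 -> 0 <= x <= 1 -> f x = f' x.
Proof.
move=> D D' e x01; have := agmon (is_DxB D D') x01.
rewrite e expr0n/= mulr0 mul0r addr0 => h; apply/eqP; rewrite -subr_eq0.
by rewrite -sqrf_eq0 eq_le h sqr_ge0.
Qed.

Lemma sobolev_jet_is_Dx m f F k : sobolev_jet m f F -> (k < m)%N -> is_Dx (F k) (F k.+1).
Proof.
move=> [_ hL hD] km; apply/is_DxP; split; first exact: hL.
by move=> x; exact: hD.
Qed.

Lemma is_Dx_sobolev_jet2 f g h : is_Dx f g -> is_Dx g h ->
  sobolev_jet 2 f (fun k => if k == 0%N then f else if k == 1%N then g else h).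
Proof.
move=> Df Dg; split=> //.
- move=> [|[|k]] _ /=; [exact: is_Dx_L2 Df|exact: is_Dx_L2 Dg|exact: is_Dx_L2' Dg].
- move=> [|[|k]] // _ x x01 /=; [exact: (is_DxE Df)|exact: (is_DxE Dg)].
Qed.

Lemma Dx_jet m f : in_H m f -> exists2 F, sobolev_jet m f F & Dx m f = F m.
Proof.
move=> [F hF]; rewrite /Dx.
set G := xget _ _; exists G => //.
by rewrite /G; case: xgetP => [_ -> //|/(_ F)].
Qed.

Lemma in_H1_is_Dx f : in_H 1 f -> is_Dx f (Dx 1 f).
Proof.
by move=> /Dx_jet[F jF ->]; exists F.
Qed.

Lemma is_Dx_in_H1 f g : is_Dx f g -> in_H 1 f.
Proof. by move=> [F jF _]; exists F. Qed.

Lemma Dx0E f : L2 f -> Dx 0 f = f.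
Proof.
move=> hf; have : in_H 0 f.
  by exists (fun=> f); split=> //.
by move=> /Dx_jet[F [F0 _ _] ->].
Qed.

Lemma L2norm_Dx1 f g : is_Dx f g -> L2norm (Dx 1 f) = L2norm g.
Proof.
move=> D; have D' := in_H1_is_Dx (is_Dx_in_H1 D).
apply: eq_L2norm_sub; [exact: is_Dx_L2' D'|exact: is_Dx_L2' D|].
exact: is_Dx_unique D' D _.
Qed.

(** [Dx] picks an arbitrary jet. Its first derivative agrees with [g] in [L^2], hence everywhere
    since both are in [H^1]; only then can the second derivatives be compared. *)
Lemma L2norm_Dx2 f g h : is_Dx f g -> is_Dx g h -> L2norm (Dx 2 f) = L2norm h.
Proof.
move=> Df Dg; have [|F jF ->] := @Dx_jet 2 f.
  by eexists; exact: is_Dx_sobolev_jet2 Df Dg.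
have [F0 _ _] := jF.
have D1 := sobolev_jet_is_Dx jF (isT : (0 < 2)%N).
have D2 := sobolev_jet_is_Dx jF (isT : (1 < 2)%N).
rewrite F0 in D1.
have e x : 0 <= x <= 1 -> F 1%N x = g x.
  by apply: H1_ae_eq D2 Dg _; exact: is_Dx_unique D1 Df _.
apply: eq_L2norm_sub; [exact: is_Dx_L2' D2|exact: is_Dx_L2' Dg|].
exact: is_Dx_unique D2 Dg e.
Qed.

Lemma Hnorm1_sqr f g : is_Dx f g -> Hnorm 1 f ^+ 2 = L2norm f ^+ 2 + L2norm g ^+ 2.
Proof.
move=> D; rewrite /Hnorm sqr_sqrtr; last by apply: sumr_ge0 => i _; exact: sqr_ge0.
by rewrite !big_ord_recr big_ord0 /= add0r (L2norm_Dx1 D) Dx0E//; exact: is_Dx_L2 D.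
Qed.

Lemma Hnorm2_sqr f g h : is_Dx f g -> is_Dx g h ->
  Hnorm 2 f ^+ 2 = L2norm f ^+ 2 + L2norm g ^+ 2 + L2norm h ^+ 2.
Proof.
move=> Df Dg; rewrite /Hnorm sqr_sqrtr; last by apply: sumr_ge0 => i _; exact: sqr_ge0.
rewrite !big_ord_recr big_ord0 /= add0r (L2norm_Dx1 Df) (L2norm_Dx2 Df Dg) Dx0E//.
exact: is_Dx_L2 Df.
Qed.

End jets.

(** * The weak form in space *)

Section spatial_form.
Context {R : realType}.
Implicit Types (p : params R) (a b phi : R -> R) (x y : R).

(** The boundary term of the weak form: [c] is [c_0] or [c_1], [w] is the drift [w_d] and [y] the
    boundary value. *)
Definition bdry (c w y : R) : R := (c + w) * y + 2 / (9 * c) * y ^+ 3.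

(** The weak form without its [w_t] and memory terms, so that coercivity and monotonicity become
    statements about one profile or two profiles, free of time. *)
Definition wform p a ax phi phix : R :=
  nu p * inner ax phix + wd p * inner ax phi + inner (fun x => a x * ax x) phi
  + bdry (c0 p) (wd p) (a 0) * phi 0 + bdry (c1 p) (wd p) (a 1) * phi 1.

(** What the minimum defining [beta] provides, unfolded into linear inequalities. *)
Definition coercive p (al be : R) : Prop :=
  [/\ 0 <= al, 0 < be & [/\ 2 * al + be <= nu p, 2 * al + be <= delta p,
    2 * al + be <= c0 p + wd p & 2 * al + be <= c1 p + wd p]].

Definition triple2 a ax : R := L2norm ax ^+ 2 + a 0 ^+ 2 + a 1 ^+ 2.

Lemma L2norm_sqr_le_triple a ax : is_Dx a ax -> L2norm a ^+ 2 <= triple2 a ax.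
Proof.
move=> D; rewrite L2norm_sqr; have ha := is_Dx_L2 D.
apply: le_trans (ler_norm _) _; apply: inner_le_bound => // x x01.
by rewrite -expr2 ger0_norm ?sqr_ge0//; exact: triple_bound.
Qed.

Lemma inner_Dx_self a ax : is_Dx a ax -> 2 * inner ax a = a 1 ^+ 2 - a 0 ^+ 2.
Proof.
move=> D; have := integration_by_parts_H1 D D.
by rewrite (innerC a ax) !expr2; lra.
Qed.

Lemma inner_burgers_self a ax : is_Dx a ax ->
  3 * inner (fun x => a x * ax x) a = a 1 ^+ 3 - a 0 ^+ 3.
Proof.
move=> D; have := integration_by_parts_H1 (is_DxM D D) D.
have ha := is_Dx_L2 D; have hax := is_Dx_L2' D.
have h1 : L2 (fun x => a x * ax x) by exact: is_Dx_L2_mul D hax.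
have -> : inner (fun x => ax x * a x + a x * ax x) a = 2 * inner (fun x => a x * ax x) a.
  by rewrite -innerZl//; apply: eq_inner => // x _; ring.
have -> : inner (fun x => a x * a x) ax = inner (fun x => a x * ax x) a.
  by rewrite /inner; apply: eq_Rintegral => x _; ring.
by rewrite !exprS expr0; lra.
Qed.

(** Tested with [a] itself, the drift and Burgers terms reduce to boundary values. The cubic ones
    are absorbed by the quadratic and quartic feedback terms; in the doubled form this leaves
    exactly [c_0 + w_d] for the square at [0], and at least [c_1 + w_d] at [1]. *)
Lemma wform_coercive p al be a ax : admissible p -> coercive p al be ->
  is_Dx a ax -> (2 * al + be) * triple2 a ax <= 2 * wform p a ax a ax.
Proof.
move=> [[nu0 rho0 de0] [c00 c10 wd0]] [al0 be0 [h1 h2 h3 h4]] D.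
have e1 := inner_Dx_self D; have e2 := inner_burgers_self D.
rewrite /wform /triple2 -L2norm_sqr /bdry.
set d := L2norm ax in e1 e2 *; set I1 := inner ax a in e1 e2 *.
set I2 := inner _ a in e2 *; set u := a 0 in e1 e2 *; set v := a 1 in e1 e2 *.
have key (c y : R) : 0 < c -> `|y ^+ 3| * 2 <= 3 * c * y ^+ 2 + y ^+ 4 / (3 * c).
  move=> cp; have c0' : c != 0 by rewrite gt_eqF.
  have e1' : (3 * c * y + y ^+ 2) ^+ 2 / (3 * c) = 3 * c * y ^+ 2 + y ^+ 4 / (3 * c) + 2 * y ^+ 3.
    by field.
  have e2' : (3 * c * y - y ^+ 2) ^+ 2 / (3 * c) = 3 * c * y ^+ 2 + y ^+ 4 / (3 * c) - 2 * y ^+ 3.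
    by field.
  have c3 : 0 <= 3 * c by rewrite mulr_ge0// ltW.
  have : 0 <= (3 * c * y + y ^+ 2) ^+ 2 / (3 * c) by rewrite divr_ge0 ?sqr_ge0.
  have : 0 <= (3 * c * y - y ^+ 2) ^+ 2 / (3 * c) by rewrite divr_ge0 ?sqr_ge0.
  rewrite e1' e2'; move: (y ^+ 3) (3 * c * y ^+ 2) (y ^+ 4 / (3 * c)) => Y A D'.
  by have [Y0|Y0] := leP 0 Y; [rewrite ger0_norm|rewrite ltr0_norm]; lra.
have ku := key _ u c00; have kv := key _ v c10.
have q4u : u ^+ 4 / (3 * c0 p) = 3 * (2 / (9 * c0 p) * u ^+ 3 * u) / 2.
  by have : c0 p != 0 by [rewrite gt_eqF]; move=> ?; field.
have q4v : v ^+ 4 / (3 * c1 p) = 3 * (2 / (9 * c1 p) * v ^+ 3 * v) / 2.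
  by have : c1 p != 0 by [rewrite gt_eqF]; move=> ?; field.
have u4 : 0 <= 2 / (9 * c0 p) * u ^+ 3 * u.
  rewrite -mulrA -exprSr mulr_ge0//; last by rewrite (_ : u ^+ 4 = (u ^+ 2) ^+ 2) ?sqr_ge0// -exprM.
  by rewrite divr_ge0// mulr_ge0// ltW.
have v4 : 0 <= 2 / (9 * c1 p) * v ^+ 3 * v.
  rewrite -mulrA -exprSr mulr_ge0//; last by rewrite (_ : v ^+ 4 = (v ^+ 2) ^+ 2) ?sqr_ge0// -exprM.
  by rewrite divr_ge0// mulr_ge0// ltW.
have := ler_norm (- v ^+ 3); have := ler_norm (u ^+ 3); rewrite normrN => nu3 nv3.
have d2 := sqr_ge0 d; have u2 := sqr_ge0 u; have v2 := sqr_ge0 v.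
rewrite q4u in ku; rewrite q4v in kv.
set U := 2 / (9 * c0 p) * u ^+ 3 in ku u4 *.
set V := 2 / (9 * c1 p) * v ^+ 3 in kv v4 *.
have m1 : (2 * al + be) * d ^+ 2 <= nu p * d ^+ 2 by rewrite ler_wpM2r.
have m2 : (2 * al + be) * u ^+ 2 <= (c0 p + wd p) * u ^+ 2 by rewrite ler_wpM2r.
have m3 : (2 * al + be) * v ^+ 2 <= (c1 p + wd p) * v ^+ 2 by rewrite ler_wpM2r.
have m4 : 0 <= nu p * d ^+ 2 by rewrite mulr_ge0// ltW.
have m5 : wd p * I1 = wd p * (v ^+ 2 - u ^+ 2) / 2 by rewrite -e1; field.
have m6 : 0 <= wd p * v ^+ 2 by rewrite mulr_ge0.
rewrite m5; lra.
Qed.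

(** With [s = a + b] and [u = b - a] the Burgers difference is [(s u)_x / 2], so it leaves the
    boundary values of [s u^2] and the pairing [(s u, u_x)]; the cubic feedback is monotone and has
    a good sign. [S] need not be small, since the loss is a multiple of [|u|^2], left to a Gronwall
    argument. *)
Lemma wform_monotone p al be a ax b bx S : admissible p -> coercive p al be ->
  is_Dx a ax -> is_Dx b bx -> 0 <= S ->
  (forall x, 0 <= x <= 1 -> `|a x| + `|b x| <= S) ->
  (2 * al - 16 / be * S ^+ 2) * L2norm (fun x => b x - a x) ^+ 2
  <= 2 * (wform p b bx (fun x => b x - a x) (fun x => bx x - ax x)
          - wform p a ax (fun x => b x - a x) (fun x => bx x - ax x)).
Proof.
move=> [[nu0 rho0 de0] [c00 c10 wd0]] [al0 be0 [h1 h2 h3 h4]] Da Db S0 hS.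
set u := fun x => b x - a x; set ux := fun x => bx x - ax x.
have Du : is_Dx u ux := is_DxB Db Da.
have Ds := is_DxD Da Db.
have Dsu := is_DxM Ds Du.
have hu := is_Dx_L2 Du; have hux := is_Dx_L2' Du.
have ha := is_Dx_L2 Da; have hax := is_Dx_L2' Da.
have hb := is_Dx_L2 Db; have hbx := is_Dx_L2' Db.
have hbb : L2 (fun x => b x * bx x) by exact: is_Dx_L2_mul Db hbx.
have haa : L2 (fun x => a x * ax x) by exact: is_Dx_L2_mul Da hax.
have e1 := inner_Dx_self Du.
pose s x := a x + b x.
have sS x : 0 <= x <= 1 -> `|s x| <= S by move=> /hS; apply: le_trans; exact: ler_normD.
have hsu : L2 (fun x => s x * u x) by exact: is_Dx_L2 Dsu.
have e2 : 2 * (inner (fun x => b x * bx x) u - inner (fun x => a x * ax x) u)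
    = s 1 * u 1 ^+ 2 - s 0 * u 0 ^+ 2 - inner (fun x => s x * u x) ux.
  have := integration_by_parts_H1 Dsu Du; rewrite -/s.
  have -> : inner (fun x => (ax x + bx x) * u x + s x * ux x) u =
      2 * (inner (fun x => b x * bx x) u - inner (fun x => a x * ax x) u).
    rewrite -innerBl// -innerZl//; last exact: L2B.
    by apply: eq_inner => // x _; rewrite /s /u /ux; ring.
  by rewrite /s !expr2 !mulrA; lra.
have b2 : `|inner (fun x => s x * u x) ux| <= S * L2norm u * L2norm ux.
  apply: le_trans (cauchy_schwarz hsu hux) _; rewrite ler_wpM2r ?L2norm_ge0//.
  by apply: L2norm_mul_le => //; exact: is_Dx_meas Ds.
have b0 := agmon Du in01_0; have b1 := agmon Du in01_1.
have nT := L2norm_sqr_le_triple Du.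
have s0 : `|s 0| <= S := sS 0 in01_0.
have s1 : `|s 1| <= S := sS 1 in01_1.
have e3 : inner bx ux = inner ax ux + L2norm ux ^+ 2.
  by rewrite L2norm_sqr -innerDl//; apply: eq_inner => // x _; rewrite /ux; ring.
have e4 : inner bx u = inner ax u + inner ux u.
  by rewrite -innerDl//; apply: eq_inner => // x _; rewrite /ux; ring.
have cub (c y z : R) : 0 < c -> 0 <= 2 / (9 * c) * (z ^+ 3 - y ^+ 3) * (z - y).
  move=> cp; rewrite -mulrA mulr_ge0//; first by rewrite divr_ge0// mulr_ge0// ltW.
  have -> : (z ^+ 3 - y ^+ 3) * (z - y) = (z - y) ^+ 2 * ((z + 2^-1 * y) ^+ 2 + 3 / 4 * y ^+ 2) by field.
  by rewrite mulr_ge0 ?sqr_ge0// addr_ge0 ?sqr_ge0// mulr_ge0 ?sqr_ge0.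
have k0 := cub _ (a 0) (b 0) c00; have k1 := cub _ (a 1) (b 1) c10.
rewrite /wform /bdry e3 e4.
set n := L2norm u in b2 b0 b1 nT *; set d := L2norm ux in b2 b0 b1 nT *.
have n0 : 0 <= n := L2norm_ge0 _; have d0 : 0 <= d := L2norm_ge0 _.
rewrite /triple2 -/d in nT.
set T := d ^+ 2 + u 0 ^+ 2 + u 1 ^+ 2 in nT.
(* [r] dominates both [n] and [d], so Agmon bounds [u 0 ^+ 2] and [u 1 ^+ 2] by [3 n r]. The
   nonlinear terms then total [3 + 3 + 1 = 7] times [S n r]. *)
pose r := Num.sqrt T.
have r0 : 0 <= r := sqrtr_ge0 _.
have T0 : 0 <= T by rewrite !addr_ge0 ?sqr_ge0.
have r2 : r ^+ 2 = T by rewrite sqr_sqrtr.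
have nr : n <= r by rewrite -ler_sqr ?nnegrE// r2.
have dr : d <= r by rewrite -ler_sqr ?nnegrE// r2 /T -addrA lerDl addr_ge0 ?sqr_ge0.
have u0b : u 0 ^+ 2 <= 3 * (n * r) by nra.
have u1b : u 1 ^+ 2 <= 3 * (n * r) by nra.
have NL : - (7 * S * (n * r)) <= s 1 * u 1 ^+ 2 - s 0 * u 0 ^+ 2 - inner (fun x => s x * u x) ux.
  have : `|s 1 * u 1 ^+ 2| <= S * (3 * (n * r)).
    by rewrite normrM (ger0_norm (sqr_ge0 _)) ler_pM ?sqr_ge0.
  have : `|s 0 * u 0 ^+ 2| <= S * (3 * (n * r)).
    by rewrite normrM (ger0_norm (sqr_ge0 _)) ler_pM ?sqr_ge0.
  have : S * n * d <= S * (n * r) by rewrite -mulrA !ler_wpM2l.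
  by move: b2; rewrite !ler_norml; lra.
(* Young's inequality against the spare [be * r ^+ 2] of coercivity; this is the origin of
   [16 / be]. *)
have yg : 8 * S * (n * r) <= be * r ^+ 2 + 16 / be * S ^+ 2 * n ^+ 2.
  have -> : 16 / be * S ^+ 2 * n ^+ 2 = (4 * S * n) ^+ 2 / be by field; rewrite gt_eqF.
  rewrite -subr_ge0.
  have -> : be * r ^+ 2 + (4 * S * n) ^+ 2 / be - 8 * S * (n * r) = (be * r - 4 * S * n) ^+ 2 / be.
    by field; rewrite gt_eqF.
  by rewrite divr_ge0 ?sqr_ge0// ltW.
have Snr : 0 <= S * (n * r) by rewrite !mulr_ge0.
have m1 : (2 * al + be) * d ^+ 2 <= nu p * d ^+ 2 by rewrite ler_wpM2r ?sqr_ge0.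
have m2 : (2 * al + be) * u 0 ^+ 2 <= (c0 p + wd p) * u 0 ^+ 2 by rewrite ler_wpM2r ?sqr_ge0.
have m3 : (2 * al + be) * u 1 ^+ 2 <= (c1 p + wd p) * u 1 ^+ 2 by rewrite ler_wpM2r ?sqr_ge0.
have m4 : 0 <= nu p * d ^+ 2 by rewrite mulr_ge0 ?sqr_ge0// ltW.
have m5 : 0 <= c0 p * u 0 ^+ 2 by rewrite mulr_ge0 ?sqr_ge0// ltW.
have m6 : 0 <= c1 p * u 1 ^+ 2 by rewrite mulr_ge0 ?sqr_ge0// ltW.
have m7 : 0 <= wd p * u 1 ^+ 2 by rewrite mulr_ge0 ?sqr_ge0.
have m8 : 2 * (wd p * inner ux u) = wd p * u 1 ^+ 2 - wd p * u 0 ^+ 2.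
  by rewrite -mulrBr -e1; ring.
have m9 : 2 * al * n ^+ 2 <= 2 * al * T by rewrite ler_wpM2l// mulr_ge0.
have m10 : be * r ^+ 2 = be * d ^+ 2 + be * u 0 ^+ 2 + be * u 1 ^+ 2 by rewrite r2 /T; ring.
have m11 : 2 * al * T = 2 * al * d ^+ 2 + 2 * al * u 0 ^+ 2 + 2 * al * u 1 ^+ 2 by rewrite /T; ring.
move: k0 k1; rewrite -/(u 0) -/(u 1) => k0 k1.
set I1 := inner ux u in m8 *; set I2 := inner ax ux; set I3 := inner ax u.
set J1 := inner _ u in e2 *; set J2 := inner _ u in e2 *.
set J3 := inner _ ux in e2 NL *.
set K0 := 2 / (9 * c0 p) in k0 *; set K1 := 2 / (9 * c1 p) in k1 *.
have q0 : (c0 p + wd p) * u 0 ^+ 2 = (c0 p + wd p) * b 0 * u 0 - (c0 p + wd p) * a 0 * u 0.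
  by rewrite /u; ring.
have q1 : (c1 p + wd p) * u 1 ^+ 2 = (c1 p + wd p) * b 1 * u 1 - (c1 p + wd p) * a 1 * u 1.
  by rewrite /u; ring.
lra.
Qed.

End spatial_form.

(** * Regularity in time *)

Section time_integrals.
Context {R : realType}.
Implicit Types (f : R -> R -> R) (k psi : R -> R) (x T B K : R).
Local Notation mu := (leb R).
Local Notation I01 := (`[0, 1]%classic : set R).

Lemma Rintegral_ae_eq (D : set R) (f g : R -> R) : measurable D ->
  measurable_fun D f -> measurable_fun D g ->
  {ae mu, forall x, D x -> f x = g x} ->
  \int[mu]_(x in D) f x = \int[mu]_(x in D) g x.
Proof.
move=> mD mf mg fg; rewrite /Rintegral; congr fine.
apply: ae_eq_integral => //; [exact/measurable_EFinP|exact/measurable_EFinP|].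
by apply: ae_imp fg => x h Dx; rewrite h.
Qed.

Definition strip : set (R * R) := [set q | 0 <= q.1 /\ 0 <= q.2 <= 1].

Lemma strip_box T : `]0, T]%classic `*` I01 `<=` strip.
Proof.
by move=> [s x] /= [+ +]; rewrite !in_itv/= => /andP[/ltW].
Qed.

Lemma measurable_strip : measurable strip.
Proof.
rewrite (_ : strip = `[0, +oo[%classic `*` I01).
  by apply: measurableX; exact: measurable_itv.
by apply/seteqP; split=> [[s x]|[s x]] /=; rewrite !in_itv/= andbT.
Qed.

Lemma measurable_fun_section f x T : measurable_fun strip (fun q : R * R => f q.1 q.2) ->
  0 <= x <= 1 -> measurable_fun `]0, T]%classic (fun s => f s x).
Proof.
move=> mf x01.
apply: (@measurable_comp _ _ _ _ _ _ strip (fun q : R * R => f q.1 q.2) _ (fun s => (s, x))) => //.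
- exact: measurable_strip.
- move=> _ [s sT <-]; split=> //=.
  by move: sT; rewrite /= in_itv/= => /andP[/ltW].
- by apply: measurable_funTS; exact: pair2_measurable.
Qed.

(** Pairing in space commutes with integration in time. It serves with [k = 1] for [w_t] and with
    [k s = expR (delta s)] for the memory. The interval omits [0] because [w_t] is controlled for
    positive times only. *)
Lemma time_fubini f k psi T B K : measurable_fun strip (fun q : R * R => f q.1 q.2) ->
  (forall s, 0 < s -> L2 (f s)) -> (forall s, 0 < s -> L2norm (f s) <= B) ->
  measurable_fun `]0, T]%classic k -> (forall s, 0 < s <= T -> `|k s| <= K) ->
  L2 psi ->
  let Z x := \int[mu]_(s in `]0, T]) (k s * f s x) in
  [/\ int01 Z, inner Z psi = \int[mu]_(s in `]0, T]) (k s * inner (f s) psi) &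
      mu.-integrable `]0, T]%classic (EFin \o (fun s => k s * inner (f s) psi))].
Proof.
move=> mf hL hB mk hK hpsi Z.
pose D := (`]0, T]%classic : set R).
have mD : measurable D by exact: measurable_itv.
have mfb : measurable_fun (D `*` I01) (fun q : R * R => f q.1 q.2).
  by apply: measurable_funS mf; [exact: measurable_strip|exact: strip_box].
have mkb : measurable_fun (D `*` I01) (fun q : R * R => k q.1).
  exact: measurable_fun_fst.
have fin (phi : R -> R) : L2 phi ->
  [/\ {ae mu, forall r, I01 r -> mu.-integrable D (EFin \o (fun s => k s * f s r * phi r))},
      mu.-integrable D (EFin \o (fun s => k s * inner (f s) phi)),
      int01 (fun x => \int[mu]_(s in D) (k s * f s x * phi x)) &
      \int[mu]_(s in D) (k s * inner (f s) phi) =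
      \int[mu]_(x in I01) \int[mu]_(s in D) (k s * f s x * phi x)].
  move=> hphi.
  have Kc : mu.-integrable D (EFin \o (fun=> `|K| * (B * L2norm phi))).
    apply: measurable_bounded_integrable => //.
      suff: (mu (`]0%R, T]%classic : set R) < +oo)%E by [].
      by rewrite lebesgue_measure_itv/=; case: ifP => _; rewrite ?ltry// -EFinD ltry.
    exists (`| `|K| * (B * L2norm phi) |); split; first exact: num_real.
    by move=> M /ltW h s _ /=.
  have innerE s : D s -> \int[mu]_(x in I01) (k s * f s x * phi x) = k s * inner (f s) phi.
    rewrite /D/= in_itv/= => /andP[s0 _]; rewrite /inner -RintegralZl//.
      by apply: eq_Rintegral => x _; rewrite mulrA.
    by apply: L2_mul_integrable => //; exact: hL.
  have dom s : D s -> (\int[mu]_(x in I01) `|k s * f s x * phi x|%:E <=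
      (`|K| * (B * L2norm phi))%:E)%E.
    move=> Ds; have /andP[s0 sT] : 0 < s <= T by move: Ds; rewrite /D/= in_itv.
    have hf := hL s s0.
    have hi := L2_mul_integrable (L2Z `|k s| (L2_norm hf)) (L2_norm hphi).
    apply: (@le_trans _ _ (inner (fun x => `|k s| * `|f s x|) (fun x => `|phi x|))%:E).
      rewrite /inner /Rintegral fineK; last exact: integrable_fin_num hi.
      by apply: le_integral_ge0 => x _; rewrite lee_fin// !normrM.
    rewrite lee_fin innerZl; [|exact: L2_norm..].
    apply: ler_pM => //.
    - by apply: Rintegral_ge0 => x _; rewrite mulr_ge0.
    - by apply: le_trans (hK s _) (ler_norm _); rewrite s0 sT.
    - apply: le_trans (ler_norm _) _; apply: le_trans (cauchy_schwarz (L2_norm hf) (L2_norm hphi)) _.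
      by rewrite !L2norm_norm ler_wpM2r ?L2norm_ge0// hB.
  have mF : measurable_fun (D `*` I01) (fun q : R * R => k q.1 * f q.1 q.2 * phi q.2).
    apply: measurable_funM; first exact: measurable_funM.
    by apply: measurable_fun_snd; [exact: measurable_itv|exact: hphi.1].
  have [_ i2 i3 i4 e] := @fubini_box_dom _ D I01 (fun s x => k s * f s x * phi x) _ mD
    (measurable_itv _) mF Kc dom.
  split => //.
  - by apply: eq_integrable i3 => // s /set_mem Ds /=; rewrite innerE.
  - by rewrite -e; apply: eq_Rintegral => s /set_mem Ds; rewrite innerE.
(* The test function [1] yields the integrability of [Z] and of almost every time section. *)
have [a1 b1 c1 e1] := fin _ (L2_cst 1).
have [a2 b2 c2 e2] := fin _ hpsi.
have iZ : int01 Z.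
  apply: eq_integrable c1 => // x _ /=; congr EFin.
  by apply: eq_Rintegral => s _; rewrite mulr1.
split=> //; rewrite e2 /inner.
(* The factor [psi x] leaves the time integral only where the section in time is integrable, hence
   for almost every [x]. *)
apply: Rintegral_ae_eq.
- exact: measurable_itv.
- apply: measurable_funM; last exact: hpsi.1.
  by apply/measurable_EFinP; exact: measurable_int iZ.
- by apply/measurable_EFinP; exact: measurable_int c2.
apply: ae_imp a1 => x /= h x01; rewrite /Z -RintegralZr//.
by apply: eq_integrable (h x01) => // s _ /=; rewrite mulr1.
Qed.

Lemma Rintegral_0oc_cc f x T : measurable_fun strip (fun q : R * R => f q.1 q.2) ->
  0 <= x <= 1 -> \int[mu]_(s in `]0, T]) f s x = \int[mu]_(s in `[0, T]) f s x.
Proof.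
move=> mf x01; rewrite /Rintegral integral_itv_obnd_cbnd//.
by apply/measurable_EFinP; exact: measurable_fun_section.
Qed.

End time_integrals.

Section time_primitive.
Context {R : realType}.
Implicit Types (m : R -> R) (s t T C : R).
Local Notation mu := (leb R).

Lemma Rintegral_oc_bound m s t C : mu.-integrable `]s, t]%classic (EFin \o m) ->
  s <= t -> (forall r, s < r <= t -> `|m r| <= C) ->
  `|\int[mu]_(r in `]s, t]) m r| <= C * (t - s).
Proof.
move=> im st hm; apply: le_trans (le_normr_Rintegral _ im) _ => //.
have lf : (mu `]s, t]%classic = (t - s)%:E)%E.
  rewrite lebesgue_measure_itv/= lte_fin; case: ltP => // ts.
  by rewrite (@le_anti _ _ s t) ?subrr// st ts.
have -> : C * (t - s) = \int[mu]_(r in `]s, t]) C.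
  by rewrite Rintegral_cst// (_ : fine _ = t - s)//; exact: (congr1 fine lf).
apply: le_Rintegral => //.
- exact: integrable_norm im.
- apply: measurable_bounded_integrable => //.
    suff : (mu (`]s, t]%classic : set R) < +oo)%E by [].
    rewrite lf; exact: ltry.
  by exists `|C|; split; [exact: num_real|move=> M /ltW h r _].
Qed.

Lemma primitive_lipschitz m T C : mu.-integrable `]0, T]%classic (EFin \o m) ->
  (forall r, 0 < r <= T -> `|m r| <= C) -> forall s t, 0 <= s <= T -> 0 <= t <= T ->
  `|\int[mu]_(r in `]0, t]) m r - \int[mu]_(r in `]0, s]) m r| <= C * `|t - s|.
Proof.
move=> im hm s t; wlog st : s t / s <= t.
  move=> h hs ht; case: (leP s t) => [st|/ltW ts]; first exact: h.
  by rewrite distrC (distrC t); exact: h.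
move=> /andP[s0 sT] /andP[t0 tT].
have it : mu.-integrable `]0, t]%classic (EFin \o m).
  by apply: integrableS im => //; apply: subset_itvl; rewrite bnd_simp.
rewrite Rintegral_itvB// ?bnd_simp//.
rewrite (ger0_norm (_ : 0 <= t - s)) ?subr_ge0//.
apply: Rintegral_oc_bound => //.
  by apply: integrableS it => //; apply: subset_itvr; rewrite bnd_simp.
by move=> r /andP[sr rt]; apply: hm; rewrite (le_lt_trans s0 sr) (le_trans rt tT).
Qed.

Lemma primitive_dat m t : 0 < t -> mu.-integrable `]0, t + 1]%classic (EFin \o m) ->
  {for t, continuous m} -> dat (fun y => \int[mu]_(r in `]0, y]) m r) t (m t).
Proof.
move=> t0 im cm; have tt1 : t < t + 1 by rewrite ltrDl.
have [|d e] := @continuous_FTC1 R m (BRight 0) t (t + 1) tt1 im _ cm.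
  by rewrite lte_fin.
by split => //; rewrite -derive1E.
Qed.

End time_primitive.

(** * The solution as a Lipschitz curve in [L^2] *)

Section regular_solution.
Context {R : realType}.
Local Notation mu := (leb R).
Local Notation I01 := (`[0, 1]%classic : set R).

(** The consequences of (A2) on which the estimates rest, with a single bound [B] uniform in time.
    Joint measurability is recorded for [wx] and [wt], whereas [wxx] and [wtx] are versions taken
    time by time. *)
Record regular_solution (p : params R) (w wx wxx wt wtx : R -> R -> R) (B : R) : Prop :=
  RegularSolution {
  rs_B : 0 <= B;
  rs_mwx : measurable_fun strip (fun q : R * R => wx q.1 q.2);
  rs_mwt : measurable_fun strip (fun q : R * R => wt q.1 q.2);
  rs_wx : forall t, 0 <= t -> is_Dx (w t) (wx t);
  rs_wxx : forall t, 0 <= t -> is_Dx (wx t) (wxx t);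
  rs_wtx : forall t, 0 < t -> is_Dx (wt t) (wtx t);
  rs_bw : forall t, 0 <= t -> L2norm (w t) <= B;
  rs_bwx : forall t, 0 <= t -> L2norm (wx t) <= B;
  rs_bwxx : forall t, 0 <= t -> L2norm (wxx t) <= B;
  rs_bwt : forall t, 0 < t -> L2norm (wt t) <= B;
  rs_rep : forall t, 0 <= t -> {ae mu, forall x, 0 <= x <= 1 ->
         w t x = w 0 x + \int[mu]_(s in `[0, t]) wt s x};
  rs_weak : forall t, 0 < t -> forall phi phix, is_Dx phi phix ->
     inner (wt t) phi + wform p (w t) (wx t) phi phix
     + rho p * inner (memory p wx t) phix = 0 }.

Context (p : params R) (w wx wxx wt wtx : R -> R -> R) (B : R).
Context (S : regular_solution p w wx wxx wt wtx B).
Implicit Types (psi : R -> R) (s t : R).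

Let B0 : 0 <= B. Proof. exact: rs_B S. Qed.
Let wL2 t : 0 <= t -> L2 (w t). Proof. by move=> /(rs_wx S) /is_Dx_L2. Qed.
Let wtL2 t : 0 < t -> L2 (wt t). Proof. by move=> /(rs_wtx S) /is_Dx_L2. Qed.

Lemma w_primitive psi t : L2 psi -> 0 <= t ->
  mu.-integrable `]0, t]%classic (EFin \o (fun s => inner (wt s) psi)) /\
  inner (w t) psi = inner (w 0) psi + \int[mu]_(s in `]0, t]) inner (wt s) psi.
Proof.
move=> hpsi t0.
have mk : measurable_fun (`]0, t]%classic : set R) (fun=> 1 : R) by exact: measurable_cst.
have [iZ eZ i1] := time_fubini (rs_mwt S) wtL2 (rs_bwt S) mk
  (fun s _ => le_refl `|1 : R|) hpsi.
have e1 (s : R) : 1 * inner (wt s) psi = inner (wt s) psi by rewrite mul1r.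
split; first by apply: eq_integrable i1 => // s _ /=; rewrite mul1r.
have {}eZ : inner (fun x => \int[mu]_(s in `]0, t]) (1 * wt s x)) psi =
   \int[mu]_(s in `]0, t]) inner (wt s) psi.
  by rewrite eZ; apply: eq_Rintegral => s _; rewrite mul1r.
rewrite -eZ addrC; apply/eqP; rewrite -subr_eq -innerBl//; [apply/eqP|exact: wL2|exact: wL2].
have mZ : measurable_fun I01 (fun x => \int[mu]_(s in `]0, t]) (1 * wt s x)).
  by apply/measurable_EFinP; exact: measurable_int iZ.
rewrite /inner; apply: Rintegral_ae_eq.
- exact: measurable_itv.
- apply: measurable_funM; last exact: hpsi.1.
  by apply: measurable_funB; [exact: (wL2 t0).1|exact: (wL2 (lexx 0)).1].
- by apply: measurable_funM mZ _; exact: hpsi.1.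
apply: ae_imp (rs_rep S t0) => x h x01.
have {}x01 : 0 <= x <= 1 by move: x01; rewrite /= in_itv.
rewrite h// addrAC subrr add0r -Rintegral_0oc_cc//; last exact: rs_mwt S.
by congr (_ * _); apply: eq_Rintegral => s _; rewrite mul1r.
Qed.

Lemma wt_inner_bound psi s : L2 psi -> 0 < s -> `|inner (wt s) psi| <= B * L2norm psi.
Proof.
move=> hpsi s0; apply: le_trans (cauchy_schwarz (wtL2 s0) hpsi) _.
by rewrite ler_wpM2r ?L2norm_ge0// (rs_bwt S).
Qed.

Lemma w_inner_lipschitz psi s t : L2 psi -> 0 <= s -> 0 <= t ->
  `|inner (w t) psi - inner (w s) psi| <= B * L2norm psi * `|t - s|.
Proof.
move=> hpsi s0 t0.
have [it ->] := w_primitive hpsi t0; have [is_ ->] := w_primitive hpsi s0.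
rewrite opprD addrACA subrr add0r.
have m0 : 0 <= Num.max s t by rewrite le_max s0.
have [iT _] := w_primitive hpsi m0.
apply: (primitive_lipschitz iT) => [r /andP[r0 _]||].
- exact: wt_inner_bound.
- by rewrite s0 le_max lexx.
- by rewrite t0 le_max lexx orbT.
Qed.

Lemma sqr_le_mul_self (n c : R) : 0 <= n -> n ^+ 2 <= c * n -> 0 <= c -> n <= c.
Proof.
move=> n0 h c0; have [->//|nn0] := eqVneq n 0.
by move: h; rewrite expr2 ler_pM2r// lt_neqAle eq_sym nn0.
Qed.

(** The weak Lipschitz bound, whose constant is linear in [|psi|], tested with the increment
    itself. *)
Lemma w_lipschitz s t : 0 <= s -> 0 <= t ->
  L2norm (fun x => w t x - w s x) <= B * `|t - s|.
Proof.
move=> s0 t0; have hu := L2B (wL2 t0) (wL2 s0).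
apply: sqr_le_mul_self; rewrite ?L2norm_ge0 ?mulr_ge0//.
rewrite L2norm_sqr [leLHS]innerBl//; try exact: wL2.
by apply: le_trans (ler_norm _) _; rewrite mulrAC; exact: w_inner_lipschitz.
Qed.

End regular_solution.

(** * Continuity in time of the terms of the weak form, and the memory variable *)

Section time_regularity.
Context {R : realType}.
Local Notation mu := (leb R).
Local Notation I01 := (`[0, 1]%classic : set R).
Context (p : params R) (w wx wxx wt wtx : R -> R -> R) (B : R).
Context (S : regular_solution p w wx wxx wt wtx B).
Implicit Types (phi psi : R -> R) (s t x T : R).

Let z := memory p wx.
Let B0 : 0 <= B. Proof. exact: rs_B S. Qed.
Let wL2 t : 0 <= t -> L2 (w t). Proof. by move=> /(rs_wx S) /is_Dx_L2. Qed.
Let wxL2 t : 0 <= t -> L2 (wx t). Proof. by move=> /(rs_wx S) /is_Dx_L2'. Qed.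

Lemma L2norm_diff_le (f g : R -> R) C : L2 f -> L2 g -> L2norm f <= C -> L2norm g <= C ->
  L2norm (fun x => f x - g x) <= 2 * C.
Proof.
move=> hf hg fC gC; have := L2norm_triangle hf (L2N hg).
by rewrite (L2normN hg); lra.
Qed.

(** Agmon's inequality interpolates between the Lipschitz bound in [L^2] and the uniform bound in
    [H^1], whence the exponent [1/2]. *)
Lemma w_sup_holder s t x : 0 <= s -> 0 <= t -> 0 <= x <= 1 ->
  `|w t x - w s x| <= 3 * B * Num.sqrt `|t - s|.
Proof.
move=> s0 t0 x01.
have D := is_DxB (rs_wx S t0) (rs_wx S s0).
have := agmon D x01; have n1 := w_lipschitz S s0 t0.
have n2 := L2norm_diff_le (wL2 t0) (wL2 s0) (rs_bw S t0) (rs_bw S s0).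
have d2 := L2norm_diff_le (wxL2 t0) (wxL2 s0) (rs_bwx S t0) (rs_bwx S s0).
have n0 := L2norm_ge0 (fun x => w t x - w s x).
have d0 := L2norm_ge0 (fun x => wx t x - wx s x).
set n := L2norm (fun x => w t x - _) in n1 n2 n0 *; set d := L2norm _ in d2 d0 *.
set u := w t x - w s x => h.
have q : 0 <= `|t - s| := normr_ge0 _.
rewrite -ler_sqr ?nnegrE ?mulr_ge0 ?sqrtr_ge0// real_normK ?num_real//.
rewrite exprMn sqr_sqrtr//; apply: le_trans h _.
have : n * (n + 2 * d) <= (B * `|t - s|) * (2 * B + 2 * (2 * B)).
  by apply: ler_pM; lra.
by have := sqr_ge0 B; move: q; set e := `|t - s|; nra.
Qed.

Lemma wx_sup s x : 0 <= s -> 0 <= x <= 1 -> `|wx s x| <= 2 * B.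
Proof.
move=> s0 x01; have := agmon (rs_wxx S s0) x01.
have := rs_bwx S s0; have := rs_bwxx S s0.
have := L2norm_ge0 (wx s); have := L2norm_ge0 (wxx s).
move: (L2norm (wx s)) (L2norm (wxx s)) => n d d0 n0 dB nB h.
rewrite -ler_sqr ?nnegrE ?mulr_ge0// real_normK ?num_real//; nra.
Qed.

Lemma w_sup s x : 0 <= s -> 0 <= x <= 1 -> `|w s x| <= 2 * B.
Proof.
move=> s0 x01; have := agmon (rs_wx S s0) x01.
have := rs_bw S s0; have := rs_bwx S s0.
have := L2norm_ge0 (w s); have := L2norm_ge0 (wx s).
move: (L2norm (w s)) (L2norm (wx s)) => n d d0 n0 dB nB h.
rewrite -ler_sqr ?nnegrE ?mulr_ge0// real_normK ?num_real//; nra.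
Qed.

(* Interpolation: [|u_x|^2 = [u u_x] - (u, u_xx)] with [u = w t - w s]. *)
Lemma wx_holder s t : 0 <= s -> 0 <= t ->
  L2norm (fun x => wx t x - wx s x) <= 6 * B * Num.sqrt (Num.sqrt `|t - s|).
Proof.
move=> s0 t0.
have D := is_DxB (rs_wx S t0) (rs_wx S s0).
have D' := is_DxB (rs_wxx S t0) (rs_wxx S s0).
have wxxL2 r : 0 <= r -> L2 (wxx r) by move=> /(rs_wxx S) /is_Dx_L2'.
have dd := L2norm_diff_le (wxxL2 _ t0) (wxxL2 _ s0) (rs_bwxx S t0) (rs_bwxx S s0).
have := integration_by_parts_H1 D D'; rewrite -L2norm_sqr.
set r := Num.sqrt `|t - s|; have r0 : 0 <= r := sqrtr_ge0 _.
have nw : L2norm (fun x => w t x - w s x) <= 3 * B * r.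
  apply: L2norm_le_bound; first exact: is_Dx_L2 D.
    by rewrite !mulr_ge0.
  by move=> x x01; exact: w_sup_holder.
have := cauchy_schwarz (is_Dx_L2 D) (is_Dx_L2' D').
have n0 := L2norm_ge0 (fun x => w t x - w s x).
have d0 := L2norm_ge0 (fun x => wxx t x - wxx s x).
have bb x : 0 <= x <= 1 -> `|(w t x - w s x) * (wx t x - wx s x)| <= (3 * B * r) * (4 * B).
  move=> x01; rewrite normrM ler_pM//; first exact: w_sup_holder.
  have := wx_sup t0 x01; have := wx_sup s0 x01; rewrite !ler_norml; lra.
move=> cs e; have b0 := bb _ in01_0; have b1 := bb _ in01_1.
have : L2norm (fun x => w t x - w s x) * L2norm (fun x => wxx t x - wxx s x) <= (3 * B * r) * (2 * B).
  exact: ler_pM.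
move: cs b0 b1 e; set I := inner _ _; set X0 := (_ - _) * _; set X1 := (_ - _) * _.
set n2 := _ ^+ 2; rewrite !ler_norml => /andP[c1 c2] /andP[b1 b2] /andP[b3 b4] e h.
have {e h} : n2 <= 30 * B ^+ 2 * r by rewrite expr2; move: h; set N := _ * L2norm _ in c1 c2 *; lra.
rewrite /n2 => h; rewrite -ler_sqr ?nnegrE ?L2norm_ge0 ?mulr_ge0 ?sqrtr_ge0//.
rewrite exprMn (sqr_sqrtr r0); apply: le_trans h _.
have : 0 <= B ^+ 2 * r by rewrite mulr_ge0 ?sqr_ge0.
by rewrite exprMn; lra.
Qed.

Lemma sqrt_sqrt_cvg (C : R) : (C * Num.sqrt (Num.sqrt `|d|)) @[d --> (0 : R)] --> (0 : R).
Proof.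
rewrite -[X in _ --> X](mulr0 C); apply: cvgM; first exact: cvg_cst.
have e : Num.sqrt (Num.sqrt `|0 : R|) = 0 by rewrite normr0 !sqrtr0.
rewrite -[X in _ --> X]e.
apply: (@continuous_cvg _ _ _ _ _ _ Num.sqrt); first exact: sqrt_continuous.
apply: (@continuous_cvg _ _ _ _ _ _ Num.sqrt); first exact: sqrt_continuous.
by apply: cvg_norm; exact: cvg_id.
Qed.

Lemma sqrt_cvg (C : R) : (C * Num.sqrt `|d|) @[d --> (0 : R)] --> (0 : R).
Proof.
rewrite -[X in _ --> X](mulr0 C); apply: cvgM; first exact: cvg_cst.
have e : Num.sqrt `|0 : R| = 0 by rewrite normr0 sqrtr0.
rewrite -[X in _ --> X]e.
apply: (@continuous_cvg _ _ _ _ _ _ Num.sqrt); first exact: sqrt_continuous.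
by apply: cvg_norm; exact: cvg_id.
Qed.

Lemma wx_inner_continuous psi t : L2 psi -> 0 < t ->
  {for t, continuous (fun s => inner (wx s) psi)}.
Proof.
move=> hpsi t0.
apply: (modulus_continuous t0 (@sqrt_sqrt_cvg (6 * B * L2norm psi))) => s /andP[s0 _].
rewrite -innerBl//; try by apply: wxL2; exact: ltW.
apply: le_trans (cauchy_schwarz _ hpsi) _; first by apply: L2B; apply: wxL2; exact: ltW.
rewrite mulrAC ler_wpM2r ?L2norm_ge0//.
exact: wx_holder (ltW _) (ltW _).
Qed.

Lemma w_point_continuous x t : 0 <= x <= 1 -> 0 < t -> {for t, continuous (w^~ x)}.
Proof.
move=> x01 t0.
apply: (modulus_continuous t0 (@sqrt_cvg (3 * B))) => s /andP[s0 _].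
by apply: w_sup_holder => //; exact: ltW.
Qed.

Lemma wwx_L2 t : 0 <= t -> L2 (fun x => w t x * wx t x).
Proof. by move=> t0; exact: is_Dx_L2_mul (rs_wx S t0) (wxL2 t0). Qed.

(** Freezing [w] at time [t] splits the pairing into [(wx s, w t phi)], continuous because [w_x] is,
    and [(wx s, (w s - w t) phi)], small by the uniform Hölder bound on [w]. *)
Lemma wwx_inner_continuous phi phix t : is_Dx phi phix -> 0 < t ->
  {for t, continuous (fun s => inner (fun x => w s x * wx s x) phi)}.
Proof.
move=> Dphi t0; have hphi := is_Dx_L2 Dphi.
have hwp : L2 (fun x => w t x * phi x) by apply: is_Dx_L2_mul (rs_wx S (ltW t0)) hphi.
rewrite (_ : (fun s => _) = (fun s => inner (wx s) (fun x => w t x * phi x) +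
    inner (fun x => w s x * wx s x) phi - inner (wx s) (fun x => w t x * phi x))); last first.
  by apply/funext => s; ring.
have e s : 0 <= s -> inner (fun x => w s x * wx s x) phi - inner (wx s) (fun x => w t x * phi x)
    = inner (wx s) (fun x => (w s x - w t x) * phi x).
  move=> s0; have hsp : L2 (fun x => w s x * phi x) by apply: is_Dx_L2_mul (rs_wx S s0) hphi.
  have -> : inner (fun x => w s x * wx s x) phi = inner (wx s) (fun x => w s x * phi x).
    by apply: eq_Rintegral => x _; ring.
  rewrite -innerBr//; last exact: wxL2.
  by apply: eq_inner => // x _; ring.
under [X in {for _, continuous X}]eq_fun do rewrite -addrA.
apply: cvgD; first exact: wx_inner_continuous.
apply: (modulus_continuous t0 (@sqrt_cvg (B * (3 * B * L2norm phi)))) => s /andP[s0 _].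
rewrite !e ?(ltW t0) ?(ltW s0)//.
have -> : inner (wx t) (fun x => (w t x - w t x) * phi x) = 0.
  by rewrite (@eq_inner _ _ (wx t) _ (fun x => 0 * phi x)) ?innerZr ?mul0r//;
    [apply: wxL2; exact: ltW|move=> x _; rewrite subrr].
rewrite subr0.
have Dd := is_DxB (rs_wx S (ltW s0)) (rs_wx S (ltW t0)).
apply: le_trans (cauchy_schwarz (wxL2 (ltW s0)) (is_Dx_L2_mul Dd hphi)) _.
rewrite -mulrA; apply: ler_pM; rewrite ?L2norm_ge0//; first by apply: (rs_bwx S); exact: ltW.
rewrite mulrAC; apply: L2norm_mul_le => //; first exact: is_Dx_meas Dd.
  by rewrite !mulr_ge0 ?sqrtr_ge0.
by move=> x x01; apply: w_sup_holder => //; exact: ltW.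
Qed.

Lemma expR_measurable (c : R) (D : set R) : measurable_fun D (fun s => expR (c * s)).
Proof.
apply: measurable_funTS; apply: continuous_measurable_fun => s.
exact: dat_cont (dat_expR c s).
Qed.

Lemma expR_le_bound (c s t : R) : 0 <= c -> 0 < s <= t -> `|expR (c * s)| <= expR (c * t).
Proof.
by move=> c0_ /andP[s0 st]; rewrite ger0_norm ?expR_ge0// ler_expR ler_wpM2l.
Qed.

Context (dp : 0 < delta p).
Local Notation de := (delta p).

Lemma memory_integrable t x : 0 <= x <= 1 ->
  mu.-integrable `]0, t]%classic (EFin \o (fun s => expR (de * s) * wx s x)).
Proof.
move=> x01.
have mwx := measurable_fun_section (T := t) (rs_mwx S) x01.
have mm : measurable_fun `]0, t]%classic (fun s => expR (de * s) * wx s x).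
  by apply: measurable_funM => //; exact: expR_measurable.
apply: measurable_bounded_integrable => //.
    suff : (mu (`]0%R, t]%classic : set R) < +oo)%E by [].
    by rewrite lebesgue_measure_itv/=; case: ifP => _; rewrite ?ltry// -EFinD ltry.
  exists (expR (de * t) * (2 * B)); split; first exact: num_real.
  move=> M /ltW BM s /=; rewrite in_itv/= => /andP[s0 st]; apply: le_trans BM.
  rewrite normrM ler_pM//; first by apply: expR_le_bound; rewrite ?s0// ltW.
  by apply: wx_sup => //; exact: ltW.
Qed.

(** Factoring the kernel frees the integrand from [t], so that the product rule and the fundamental
    theorem of calculus apply to [z]. *)
Lemma memoryE t x : 0 <= x <= 1 ->
  z t x = expR (- de * t) * \int[mu]_(s in `]0, t]) (expR (de * s) * wx s x).
Proof.
move=> x01.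
have mwx := measurable_fun_section (T := t) (rs_mwx S) x01.
have ii := memory_integrable t x01.
rewrite /z /memory -RintegralZl//.
transitivity (\int[mu]_(s in `]0, t]) (expR (- de * (t - s)) * wx s x)).
  rewrite /Rintegral integral_itv_obnd_cbnd//; apply/measurable_EFinP.
  apply: measurable_funM => //.
  rewrite (_ : (fun s => _) = (fun s => expR (- de * t) * expR (de * s))).
    by apply: measurable_funM; [exact: measurable_cst|exact: expR_measurable].
  by apply/funext => s; rewrite -expRD; congr expR; ring.
apply: eq_Rintegral => s _; rewrite mulrA -expRD; congr (expR _ * _); ring.
Qed.

Lemma memory_primitive psi t : L2 psi -> 0 <= t ->
  [/\ L2 (z t), mu.-integrable `]0, t]%classic (EFin \o (fun s => expR (de * s) * inner (wx s) psi)) &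
  inner (z t) psi = expR (- de * t) * \int[mu]_(s in `]0, t]) (expR (de * s) * inner (wx s) psi)].
Proof.
move=> hpsi t0.
have mk : measurable_fun (`]0, t]%classic : set R) (fun s => expR (de * s)) by exact: expR_measurable.
have wxL2' s : 0 < s -> L2 (wx s) by move=> /ltW; exact: wxL2.
have wxB s : 0 < s -> L2norm (wx s) <= B by move=> /ltW; exact: rs_bwx S _.
have hk s : 0 < s <= t -> `|expR (de * s)| <= expR (de * t).
  by apply: expR_le_bound; exact: ltW.
have [iZ eZ i1] := time_fubini (rs_mwx S) wxL2' wxB mk hk hpsi.
have ez x : 0 <= x <= 1 -> z t x = expR (- de * t) * \int[mu]_(s in `]0, t]) (expR (de * s) * wx s x).
  by move=> x01; rewrite memoryE.
set Z := fun x => _ in iZ eZ.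
have mZ : measurable_fun I01 Z by apply/measurable_EFinP; exact: measurable_int iZ.
have hZ : L2 Z.
  apply: (@L2_bounded _ _ (expR (de * t) * (2 * B) * (t - 0))) => // x x01.
  apply: Rintegral_oc_bound => //.
    exact: memory_integrable.
  move=> r /andP[r0 rt]; rewrite normrM ler_pM//; first by apply: hk; rewrite r0.
  by apply: wx_sup => //; exact: ltW.
split=> //.
- have := L2Z (expR (- de * t)) hZ; case=> m1 i2; split.
    by apply: eq_measurable_fun m1 => x; rewrite inE/= in_itv/= => /ez ->.
  by apply: eq_integrable i2 => // x; rewrite inE/= in_itv/= => /ez ->.
- by rewrite -eZ -innerZl//; apply: eq_inner.
Qed.

Lemma memory_integrand_bound psi s t : L2 psi -> 0 < s <= t ->
  `|expR (de * s) * inner (wx s) psi| <= expR (de * t) * (B * L2norm psi).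
Proof.
move=> hpsi /andP[s0 st]; rewrite normrM ler_pM//.
  by apply: expR_le_bound; rewrite ?s0// ltW.
apply: le_trans (cauchy_schwarz (wxL2 (ltW s0)) hpsi) _.
by rewrite ler_wpM2r ?L2norm_ge0// (rs_bwx S)// ltW.
Qed.

Lemma memory_dat psi t : L2 psi -> 0 < t ->
  dat (fun s => inner (z s) psi) t (inner (wx t) psi - de * inner (z t) psi).
Proof.
move=> hpsi t0.
have t10 : 0 <= t + 1 by rewrite addr_ge0// ltW.
have [_ i1 _] := memory_primitive hpsi t10.
pose m s := expR (de * s) * inner (wx s) psi.
have cm : {for t, continuous m}.
  apply: cvgM; first exact: dat_cont (dat_expR _ _).
  exact: wx_inner_continuous.
have d1 := primitive_dat t0 i1 cm.
have d2 := datM (dat_expR (- de) t) d1.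
apply: (dat_pos t0) (dat_eq d2 _) => [y y0|].
  by have [_ _ ->] := memory_primitive hpsi (ltW y0).
have [_ _ ->] := memory_primitive hpsi (ltW t0).
rewrite /m mulrA -expRD (_ : - de * t + de * t = 0) ?expR0; last by ring.
by rewrite mul1r; ring.
Qed.

Lemma expR_decay_lipschitz s t : 0 <= s -> 0 <= t ->
  `|expR (- de * t) - expR (- de * s)| <= de * `|t - s|.
Proof.
wlog st : s t / s <= t.
  move=> h hs ht; case: (leP s t) => [st|/ltW ts]; first exact: h.
  by rewrite distrC (distrC t); exact: h.
move=> s0 t0; rewrite (ger0_norm (_ : 0 <= t - s)) ?subr_ge0//.
apply: (@dat_bound _ (fun r => expR (- de * r)) (fun r => - de * expR (- de * r))) => //.
- by move=> r _; exact: dat_expR.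
- move=> r /andP[sr _]; rewrite normrM normrN (gtr0_norm dp) ger0_norm ?expR_ge0//.
  rewrite -[leRHS]mulr1 ler_wpM2l ?(ltW dp)// -expR0 ler_expR mulNr oppr_le0.
  by rewrite mulr_ge0 ?(ltW dp)// (le_trans s0 (ltW sr)).
- by apply: continuous_subspaceT => r; exact: dat_cont (dat_expR _ _).
Qed.

(** [L] does not depend on [psi], so that [psi] may later be the increment of [z], which gives the
    Lipschitz bound in norm. *)
Lemma memory_inner_lipschitz T : 0 <= T -> exists2 L, 0 <= L & forall psi s t, L2 psi ->
  0 <= s <= T -> 0 <= t <= T -> `|inner (z t) psi - inner (z s) psi| <= L * L2norm psi * `|t - s|.
Proof.
move=> T0; exists (expR (de * T) * B * (1 + de * T)).
  by rewrite !mulr_ge0 ?expR_ge0// addr_ge0// mulr_ge0// ltW.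
move=> psi s t hpsi sT tT.
have /andP[s0 _] := sT; have /andP[t0 _] := tT.
have [_ i1 _] := memory_primitive hpsi T0.
have [_ _ ->] := memory_primitive hpsi s0.
have [_ _ ->] := memory_primitive hpsi t0.
set m := fun s => _ in i1.
pose J y := \int[mu]_(r in `]0, y]) m r; rewrite -/(J s) -/(J t).
pose C := expR (de * T) * (B * L2norm psi).
have C0 : 0 <= C by rewrite !mulr_ge0 ?expR_ge0 ?L2norm_ge0.
have mb r : 0 < r <= T -> `|m r| <= C by exact: memory_integrand_bound.
have J1 : `|J t - J s| <= C * `|t - s| by exact: primitive_lipschitz i1 mb _ _ sT tT.
have J2 : `|J s| <= C * T.
  have := primitive_lipschitz i1 mb (_ : 0 <= 0 <= T) sT.
  rewrite lexx T0 => /(_ isT); rewrite set_itvoc0 Rintegral_set0 !subr0 => /le_trans; apply.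
  by rewrite ler_wpM2l// ger0_norm//; case/andP: sT.
have E := expR_decay_lipschitz s0 t0.
have e1 : expR (- de * t) <= 1.
  by rewrite -expR0 ler_expR mulNr oppr_le0 mulr_ge0// ltW.
have -> : expR (- de * t) * J t - expR (- de * s) * J s =
  expR (- de * t) * (J t - J s) + (expR (- de * t) - expR (- de * s)) * J s by ring.
apply: le_trans (ler_normD _ _) _; rewrite !normrM (ger0_norm (expR_ge0 _)).
have a1 : expR (- de * t) * `|J t - J s| <= 1 * (C * `|t - s|) by apply: ler_pM; rewrite ?expR_ge0.
have a2 : `|expR (- de * t) - expR (- de * s)| * `|J s| <= (de * `|t - s|) * (C * T) by exact: ler_pM.
apply: le_trans (lerD a1 a2) _.
by rewrite le_eqVlt; apply/orP; left; apply/eqP; rewrite /C; ring.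
Qed.

Lemma memory_L2 t : 0 <= t -> L2 (z t).
Proof. by move=> /(memory_primitive (L2_cst 0))[]. Qed.

Lemma memory_lipschitz T : 0 <= T -> exists2 L, 0 <= L & forall s t,
  0 <= s <= T -> 0 <= t <= T -> L2norm (fun x => z t x - z s x) <= L * `|t - s|.
Proof.
move=> /memory_inner_lipschitz[L L0 h]; exists L => // s t sT tT.
have zs : L2 (z s) by apply: memory_L2; case/andP: sT.
have zt : L2 (z t) by apply: memory_L2; case/andP: tT.
have hu := L2B zt zs.
apply: sqr_le_mul_self; rewrite ?L2norm_ge0 ?mulr_ge0//.
rewrite L2norm_sqr [leLHS]innerBl//.
by apply: le_trans (ler_norm _) _; rewrite mulrAC; exact: h.
Qed.

Lemma continuous_pos (f g : R -> R) t : 0 < t -> (forall y, 0 < y -> f y = g y) ->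
  {for t, continuous f} -> {for t, continuous g}.
Proof.
move=> t0 fg; rewrite /prop_for /continuous_at -fg//; apply: cvg_trans.
apply: near_eq_cvg; near=> y; apply: fg; near: y; exact: lt_nbhsr.
Unshelve. all: by end_near. Qed.

(** Read off from the weak form, in which every other term is continuous in time; nothing is known
    about [w_tt]. This is what makes [(w, phi)] differentiable at every positive time, and it is why
    [phi] has to be in [H^1]. *)
Lemma wt_inner_continuous phi phix t : is_Dx phi phix -> 0 < t ->
  {for t, continuous (fun s => inner (wt s) phi)}.
Proof.
move=> Dphi t0; have hphi := is_Dx_L2 Dphi; have hphix := is_Dx_L2' Dphi.
pose g s := - wform p (w s) (wx s) phi phix - rho p * inner (z s) phix.
apply: (@continuous_pos g) => //.
  move=> y y0; have := rs_weak S y0 Dphi; rewrite /g -/z; lra.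
have cb c x : 0 <= x <= 1 -> {for t, continuous (fun s => bdry c (wd p) (w s x) * phi x)}.
  move=> x01; apply: cvgM; last exact: cvg_cst.
  have cw : {for t, continuous (w^~ x)} by exact: w_point_continuous.
  apply: cvgD; first by apply: cvgM; [exact: cvg_cst|exact: cw].
  apply: cvgM; first exact: cvg_cst.
  by apply: (@continuous_comp _ _ _ (w^~ x) (fun y : R => y ^+ 3)) => //; exact: exprn_continuous.
apply: cvgB.
  apply: cvgN; rewrite /wform.
  apply: cvgD; last exact: cb in01_1.
  apply: cvgD; last exact: cb in01_0.
  apply: cvgD; last exact: wwx_inner_continuous Dphi t0.
  apply: cvgD; apply: cvgM; first exact: cvg_cst.
  - exact: wx_inner_continuous.
  - exact: cvg_cst.
  - exact: wx_inner_continuous.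
apply: cvgM; first exact: cvg_cst.
exact: dat_cont (memory_dat hphix t0).
Qed.

Lemma w_dat phi phix t : is_Dx phi phix -> 0 < t ->
  dat (fun s => inner (w s) phi) t (inner (wt t) phi).
Proof.
move=> Dphi t0; have hphi := is_Dx_L2 Dphi.
have t10 : 0 <= t + 1 by rewrite addr_ge0// ltW.
have [i1 _] := w_primitive S hphi t10.
have d1 := primitive_dat t0 i1 (wt_inner_continuous Dphi t0).
apply: (dat_pos t0) (dat_eq (datD (dat_cst (inner (w 0) phi) t) d1) _) => [y y0|].
  by have [_ ->] := w_primitive S hphi (ltW y0).
by rewrite add0r.
Qed.

End time_regularity.

Section norm_derivative.
Context {R : realType}.

Lemma dat_L2norm_sqr (v : R -> R -> R) (t a L : R) : 0 < t ->
  (forall s, 0 < s -> L2 (v s)) ->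
  (forall s, 0 < s < t + 1 -> L2norm (fun x => v s x - v t x) <= L * `|s - t|) ->
  dat (fun s => inner (v s) (v t)) t a -> dat (fun s => L2norm (v s) ^+ 2) t (2 * a).
Proof.
move=> t0 hv hL hd.
pose r s := L2norm (fun x => v s x - v t x) ^+ 2.
have dr : dat r t 0.
  apply: (@dat_sq0 _ _ _ (L ^+ 2)) => // s s0; rewrite ger0_norm ?sqr_ge0//.
  rewrite -(real_normK (num_real (s - t))) -exprMn /r.
  have := hL s s0; have := L2norm_ge0 (fun x => v s x - v t x); nra.
have d := datD (datB (datZ 2 hd) (dat_cst (inner (v t) (v t)) t)) dr.
apply: (dat_pos t0) (dat_eq d _) => [s s0|]; last by rewrite subr0 addr0.
have hs := hv s s0; have ht := hv t t0.
rewrite /r !L2norm_sqr innerBl//; last exact: L2B.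
by rewrite !innerBr// (innerC (v t)); ring.
Qed.

End norm_derivative.

(** * Energy estimates *)

Lemma sqrtD_sqr_le {R : realType} (a b : R) : 0 <= a -> 0 <= b ->
  (Num.sqrt a + Num.sqrt b) ^+ 2 <= 2 * (a + b).
Proof.
move=> a0 b0; have := sqr_ge0 (Num.sqrt a - Num.sqrt b).
by rewrite -{3}(sqr_sqrtr a0) -{3}(sqr_sqrtr b0); move: (Num.sqrt a) (Num.sqrt b) => x y; lra.
Qed.

(** [U] and [Z] stand for the squared norms of the increments of [w] and [z], [A1] and [A2] for the
    spatial forms at [t + h] and [t], [J1] and [J2] for the memory terms. Over abstract reals the
    inequality is linear up to a few products. *)
Lemma incr_algebra {R : realType} (r d a U Z Q T A1 A2 I1 I2 J1 J2 K : R) :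
  (2 * a - T) * U <= 2 * (A1 - A2) -> T * U <= Q * U ->
  I1 + A1 + J1 = 0 -> I2 + A2 + J2 = 0 -> r * K = J1 - J2 ->
  0 <= r * Z -> 2 * a <= d -> 0 <= d -> 0 <= Q ->
  2 * (I1 - I2) + r * (2 * (K - d * Z)) <= (- (2 * a) + Q) * (U + r * Z).
Proof.
move=> M m0 W1 W2 e Z0 ad d0 Q0.
have -> : r * (2 * (K - d * Z)) = 2 * (r * K) - 2 * d * (r * Z) by ring.
rewrite e; move: Z0; move: (r * Z) => z Z0.
have m1 : 2 * a * z <= d * z by exact: ler_wpM2r.
have m2 : 0 <= d * z by exact: mulr_ge0.
have m3 : 0 <= Q * z by exact: mulr_ge0.
lra.
Qed.

Section energy.
Context {R : realType}.
Context (p : params R) (w wx wxx wt wtx : R -> R -> R) (B al be : R).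
Context (hp : admissible p) (hc : coercive p al be).
Context (S : regular_solution p w wx wxx wt wtx B).
Implicit Types (psi : R -> R) (s t x T h : R).

Local Notation z := (memory p wx).
Local Notation de := (delta p).
Let B0 : 0 <= B. Proof. exact: rs_B S. Qed.
Let wL2 t : 0 <= t -> L2 (w t). Proof. by move=> /(rs_wx S) /is_Dx_L2. Qed.
Let wxL2 t : 0 <= t -> L2 (wx t). Proof. by move=> /(rs_wx S) /is_Dx_L2'. Qed.
Let dp : 0 < de. Proof. by case: hp => [[]]. Qed.
Let rp : 0 < rho p. Proof. by case: hp => [[]]. Qed.
Let zL2 t : 0 <= t -> L2 (z t). Proof. exact: memory_L2 S dp _. Qed.
Let al0 : 0 <= al. Proof. by case: hc. Qed.
Let be0 : 0 < be. Proof. by case: hc. Qed.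
Let hde : 2 * al + be <= de. Proof. by case: hc => _ _ []. Qed.

Let al_de : 2 * al <= de. Proof. by move: hde be0; lra. Qed.

Lemma triple2_ge0 (a ax : R -> R) : 0 <= triple2 a ax.
Proof. by rewrite /triple2 !addr_ge0 ?sqr_ge0. Qed.

Lemma memory0 x : z 0 x = 0.
Proof. by rewrite /memory set_itv1 Rintegral_set1. Qed.

Lemma memory0_norm : L2norm (z 0) = 0.
Proof.
have -> : z 0 = fun=> 0 by apply/funext => x; exact: memory0.
by rewrite /L2norm /inner; under eq_Rintegral do rewrite mul0r; rewrite Rintegral_cst// mul0r sqrtr0.
Qed.

(** The weight [rho] makes the cross terms [(z, w_x)] of the two equations cancel in the
    derivative. *)
Definition energy0 t := L2norm (w t) ^+ 2 + rho p * L2norm (z t) ^+ 2.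

Let P t := triple2 (w t) (wx t).

Lemma L2norm_sqr_within (v : R -> R -> R) T L : (forall s, 0 <= s <= T -> L2 (v s)) ->
  (forall s t, 0 <= s <= T -> 0 <= t <= T -> L2norm (fun x => v t x - v s x) <= L * `|t - s|) ->
  {within `[0, T], continuous (fun s => L2norm (v s) ^+ 2)}.
Proof.
move=> hv hL.
have h : {within `[0, T], continuous (fun s => L2norm (v s))}.
  apply: (@lipschitz_within _ _ L) => s t hs ht.
  by apply: le_trans (L2norm_dist (hv _ hs) (hv _ ht)) _; exact: hL.
by move=> s; rewrite (_ : (fun s => _) = (fun s => L2norm (v s) * L2norm (v s)));
  [apply: cvgM; exact: h|apply/funext => r; rewrite expr2].
Qed.

Lemma energy0_within h T : 0 <= h -> 0 <= T ->
  {within `[0, T], continuous (fun s => energy0 (s + h))}.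
Proof.
move=> h0 T0.
have sh s : 0 <= s <= T -> 0 <= s + h <= T + h.
  by move=> /andP[s0 sT]; rewrite addr_ge0// lerD2r.
have dsh s t : t + h - (s + h) = t - s by ring.
have c1 : {within `[0, T], continuous (fun s => L2norm (w (s + h)) ^+ 2)}.
  apply: (@L2norm_sqr_within (fun s => w (s + h)) _ B) => [s /sh /andP[? _]|s t /sh /andP[? _] /sh /andP[? _]].
    exact: wL2.
  by rewrite -(dsh s t); apply: (w_lipschitz S).
have [L _ hL] := memory_lipschitz S dp (addr_ge0 T0 h0).
have c2 : {within `[0, T], continuous (fun s => L2norm (z (s + h)) ^+ 2)}.
  apply: (@L2norm_sqr_within (fun s => z (s + h)) _ L) => [s /sh /andP[? _]|s t /sh hs /sh ht].
    exact: zL2.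
  by rewrite -(dsh s t); exact: hL.
move=> s; apply: cvgD; first exact: c1.
by apply: cvgM; [exact: cvg_cst|exact: c2].
Qed.

Lemma energy0_dat t : 0 < t -> exists2 d, dat energy0 t d &
  d <= - (2 * al) * energy0 t - be * P t.
Proof.
move=> t0; have t0' := ltW t0.
have d1 : dat (fun s => L2norm (w s) ^+ 2) t (2 * inner (wt t) (w t)).
  apply: (@dat_L2norm_sqr _ _ _ _ B) => // [s s0|s /andP[s0 _]|].
  - exact: wL2 (ltW _).
  - by apply: (w_lipschitz S) => //; exact: ltW.
  - exact: w_dat S dp _ _ _ (rs_wx S t0') t0.
have d2 : dat (fun s => L2norm (z s) ^+ 2) t (2 * (inner (wx t) (z t) - de * inner (z t) (z t))).
  have [L L0 hL] := memory_lipschitz S dp (addr_ge0 t0' ler01 : 0 <= t + 1).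
  apply: (@dat_L2norm_sqr _ _ _ _ L) => // [s s0|s /andP[s0 st]|].
  - exact: zL2 (ltW _).
  - by apply: hL; move: s0 st t0; lra.
  - exact: memory_dat S dp _ _ (zL2 t0') t0.
eexists; first exact: datD d1 (datZ (rho p) d2).
have W := rs_weak S t0 (rs_wx S t0').
have C := wform_coercive hp hc (rs_wx S t0').
have nP := L2norm_sqr_le_triple (rs_wx S t0').
rewrite /energy0 -/(P t) in C nP *; rewrite -L2norm_sqr (innerC (wx t)).
have m1 : 0 <= rho p * L2norm (z t) ^+ 2 by rewrite mulr_ge0 ?sqr_ge0// ltW.
have m2 : (2 * al) * (rho p * L2norm (z t) ^+ 2) <= de * (rho p * L2norm (z t) ^+ 2).
  by rewrite ler_wpM2r//; move: hde be0; lra.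
have m3 : (2 * al) * L2norm (w t) ^+ 2 <= (2 * al) * P t by rewrite ler_wpM2l// mulr_ge0.
have m4 : 0 <= de * (rho p * L2norm (z t) ^+ 2) by rewrite mulr_ge0// ltW.
move: W C m1 m2 m3 m4; set I1 := inner (wt t) _; set W := wform _ _ _ _ _.
set I2 := inner (z t) _; set Z := L2norm (z t) ^+ 2; lra.
Qed.

Lemma energy0_decay t : 0 <= t -> expR (2 * al * t) * energy0 t <= L2norm (w 0) ^+ 2.
Proof.
move=> t0.
have -> : L2norm (w 0) ^+ 2 = expR (2 * al * 0) * energy0 0.
  by rewrite mulr0 expR0 mul1r /energy0 memory0_norm expr0n/= mulr0 addr0.
have cE : {within `[0, t], continuous energy0}.
  have := @energy0_within 0 t (lexx _) t0.
  have -> : (fun s => energy0 (s + 0)) = energy0 by apply/funext => s; rewrite addr0.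
  by [].
apply: (@dat_nonincr _ (fun s => expR (2 * al * s) * energy0 s)) => //.
- move=> s /andP[s0 _]; have [d dE h] := energy0_dat s0.
  eexists; first exact: datM (dat_expR _ _) dE.
  have e0 := expR_gt0 (2 * al * s).
  have P0 : 0 <= P s by rewrite /P /triple2 !addr_ge0 ?sqr_ge0.
  have -> : 2 * al * expR (2 * al * s) * energy0 s + expR (2 * al * s) * d =
    expR (2 * al * s) * (2 * al * energy0 s + d) by ring.
  rewrite pmulr_rle0//; have : 0 <= be * P s by rewrite mulr_ge0// ltW.
  lra.
- move=> s; apply: cvgM; last exact: cE.
  by apply: continuous_subspaceT => r; exact: dat_cont (dat_expR _ _).
Qed.

Lemma energy0_le t : 0 <= t -> energy0 t <= expR (- 2 * al * t) * L2norm (w 0) ^+ 2.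
Proof.
move=> /energy0_decay h; rewrite -(ler_pM2l (expR_gt0 (2 * al * t))); apply: le_trans h _.
by rewrite mulrA -expRD (_ : _ + _ = 0) ?expR0 ?mul1r//; ring.
Qed.

Definition increment h t x := w (t + h) x - w t x.

Definition energy_incr h t := L2norm (increment h t) ^+ 2
  + rho p * L2norm (fun x => z (t + h) x - z t x) ^+ 2.

Lemma energy_incr_within h T : 0 <= h -> 0 <= T ->
  {within `[0, T], continuous (energy_incr h)}.
Proof.
move=> h0 T0.
have sh s : 0 <= s <= T -> 0 <= s + h <= T + h.
  by move=> /andP[s0 sT]; rewrite addr_ge0// lerD2r.
have sh' s : 0 <= s <= T -> 0 <= s <= T + h.
  by move=> /andP[s0 sT]; rewrite s0 (le_trans sT)// lerDl.
have dsh s t : t + h - (s + h) = t - s by ring.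
have tri (v : R -> R -> R) L s t : (forall r, 0 <= r -> L2 (v r)) ->
  (forall a b, 0 <= a <= T + h -> 0 <= b <= T + h -> L2norm (fun x => v b x - v a x) <= L * `|b - a|) ->
  0 <= s <= T -> 0 <= t <= T ->
  L2norm (fun x => (v (t + h) x - v t x) - (v (s + h) x - v s x)) <= 2 * L * `|t - s|.
  move=> hv hL hs ht.
  have h1 := hL _ _ (sh _ hs) (sh _ ht); have h2 := hL _ _ (sh' _ hs) (sh' _ ht).
  rewrite dsh in h1.
  have /andP[a1 _] := sh _ hs; have /andP[a2 _] := sh _ ht.
  have /andP[a3 _] := hs; have /andP[a4 _] := ht.
  have := L2norm_triangle (L2B (hv _ a2) (hv _ a1)) (L2N (L2B (hv _ a4) (hv _ a3))).
  rewrite (L2normN (L2B (hv _ a4) (hv _ a3))).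
  rewrite (@L2norm_eq _ _ (fun x => (v (t + h) x - v t x) - (v (s + h) x - v s x))); last by move=> x _; ring.
  by lra.
have [L _ hL] := memory_lipschitz S dp (addr_ge0 T0 h0).
have c1 : {within `[0, T], continuous (fun s => L2norm (increment h s) ^+ 2)}.
  apply: (@L2norm_sqr_within (increment h) _ (2 * B)) => [s hs|s t hs ht].
    by have /andP[? _] := hs; have /andP[? _] := sh _ hs; apply: L2B; apply: wL2.
  by apply: tri => // a b /andP[? _] /andP[? _]; apply: (w_lipschitz S).
have c2 : {within `[0, T], continuous (fun s => L2norm (fun x => z (s + h) x - z s x) ^+ 2)}.
  apply: (@L2norm_sqr_within (fun s x => z (s + h) x - z s x) _ (2 * L)) => [s hs|s t hs ht].
    by have /andP[? _] := hs; have /andP[? _] := sh _ hs; apply: L2B; apply: zL2.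
  by apply: tri.
move=> s; apply: cvgD; first exact: c1.
by apply: cvgM; [exact: cvg_cst|exact: c2].
Qed.

(** The weak forms at [t + h] and [t] are both tested with the increment and subtracted.
    Monotonicity applies with [S] the sum of the square roots of [P t] and [P (t + h)], which bound
    [|w|] pointwise; squaring that sum turns [16 / be] into [32 / be]. *)
Lemma energy_incr_dat h t : 0 <= h -> 0 < t -> exists2 d, dat (energy_incr h) t d &
  d <= (- (2 * al) + 32 / be * (P t + P (t + h))) * energy_incr h t.
Proof.
move=> h0 t0; have t0' := ltW t0.
have th0 : 0 < t + h by rewrite ltr_wpDr.
have th0' := ltW th0.
have Du : is_Dx (increment h t) (fun x => wx (t + h) x - wx t x).
  exact: is_DxB (rs_wx S th0') (rs_wx S t0').
have hz : L2 (fun x => z (t + h) x - z t x) by apply: L2B; apply: zL2.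
have uL2 s : 0 < s -> L2 (increment h s).
  by move=> s0; apply: L2B; apply: wL2; rewrite ?addr_ge0// ltW.
have zzL2 s : 0 < s -> L2 (fun x => z (s + h) x - z s x).
  by move=> s0; apply: L2B; apply: zL2; rewrite ?addr_ge0// ltW.
have dsh s : s + h - (t + h) = s - t by ring.
have tri (v : R -> R -> R) L s : (forall r, 0 <= r -> L2 (v r)) ->
  (forall a b, 0 <= a <= t + 1 + h -> 0 <= b <= t + 1 + h -> L2norm (fun x => v b x - v a x) <= L * `|b - a|) ->
  0 < s < t + 1 ->
  L2norm (fun x => (v (s + h) x - v s x) - (v (t + h) x - v t x)) <= 2 * L * `|s - t|.
  move=> hv hL hs; have /andP[s0 s1] := hs; have s0' := ltW s0.
  have sh0 : 0 <= s + h by rewrite addr_ge0.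
  have h1 : L2norm (fun x => v (s + h) x - v (t + h) x) <= L * `|s + h - (t + h)|.
    by apply: hL; lra.
  have h2 : L2norm (fun x => v s x - v t x) <= L * `|s - t| by apply: hL; lra.
  rewrite dsh in h1.
  have := L2norm_triangle (L2B (hv _ sh0) (hv _ th0')) (L2N (L2B (hv _ s0') (hv _ t0'))).
  rewrite (L2normN (L2B (hv _ s0') (hv _ t0'))).
  rewrite (@L2norm_eq _ _ (fun x => (v (s + h) x - v s x) - (v (t + h) x - v t x))); last by move=> x _; ring.
  by lra.
have d1 : dat (fun s => L2norm (increment h s) ^+ 2) t
    (2 * (inner (wt (t + h)) (increment h t) - inner (wt t) (increment h t))).
  apply: (@dat_L2norm_sqr _ (increment h) _ _ (2 * B)) => // [s hs|].
    by apply: tri => // a b /andP[? _] /andP[? _]; apply: (w_lipschitz S).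
  have d2 := datB (dat_shift (w_dat S dp Du th0)) (w_dat S dp Du t0).
  apply: (dat_pos t0) d2 => s s0; rewrite innerBl//; last exact: uL2.
  - by apply: wL2; rewrite addr_ge0// ltW.
  - exact: wL2 (ltW _).
have d2 : dat (fun s => L2norm (fun x => z (s + h) x - z s x) ^+ 2) t
    (2 * (inner (wx (t + h)) (fun x => z (t + h) x - z t x) - inner (wx t) (fun x => z (t + h) x - z t x)
          - de * inner (fun x => z (t + h) x - z t x) (fun x => z (t + h) x - z t x))).
  have tT : 0 <= t + 1 + h by lra.
  have [L L0 hL] := memory_lipschitz S dp tT.
  apply: (@dat_L2norm_sqr _ (fun s x => z (s + h) x - z s x) _ _ (2 * L)) => // [s hs|].
    by apply: tri.
  have d3 := datB (dat_shift (memory_dat S dp hz th0)) (memory_dat S dp hz t0).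
  apply: (dat_pos t0) (dat_eq d3 _) => [s s0|].
    rewrite innerBl//; last 1 first.
    - exact: zL2 (ltW _).
    - by apply: zL2; rewrite addr_ge0// ltW.
  set psi := (fun x => z (t + h) x - z t x) in hz *.
  have -> : inner psi psi = inner (z (t + h)) psi - inner (z t) psi.
    by rewrite -innerBl//; exact: zL2.
  move: (inner (wx (t + h)) psi) (inner (wx t) psi) (inner (z (t + h)) psi) (inner (z t) psi).
  by move=> i1 i2 i3 i4; ring.
eexists; first exact: datD d1 (datZ (rho p) d2).
have W1 := rs_weak S th0 Du; have W2 := rs_weak S t0 Du.
have SP s x : 0 <= s -> 0 <= x <= 1 -> `|w s x| <= Num.sqrt (P s).
  move=> s0 x01; rewrite -ler_sqr ?nnegrE ?sqrtr_ge0// real_normK ?num_real//.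
  rewrite sqr_sqrtr; last by rewrite /P /triple2 !addr_ge0 ?sqr_ge0.
  exact: triple_bound (rs_wx S s0) x01.
have S0 : 0 <= Num.sqrt (P t) + Num.sqrt (P (t + h)) by rewrite addr_ge0 ?sqrtr_ge0.
have M := wform_monotone hp hc (rs_wx S t0') (rs_wx S th0') S0
  (fun x x01 => lerD (SP t x t0' x01) (SP (t + h) x th0' x01)).
have S2 : (Num.sqrt (P t) + Num.sqrt (P (t + h))) ^+ 2 <= 2 * (P t + P (t + h)).
  by apply: sqrtD_sqr_le; rewrite /P /triple2 !addr_ge0 ?sqr_ge0.
move: M; rewrite -/(increment h t); set T2 := (_ + _) ^+ 2 in S2 *; move=> M.
have n2 : 0 <= L2norm (increment h t) ^+ 2 := sqr_ge0 _.
have m0 : 16 / be * T2 * L2norm (increment h t) ^+ 2 <=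
   32 / be * (P t + P (t + h)) * L2norm (increment h t) ^+ 2.
  rewrite ler_wpM2r//.
  have -> : 32 / be * (P t + P (t + h)) = 16 / be * (2 * (P t + P (t + h))) by field; rewrite gt_eqF.
  by rewrite ler_wpM2l// divr_ge0// ltW.
rewrite /energy_incr.
have hwx1 := wxL2 th0'; have hwx2 := wxL2 t0'.
move: W1 W2; rewrite -/z.
set D := fun x => wx (t + h) x - wx t x => W1 W2.
have e1 : inner (z (t + h)) D - inner (z t) D =
    inner (wx (t + h)) (fun x => z (t + h) x - z t x) - inner (wx t) (fun x => z (t + h) x - z t x).
  rewrite -innerBl; [|exact: zL2|exact: zL2|exact: is_Dx_L2' Du].
  by rewrite innerC -innerBl.
rewrite -!L2norm_sqr.
have Z0 : 0 <= rho p * L2norm (fun x => z (t + h) x - z t x) ^+ 2.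
  by apply: mulr_ge0; [exact: ltW|exact: sqr_ge0].
have Q0 : 0 <= 32 / be * (P t + P (t + h)).
  apply: mulr_ge0; first by apply: divr_ge0 => //; exact: ltW.
  by apply: addr_ge0; exact: triple2_ge0.
apply: incr_algebra M m0 W1 W2 _ Z0 al_de (ltW dp) Q0.
by rewrite -e1 mulrBr.
Qed.

End energy.

(** * Decay of the increments and of [w_t] *)

Lemma decay_algebra {R : realType} (a b g e1 e2 Y Y' P1 P2 E1 E2 : R) :
  0 < b -> 0 <= e1 -> 0 <= e2 -> 0 <= Y -> g = 32 / b ^+ 2 ->
  Y' <= (- (2 * a) + 32 / b * (P1 + P2)) * Y -> E1 <= - b * P1 -> E2 <= - b * P2 ->
  (2 * a * e1 * Y + e1 * Y') * e2 + e1 * Y * (e2 * (g * (E1 + E2))) <= 0.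
Proof.
move=> b0 e10 e20 Y0 gE hY h1 h2.
have -> : (2 * a * e1 * Y + e1 * Y') * e2 + e1 * Y * (e2 * (g * (E1 + E2))) =
  (e1 * e2) * (2 * a * Y + Y' + g * Y * (E1 + E2)) by ring.
apply: mulr_ge0_le0; first exact: mulr_ge0.
have g0 : 0 <= g * Y by rewrite gE mulr_ge0// divr_ge0// sqr_ge0.
have : g * Y * (E1 + E2) <= g * Y * (- b * (P1 + P2)) by apply: ler_wpM2l => //; lra.
have -> : g * Y * (- b * (P1 + P2)) = - (32 / b * (P1 + P2) * Y).
  by rewrite gE; field; rewrite gt_eqF.
lra.
Qed.

Lemma gronwall_algebra {R : realType} (e k X M d : R) : 0 <= e -> e <= 1 -> 0 <= M ->
  d <= k * X + M -> - k * e * X + e * d - M * 1 <= 0.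
Proof.
move=> e0 e1 M0 hd; have := ler_wpM2l e0 hd; have := ler_wpM2r M0 e1; lra.
Qed.

Lemma regroup_algebra {R : realType} (e f m h : R) :
  e * (f * (h ^+ 2 * m)) = f * m * e * h ^+ 2.
Proof. ring. Qed.

Lemma le_drop_ge0 {R : realType} (d a e b q : R) :
  d <= - a * e - b * q -> 0 <= a * e -> d <= - b * q.
Proof. lra. Qed.

Lemma le_add_double {R : realType} (a b n : R) : a <= n -> b <= n -> a + b <= 2 * n.
Proof. lra. Qed.

(** Young's inequality with weight [h]: [2 f0 n <= h f0^2 + n^2 / h]. Over a time of length [h] the
    rate [1 / h] costs only a factor [e], while the source [h f0^2] integrates to order [h^2], as a
    squared increment requires. *)
Lemma initial_algebra {R : realType} (h r d a T U Z I1 A1 A2 F J K K0 n zn f0 x0 : R) :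
  0 < h -> 0 <= r -> 0 <= d -> 0 <= a -> 0 <= Z -> 0 <= U -> U = n ^+ 2 -> Z = zn ^+ 2 ->
  I1 + A1 + r * J = 0 -> A2 = - F -> J = K - K0 -> (2 * a - T) * U <= 2 * (A1 - A2) ->
  F <= f0 * n -> K0 <= zn * x0 -> 0 <= T ->
  2 * I1 + r * (2 * (K - d * Z)) <= (T + h^-1) * (U + r * Z) + h * (f0 ^+ 2 + r * x0 ^+ 2).
Proof.
move=> h0 r0 d0 a0 Z0 U0 UE ZE W -> JE M hF hK T0.
have yg (x y : R) : 2 * (x * y) <= h * x ^+ 2 + h^-1 * y ^+ 2.
  rewrite -subr_ge0.
  have -> : h * x ^+ 2 + h^-1 * y ^+ 2 - 2 * (x * y) = (h * x - y) ^+ 2 / h by field; rewrite gt_eqF.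
  by rewrite divr_ge0 ?sqr_ge0// ltW.
have y1 := yg f0 n; have y2 := ler_wpM2l r0 (yg x0 zn).
have k2 : r * (2 * K0) <= r * (2 * (x0 * zn)) by apply: ler_wpM2l => //; lra.
have m1 : 0 <= r * (d * Z) by rewrite !mulr_ge0.
have m2 : 0 <= a * U by rewrite mulr_ge0.
have m3 : 0 <= T * (r * Z) by rewrite !mulr_ge0.
rewrite -UE in y1; rewrite -ZE in y2.
have -> : r * (2 * (K - d * Z)) = 2 * (r * K) - 2 * (r * (d * Z)) by ring.
have rJ : r * J = r * K - r * K0 by rewrite JE; ring.
lra.
Qed.

Section decay.
Context {R : realType}.
Context (p : params R) (w wx wxx wt wtx : R -> R -> R) (B al be : R).
Context (hp : admissible p) (hc : coercive p al be).
Context (S : regular_solution p w wx wxx wt wtx B).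
Implicit Types (phi : R -> R) (s t x T h : R).

Local Notation z := (memory p wx).
Local Notation de := (delta p).
Local Notation E0 := (energy0 p w wx).
Local Notation Y := (energy_incr p w wx).
Let B0 : 0 <= B. Proof. exact: rs_B S. Qed.
Let wL2 t : 0 <= t -> L2 (w t). Proof. by move=> /(rs_wx S) /is_Dx_L2. Qed.
Let wxL2 t : 0 <= t -> L2 (wx t). Proof. by move=> /(rs_wx S) /is_Dx_L2'. Qed.
Let dp : 0 < de. Proof. by case: hp => [[]]. Qed.
Let rp : 0 < rho p. Proof. by case: hp => [[]]. Qed.
Let zL2 t : 0 <= t -> L2 (z t). Proof. exact: memory_L2 S dp _. Qed.
Let al0 : 0 <= al. Proof. by case: hc. Qed.
Let be0 : 0 < be. Proof. by case: hc. Qed.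

Lemma energy0_ge0 t : 0 <= E0 t.
Proof. by apply: addr_ge0; [exact: sqr_ge0|apply: mulr_ge0; [exact: ltW|exact: sqr_ge0]]. Qed.

Lemma energy_incr_ge0 h t : 0 <= Y h t.
Proof. by apply: addr_ge0; [exact: sqr_ge0|apply: mulr_ge0; [exact: ltW|exact: sqr_ge0]]. Qed.

Lemma energy0_le0 t : 0 <= t -> E0 t <= L2norm (w 0) ^+ 2.
Proof.
move=> t0; apply: le_trans (energy0_le hp hc S t0) _.
rewrite ler_piMl ?sqr_ge0// -expR0 ler_expR mulNr mulNr oppr_le0.
by rewrite !mulr_ge0.
Qed.

Lemma energy_incr_decay h t : 0 <= h -> 0 <= t ->
  Y h t <= expR (- 2 * al * t) * (expR (64 / be ^+ 2 * L2norm (w 0) ^+ 2) * Y h 0).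
Proof.
(* Chosen so that [g * be = 32 / be]: the dissipation [be * P] in the derivative of the energy,
   multiplied by [g], cancels the growth rate of the increments. *)
move=> h0 t0; pose g := 32 / be ^+ 2.
have g0 : 0 <= g by rewrite divr_ge0 ?sqr_ge0.
pose X s := E0 s + E0 (s + h).
pose G s := (expR (2 * al * s) * Y h s) * expR (g * X s).
have GG : G t <= G 0.
  apply: dat_nonincr => // [s /andP[s0 _]|].
    have [d1 dd1 l1] := energy0_dat hp hc S s0.
    have sh0 : 0 < s + h by rewrite ltr_wpDr.
    have [d2 dd2 l2] := energy0_dat hp hc S sh0.
    have [d3 dd3 l3] := energy_incr_dat hp hc S h0 s0.
    eexists.
      apply: datM; first exact: datM (dat_expR _ _) dd3.
      exact: dat_comp (is_derive_expR _) (datZ g (datD dd1 (dat_shift dd2))).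
    have aE r : 0 <= (2 * al) * E0 r by rewrite !mulr_ge0// energy0_ge0.
    apply: (decay_algebra be0 (expR_ge0 _) (expR_ge0 _) (energy_incr_ge0 h s) (erefl g) l3).
    - exact: le_drop_ge0 l1 (aE s).
    - exact: le_drop_ge0 l2 (aE (s + h)).
  have cX : {within `[0, t], continuous X}.
    have c1 := @energy0_within _ _ _ _ _ _ _ _ hp S 0 t (lexx _) t0.
    have c2 := @energy0_within _ _ _ _ _ _ _ _ hp S h t h0 t0.
    move=> s; apply: cvgD; last exact: c2.
    have -> : E0 = (fun s => E0 (s + 0)) by apply/funext => r; rewrite addr0.
    exact: c1.
  move=> s; apply: cvgM.
    apply: cvgM; last exact: (energy_incr_within hp S h0 t0).
    by apply: continuous_subspaceT => r; exact: dat_cont (dat_expR _ _).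
  apply: (@continuous_cvg _ _ _ _ _ _ expR); first exact: continuous_expR.
  by apply: cvgM; [exact: cvg_cst|exact: cX].
rewrite -(ler_pM2l (expR_gt0 (2 * al * t))) [leRHS]mulrA -expRD.
rewrite (_ : 2 * al * t + - 2 * al * t = 0); last by ring.
rewrite expR0 mul1r.
have X0 r : 0 <= g * X r by rewrite mulr_ge0// addr_ge0 ?energy0_ge0.
apply: (@le_trans _ _ (G t)).
  rewrite /G ler_peMr ?mulr_ge0 ?expR_ge0 ?energy_incr_ge0//.
  by rewrite -expR0 ler_expR.
apply: le_trans GG _; rewrite /G mulr0 expR0 mul1r mulrC.
apply: ler_wpM2r; first exact: energy_incr_ge0.
(* Both energies in [X 0] are at most [|w 0|^2], whence [64 = 2 * 32]. *)
rewrite ler_expR (_ : 64 / be ^+ 2 * L2norm (w 0) ^+ 2 = g * (2 * L2norm (w 0) ^+ 2)); last first.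
  by rewrite /g; field; rewrite gt_eqF.
apply: ler_wpM2l => //; rewrite /X add0r.
exact: le_add_double (energy0_le0 (lexx 0)) (energy0_le0 h0).
Qed.

Context (hb0 : nu p * wx 0 0 = bdry (c0 p) (wd p) (w 0 0)).
Context (hb1 : nu p * wx 0 1 = - bdry (c1 p) (wd p) (w 0 1)).

(** The value that the equation assigns to [w_t] at time [0], where [z] vanishes; it replaces
    [wt 0], which is not controlled. *)
Definition initial_rhs x := nu p * wxx 0 x - w 0 x * wx 0 x - wd p * wx 0 x.

Lemma initial_rhs_L2 : L2 initial_rhs.
Proof.
have h := is_Dx_L2' (rs_wxx S (lexx 0)).
apply: L2B; last by apply: L2Z; exact: wxL2.
by apply: L2B; [exact: L2Z|exact: wwx_L2 S _ (lexx 0)].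
Qed.

(** The compatibility conditions cancel the boundary terms of the integration by parts. With those
    terms present, the form at time [0] would not be bounded by the [L^2] norm of [phi], and the
    first increment would not be of order [h]. *)
Lemma wform_initial phi phix : is_Dx phi phix ->
  wform p (w 0) (wx 0) phi phix = - inner initial_rhs phi.
Proof.
move=> D; have e := integration_by_parts_H1 (rs_wxx S (lexx 0)) D.
have hphi := is_Dx_L2 D.
have h := is_Dx_L2' (rs_wxx S (lexx 0)).
have h1 := wxL2 (lexx 0); have h2 := wwx_L2 S (lexx 0).
have -> : inner initial_rhs phi = nu p * inner (wxx 0) phi -
   inner (fun x => w 0 x * wx 0 x) phi - wd p * inner (wx 0) phi.
  rewrite /initial_rhs innerBl//; [|by apply: L2B => //; exact: L2Z|exact: L2Z].
  by rewrite innerBl//; [rewrite !innerZl|exact: L2Z].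
rewrite /wform -hb0 -[bdry (c1 p) _ _]opprK -hb1.
have -> : inner (wxx 0) phi = wx 0 1 * phi 1 - wx 0 0 * phi 0 - inner (wx 0) phix by move: e; lra.
ring.
Qed.

Definition data_norm := L2norm initial_rhs ^+ 2 + rho p * L2norm (wx 0) ^+ 2.

(** Gronwall on [[0, h]] for the distance [X] to the initial state, which starts from [0] and at
    time [h] is the energy of the first increment. [B] enters only multiplied by [h]. *)
Lemma energy_incr_initial h : 0 < h ->
  Y h 0 <= expR (1 + 256 / be * B ^+ 2 * h) * (h ^+ 2 * data_norm).
Proof.
(* [4 * B] bounds [|w 0 x| + |w s x|], and [T = 256 / be * B ^+ 2]. *)
move=> h0; pose T := 16 / be * (4 * B) ^+ 2.
have T0 : 0 <= T by rewrite mulr_ge0 ?sqr_ge0// divr_ge0// ltW.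
pose k := T + h^-1; have k0 : 0 < k by rewrite ltr_wpDl// invr_gt0.
pose X s := L2norm (fun x => w s x - w 0 x) ^+ 2 + rho p * L2norm (z s) ^+ 2.
have X0 : X 0 = 0.
  rewrite /X memory0_norm (@L2norm_eq _ _ (fun=> 0 * 0)); last by move=> x _; rewrite subrr mul0r.
  by rewrite (L2normZ 0 (L2_cst 0)) normr0 mul0r !expr0n/= mulr0 addr0.
have Xh : Y h 0 = X h.
  rewrite /energy_incr /X /increment add0r; congr (_ + _ * _ ^+ 2).
  by apply: L2norm_eq => x _; rewrite memory0 subr0.
have M0 : 0 <= data_norm by rewrite addr_ge0 ?sqr_ge0// mulr_ge0 ?sqr_ge0// ltW.
have Xd s : 0 < s -> exists2 d, dat X s d & d <= k * X s + h * data_norm.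
  move=> s0; have s0' := ltW s0.
  have Du := is_DxB (rs_wx S s0') (rs_wx S (lexx 0)).
  have d1 : dat (fun r => L2norm (fun x => w r x - w 0 x) ^+ 2) s
      (2 * inner (wt s) (fun x => w s x - w 0 x)).
    apply: (@dat_L2norm_sqr _ (fun r x => w r x - w 0 x) _ _ B) => // [r r0|r /andP[r0 _]|].
    - by apply: L2B; apply: wL2 => //; exact: ltW.
    - rewrite (@L2norm_eq _ _ (fun x => w r x - w s x)); last by move=> x _; ring.
      by apply: (w_lipschitz S) => //; exact: ltW.
    - have d2 := datB (w_dat S dp Du s0) (dat_cst (inner (w 0) (fun x => w s x - w 0 x)) s).
      apply: (dat_pos s0) (dat_eq d2 (subr0 _)) => r r0; rewrite innerBl//; last exact: is_Dx_L2 Du.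
      - exact: wL2 (ltW _).
      - exact: wL2.
  have d2 : dat (fun r => L2norm (z r) ^+ 2) s (2 * (inner (wx s) (z s) - de * L2norm (z s) ^+ 2)).
    have s10 : 0 <= s + 1 by rewrite addr_ge0.
    have [L L0 hL] := memory_lipschitz S dp s10.
    suff d : dat (fun r => L2norm (z r) ^+ 2) s (2 * (inner (wx s) (z s) - de * inner (z s) (z s))).
      apply: (dat_eq d); congr (2 * (_ - de * _)); exact/esym/L2norm_sqr.
    apply: (@dat_L2norm_sqr _ _ _ _ L) => // [r r0|r /andP[r0 st]|].
    - exact: zL2 (ltW _).
    - by apply: hL; [rewrite s0' lerDl ler01|rewrite (ltW r0) (ltW st)].
    - exact: memory_dat S dp _ _ (zL2 s0') s0.
  eexists; first exact: datD d1 (datZ (rho p) d2).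
  have W := rs_weak S s0 Du; have W0 := wform_initial Du.
  have B4 : 0 <= 4 * B by rewrite mulr_ge0.
  have M := wform_monotone hp hc (rs_wx S (lexx 0)) (rs_wx S s0') B4.
  have wB x : 0 <= x <= 1 -> `|w 0 x| + `|w s x| <= 4 * B.
    move=> x01; have -> : 4 * B = 2 * (2 * B) by ring.
    exact: le_add_double (w_sup S (lexx 0) x01) (w_sup S s0' x01).
  have {}M := M wB.
  apply: (@initial_algebra _ h (rho p) de al T _ _ _ _ _ (inner initial_rhs (fun x => w s x - w 0 x)) _ _
     (inner (z s) (wx 0)) (L2norm (fun x => w s x - w 0 x)) (L2norm (z s)) (L2norm initial_rhs) (L2norm (wx 0))
     h0 (ltW rp) (ltW dp) al0 (sqr_ge0 _) (sqr_ge0 _) (erefl _) (erefl _) W W0 _ M _ _ T0).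
  - by rewrite innerBr ?(innerC (wx s))//; [exact: wxL2|exact: wxL2|exact: zL2].
  - by apply: le_trans (ler_norm _) (cauchy_schwarz initial_rhs_L2 _); exact: is_Dx_L2 Du.
  - by apply: le_trans (ler_norm _) (cauchy_schwarz (zL2 s0') _); exact: wxL2.
have cX : {within `[0, h], continuous X}.
  have c1 : {within `[0, h], continuous (fun s => L2norm (fun x => w s x - w 0 x) ^+ 2)}.
    apply: (@L2norm_sqr_within _ (fun r x => w r x - w 0 x) _ B) => [r /andP[r0 _]|r t /andP[r0 _] /andP[t0 _]].
      by apply: L2B; exact: wL2.
    rewrite (@L2norm_eq _ _ (fun x => w t x - w r x)); last by move=> x _; ring.
    exact: (w_lipschitz S).
  have [L _ hL] := memory_lipschitz S dp (ltW h0).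
  have c2 : {within `[0, h], continuous (fun s => L2norm (z s) ^+ 2)}.
    by apply: (@L2norm_sqr_within _ _ _ L) => [s /andP[s0 _]|//]; exact: zL2.
  move=> s; apply: cvgD; first exact: c1.
  by apply: cvgM; [exact: cvg_cst|exact: c2].
pose G s := expR (- k * s) * X s - h * data_norm * s.
have : G h <= G 0.
  apply: dat_nonincr; [exact: ltW| |].
    move=> s /andP[s0 _]; have [d dX ld] := Xd s s0.
    eexists; first exact: datB (datM (dat_expR _ _) dX) (datZ (h * data_norm) (dat_id s)).
    have e0 := expR_ge0 (- k * s).
    have e1 : expR (- k * s) <= 1.
      by rewrite -expR0 ler_expR mulNr oppr_le0 mulr_ge0// ltW.
    have hM : 0 <= h * data_norm by rewrite mulr_ge0// ltW.
    exact: gronwall_algebra e0 e1 hM ld.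
  move=> s; apply: cvgB.
    apply: cvgM; last exact: cX.
    by apply: continuous_subspaceT => r; exact: dat_cont (dat_expR _ _).
  by apply: continuous_subspaceT => r; exact: dat_cont (datZ _ (dat_id _)).
rewrite /G X0 !mulr0 subrr subr_le0 Xh => hX.
rewrite -(ler_pM2l (expR_gt0 (- k * h))) [leRHS]mulrA -expRD.
apply: le_trans hX _.
have -> : - k * h + (1 + 256 / be * B ^+ 2 * h) = 0.
  by rewrite /k /T; field; rewrite !gt_eqF.
by rewrite expR0 mul1r expr2 mulrAC.
Qed.

Definition wt_decay_sqr := expR 2 * data_norm * expR (64 / be ^+ 2 * L2norm (w 0) ^+ 2).

Lemma wt_decay t : 0 < t -> L2norm (wt t) ^+ 2 <= expR (- 2 * al * t) * wt_decay_sqr.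
Proof.
move=> t0; have t0' := ltW t0.
have M0 : 0 <= data_norm by rewrite addr_ge0 ?sqr_ge0// mulr_ge0 ?sqr_ge0// ltW.
set K := expR (- 2 * al * t) * wt_decay_sqr.
have K0 : 0 <= K by rewrite !mulr_ge0 ?expR_ge0.
pose c := 256 / be * B ^+ 2.
have c0_ : 0 <= c.
  apply: mulr_ge0; last exact: sqr_ge0.
  by apply: divr_ge0; [exact: ler0n|exact: ltW].
(* Under [c * h <= 1] the factor [expR (1 + c * h)] is at most [expR 2], and the bound [B]
   disappears from the estimate. *)
have inc h : 0 < h -> c * h <= 1 -> L2norm (increment w h t) <= Num.sqrt K * h.
  move=> h0 ch; have h0' := ltW h0.
  rewrite -ler_sqr ?nnegrE ?L2norm_ge0 ?mulr_ge0 ?sqrtr_ge0// exprMn (sqr_sqrtr K0).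
  apply: (@le_trans _ _ (Y h t)).
    by rewrite /energy_incr lerDl; apply: mulr_ge0; [exact: ltW|exact: sqr_ge0].
  apply: le_trans (energy_incr_decay h0' t0') _.
  rewrite /K -[leRHS]mulrA; apply: ler_wpM2l; first exact: expR_ge0.
  have hi := energy_incr_initial h0.
  have h1 : expR (1 + c * h) <= expR 2 by rewrite ler_expR (natrD _ 1 1) lerD2l.
  have hM : 0 <= h ^+ 2 * data_norm by apply: mulr_ge0 => //; exact: sqr_ge0.
  have {}hi := le_trans hi (ler_wpM2r hM h1).
  apply: le_trans (ler_wpM2l (expR_ge0 _) hi) _.
  by rewrite /wt_decay_sqr le_eqVlt; apply/orP; left; apply/eqP; exact: regroup_algebra.
(* Difference quotients of [(w, phi)] along small steps tend to [(wt t, phi)]. As [wt t] is itself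
   in [H^1], it can then be taken as [phi]. *)
have key phi phix : is_Dx phi phix -> `|inner (wt t) phi| <= Num.sqrt K * L2norm phi.
  move=> Dphi; have hphi := is_Dx_L2 Dphi.
  pose u n : R := (c + 1)^-1 * n.+1%:R^-1.
  have c1 : 0 < c + 1 by rewrite ltr_wpDl.
  have u0 n : 0 < u n by rewrite mulr_gt0 ?invr_gt0.
  have cu n : c * u n <= 1.
    rewrite /u mulrA -[leRHS]mulr1; apply: ler_pM.
    - by rewrite divr_ge0// ltW.
    - by rewrite invr_ge0.
    - by rewrite ler_pdivrMr// mul1r lerDl.
    - by rewrite invf_le1 ?ler1n.
  have ul : u n @[n --> \oo] --> 0.
    rewrite -[X in _ --> X](mulr0 (c + 1)^-1); apply: cvgM; first exact: cvg_cst.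
    exact: cvg_harmonic.
  have un0 n : u n != 0 by rewrite gt_eqF.
  have q := dat_quotient (w_dat S dp Dphi t0) un0 ul.
  apply: (cvgr_to_le (cvg_norm q)); apply: nearW => n.
  have tu0 : 0 <= t + u n by rewrite addr_ge0// ltW.
  rewrite -innerBl//; [|exact: wL2|exact: wL2].
  rewrite normrM normfV (gtr0_norm (u0 n)) ler_pdivrMl//.
  apply: le_trans (cauchy_schwarz _ hphi) _; first by apply: L2B; apply: wL2.
  rewrite [leRHS]mulrA [u n * _]mulrC; apply: ler_wpM2r; first exact: L2norm_ge0.
  exact: inc (u0 n) (cu n).
have := key _ _ (rs_wtx S t0); rewrite -L2norm_sqr ger0_norm ?sqr_ge0// => k1.
have k2 := sqr_le_mul_self (L2norm_ge0 _) k1 (sqrtr_ge0 _).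
by rewrite -[leRHS](sqr_sqrtr K0) ler_sqr ?nnegrE ?L2norm_ge0 ?sqrtr_ge0.
Qed.

End decay.

(** * Decay of the second space derivative *)

Lemma sqr_homo {R : realType} (x y : R) : 0 <= x -> x <= y -> x ^+ 2 <= y ^+ 2.
Proof. by move=> x0 xy; rewrite ler_sqr ?nnegrE// (le_trans x0). Qed.

(** The equation tested with [w] at a single time: coercivity bounds [P] by the [w_t] and memory
    pairings, and Young's inequality absorbs [|w_x|] from the latter into [b P]. So [P] inherits the
    decay of [w_t], [w] and [z] pointwise in time. *)
Lemma triple_algebra {R : realType} (a b r P d W I J nt n nz : R) : 0 <= a -> 0 < b -> 0 <= r ->
  0 <= P -> 0 <= d -> 0 <= nz -> d ^+ 2 <= P -> (2 * a + b) * P <= 2 * W -> I + W + r * J = 0 ->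
  - I <= nt * n -> - J <= nz * d ->
  P <= 4 / b * (nt * n + r ^+ 2 / b * nz ^+ 2).
Proof.
move=> a0 b0 r0 P0 d0 nz0 dP hW e hI hJ.
have rJ := ler_wpM2l r0 hJ.
have aP : 0 <= a * P by rewrite mulr_ge0.
have yg : 2 * (r * (nz * d)) <= b / 2 * d ^+ 2 + 2 * (r ^+ 2 / b * nz ^+ 2).
  rewrite -subr_ge0.
  have -> : b / 2 * d ^+ 2 + 2 * (r ^+ 2 / b * nz ^+ 2) - 2 * (r * (nz * d)) =
    (b * d - 2 * (r * nz)) ^+ 2 / (2 * b).
    by field; rewrite gt_eqF.
  by rewrite divr_ge0 ?sqr_ge0// mulr_ge0// ltW.
have bd : b / 2 * d ^+ 2 <= b / 2 * P by rewrite ler_wpM2l// divr_ge0// ltW.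
have : b / 2 * P <= 2 * (nt * n + r ^+ 2 / b * nz ^+ 2) by lra.
rewrite -(ler_pM2l (_ : 0 < 2 / b)); last by rewrite divr_gt0.
have -> : 2 / b * (b / 2 * P) = P by field; rewrite gt_eqF.
by have -> : 2 / b * (2 * (nt * n + r ^+ 2 / b * nz ^+ 2)) =
    4 / b * (nt * n + r ^+ 2 / b * nz ^+ 2) by field; rewrite gt_eqF.
Qed.

(** The three summands bound the squares of [w_t], [w w_x] and [w_d w_x], up to the exponential
    decay; [K2] stands for the constant of [w_t] and [N2] for [|w0|^2]. *)
Definition forcing_bound {R : realType} (b r wd K2 N2 : R) : R :=
  3 * (K2 + 32 / b ^+ 2 * N2 * (K2 + (r / b) ^+ 2 * N2)
       + wd ^+ 2 * (4 / b * ((K2 + N2) / 2 + r / b * N2))).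

(** [e] is the decay factor. The square of [w w_x] is controlled by [P ^+ 2] and decays like [e^2];
    the assumption [e <= 1] brings it to the common rate. *)
Lemma forcing_algebra {R : realType} (b r wd e K2 N2 P nt n nz g1 g2 g3 G : R) :
  0 < b -> 0 < r -> 0 <= e <= 1 -> 0 <= P -> 0 <= nt -> 0 <= n -> 0 <= nz ->
  0 <= K2 -> 0 <= N2 ->
  P <= 4 / b * (nt * n + r ^+ 2 / b * nz ^+ 2) ->
  nt ^+ 2 <= e * K2 -> n ^+ 2 <= e * N2 -> r * nz ^+ 2 <= e * N2 ->
  0 <= g1 -> 0 <= g2 -> 0 <= g3 -> 0 <= G ->
  g1 <= nt -> g2 ^+ 2 <= P ^+ 2 -> g3 ^+ 2 <= wd ^+ 2 * P -> G <= g1 + g2 + g3 ->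
  G ^+ 2 <= e * forcing_bound b r wd K2 N2.
Proof.
move=> b0 r0 /andP[e0 e1] P0 nt0 n0 nz0 K0 N0 hP hnt hn hnz g10 g20 g30 G0 h1 h2 h3 hG.
have G3 : G ^+ 2 <= 3 * (g1 ^+ 2 + g2 ^+ 2 + g3 ^+ 2).
  apply: (@le_trans _ _ ((g1 + g2 + g3) ^+ 2)); first exact: sqr_homo.
  have := sqr_ge0 (g1 - g2); have := sqr_ge0 (g1 - g3); have := sqr_ge0 (g2 - g3); lra.
have g1b : g1 ^+ 2 <= e * K2 by apply: le_trans hnt; exact: sqr_homo.
pose Z := r ^+ 2 / b * nz ^+ 2; pose rb := r / b.
have ZE : Z = rb * (r * nz ^+ 2) by rewrite /Z /rb; ring.
have rb0 : 0 <= rb by rewrite divr_ge0// ltW.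
have Z0 : 0 <= Z.
  by rewrite ZE; apply: mulr_ge0 => //; apply: mulr_ge0; [exact: ltW|exact: sqr_ge0].
have Zb : Z <= e * (rb * N2) by rewrite ZE [leRHS]mulrCA; apply: ler_wpM2l.
have ntn : nt * n <= e * ((K2 + N2) / 2) by have := sqr_ge0 (nt - n); lra.
have b4 : 0 <= 4 / b by rewrite divr_ge0// ltW.
have Pb : P <= e * (4 / b * ((K2 + N2) / 2 + rb * N2)).
  apply: le_trans hP _; rewrite -/Z [leRHS]mulrCA; apply: ler_wpM2l => //.
  by rewrite mulrDr; exact: lerD.
have ntn2 : (nt * n) ^+ 2 <= e * (K2 * N2).
  apply: (@le_trans _ _ ((e * K2) * (e * N2))).
    by rewrite exprMn; apply: ler_pM; rewrite ?sqr_ge0.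
  have -> : (e * K2) * (e * N2) = e * (e * (K2 * N2)) by ring.
  by rewrite ler_wpM2l// ler_piMl// mulr_ge0.
have Z2 : Z ^+ 2 <= e * (rb ^+ 2 * N2 * N2).
  apply: (@le_trans _ _ ((e * (rb * N2)) ^+ 2)); first exact: sqr_homo.
  have -> : (e * (rb * N2)) ^+ 2 = e * (e * (rb ^+ 2 * N2 * N2)) by ring.
  apply: ler_wpM2l => //; apply: ler_piMl => //.
  by apply: mulr_ge0 => //; apply: mulr_ge0 => //; exact: sqr_ge0.
have P2 : P ^+ 2 <= e * (32 / b ^+ 2 * N2 * (K2 + rb ^+ 2 * N2)).
  apply: (@le_trans _ _ ((4 / b * (nt * n + Z)) ^+ 2)).
    exact: sqr_homo.
  apply: (@le_trans _ _ (32 / b ^+ 2 * ((nt * n) ^+ 2 + Z ^+ 2))).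
    have -> : (4 / b * (nt * n + Z)) ^+ 2 = 16 / b ^+ 2 * (nt * n + Z) ^+ 2.
      by field; rewrite gt_eqF.
    have -> : 32 / b ^+ 2 * ((nt * n) ^+ 2 + Z ^+ 2) = 16 / b ^+ 2 * (2 * ((nt * n) ^+ 2 + Z ^+ 2)).
      by field; rewrite gt_eqF.
    rewrite ler_wpM2l ?divr_ge0 ?sqr_ge0//.
    by have := sqr_ge0 (nt * n - Z); move: (nt * n) => y; lra.
  have -> : e * (32 / b ^+ 2 * N2 * (K2 + rb ^+ 2 * N2)) =
     32 / b ^+ 2 * (e * (K2 * N2) + e * (rb ^+ 2 * N2 * N2)) by ring.
  by rewrite ler_wpM2l ?divr_ge0 ?sqr_ge0// lerD.
have g3b := le_trans h3 (ler_wpM2l (sqr_ge0 wd) Pb).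
have g2b := le_trans h2 P2.
apply: le_trans G3 _; rewrite /forcing_bound -/rb.
have -> : e * (3 * (K2 + 32 / b ^+ 2 * N2 * (K2 + rb ^+ 2 * N2) +
    wd ^+ 2 * (4 / b * ((K2 + N2) / 2 + rb * N2)))) =
  3 * (e * K2 + e * (32 / b ^+ 2 * N2 * (K2 + rb ^+ 2 * N2)) +
    wd ^+ 2 * (e * (4 / b * ((K2 + N2) / 2 + rb * N2)))) by ring.
by rewrite ler_wpM2l// !lerD.
Qed.

(** Eliminating [A = (w_x, phi_x)] between the memory equation and the weak form raises the damping
    of [y = (z, phi_x)] from [d] to [d + r / n]. The subtracted term is the response to a source
    decaying at rate [a]. *)
Lemma memory_algebra {R : realType} (n r d a E e gam l y A F : R) :
  0 < n -> 0 < d + r / n - a -> 0 <= E ->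
  n * A + r * y <= e * gam * l ->
  (d + r / n) * E * y + E * (A - d * y)
    - gam * l / (n * (d + r / n - a)) * ((d + r / n - a) * (E * e)) <= 0.
Proof.
move=> n0 k0 E0 h; have [q qE] : exists q, q = d + r / n by exists (d + r / n).
have dE : d = q - r / n by rewrite qE; ring.
rewrite -!qE in k0 *; rewrite {}dE.
have -> : q * E * y + E * (A - (q - r / n) * y)
    - gam * l / (n * (q - a)) * ((q - a) * (E * e)) = E / n * ((n * A + r * y) - e * gam * l).
  by field; rewrite !gt_eqF.
by rewrite mulr_ge0_le0 ?subr_le0// divr_ge0// ltW.
Qed.

(** [X = (w_xx, phi)] equals [- (w_x, phi_x)], that is [(F + r y) / n] by the weak form; both parts
    have already been bounded. *)
Lemma wxx_algebra {R : realType} (n r k X A y F e gam l : R) :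
  0 < n -> 0 <= r -> 0 < k -> X + A = 0 ->
  y <= e * (gam * l / (n * k)) -> - y <= e * (gam * l / (n * k)) ->
  n * A + r * y = - F -> `|F| <= e * gam * l ->
  `|X| <= n^-1 * (1 + r / (n * k)) * (e * gam) * l.
Proof.
move=> n0 r0 k0 XA y1 y2 W; rewrite !ler_norml => /andP[F1 F2].
have -> : X = n^-1 * (F + r * y).
  have -> : X = - A by move: XA; lra.
  by have -> : F = - (n * A) - r * y by [move: W; lra]; field; rewrite gt_eqF.
have -> : n^-1 * (1 + r / (n * k)) * (e * gam) * l =
    n^-1 * (e * gam * l + r * (e * (gam * l / (n * k)))).
  by field; rewrite !gt_eqF.
set Y := e * (gam * l / (n * k)) in y1 y2 *.
have ry1 := ler_wpM2l r0 y1; have ry2 := ler_wpM2l r0 y2.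
rewrite -mulrN; apply/andP; split; rewrite ler_pM2l ?invr_gt0//; lra.
Qed.

Section wxx_decay.
Context {R : realType}.
Context (p : params R) (w wx wxx wt wtx : R -> R -> R) (B al be : R).
Context (hp : admissible p) (hc : coercive p al be).
Context (S : regular_solution p w wx wxx wt wtx B).
Implicit Types (phi : R -> R) (s t x : R).

Local Notation z := (memory p wx).
Local Notation de := (delta p).
Let wL2 t : 0 <= t -> L2 (w t). Proof. by move=> /(rs_wx S) /is_Dx_L2. Qed.
Let wxL2 t : 0 <= t -> L2 (wx t). Proof. by move=> /(rs_wx S) /is_Dx_L2'. Qed.
Let wtL2 t : 0 < t -> L2 (wt t). Proof. by move=> /(rs_wtx S) /is_Dx_L2. Qed.
Let dp : 0 < de. Proof. by case: hp => [[]]. Qed.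
Let rp : 0 < rho p. Proof. by case: hp => [[]]. Qed.
Let nup : 0 < nu p. Proof. by case: hp => [[]]. Qed.
Let zL2 t : 0 <= t -> L2 (z t). Proof. exact: memory_L2 S dp _. Qed.
Let al0 : 0 <= al. Proof. by case: hc. Qed.
Let be0 : 0 < be. Proof. by case: hc. Qed.

Context (hb0 : nu p * wx 0 0 = bdry (c0 p) (wd p) (w 0 0)).
Context (hb1 : nu p * wx 0 1 = - bdry (c1 p) (wd p) (w 0 1)).

Local Notation K2 := (wt_decay_sqr p w wx wxx be).
Local Notation N2 := (L2norm (w 0) ^+ 2).

Definition forcing t x := wt t x + w t x * wx t x + wd p * wx t x.

Lemma forcing_L2 t : 0 < t -> L2 (forcing t).
Proof.
move=> t0; apply: L2D; last by apply: L2Z; exact: wxL2 (ltW t0).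
by apply: L2D; [exact: wtL2|exact: wwx_L2 S _ (ltW t0)].
Qed.

Lemma wt_decay_sqr_ge0 : 0 <= K2.
Proof.
apply: mulr_ge0; last exact: expR_ge0.
apply: mulr_ge0; first exact: expR_ge0.
by apply: addr_ge0; [exact: sqr_ge0|apply: mulr_ge0; [exact: ltW|exact: sqr_ge0]].
Qed.

Lemma expR_decay_le1 t : 0 <= t -> 0 <= expR (- 2 * al * t) <= 1.
Proof.
by move=> t0; rewrite expR_ge0/= -expR0 ler_expR mulNr mulNr oppr_le0 !mulr_ge0.
Qed.

Lemma forcing_decay t : 0 < t ->
  L2norm (forcing t) ^+ 2 <= expR (- 2 * al * t) * forcing_bound be (rho p) (wd p) K2 N2.
Proof.
move=> t0; have t0' := ltW t0; have D := rs_wx S t0'.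
have W := rs_weak S t0 D; have C := wform_coercive hp hc D.
pose P := triple2 (w t) (wx t).
have P0 : 0 <= P := triple2_ge0 _ _.
have wtw := le_trans (ler_norm _) (cauchy_schwarz (L2N (wtL2 t0)) (wL2 t0')).
rewrite (L2normN (wtL2 t0)) (innerNl (wtL2 t0) (wL2 t0')) in wtw.
have zw := le_trans (ler_norm _) (cauchy_schwarz (L2N (zL2 t0')) (wxL2 t0')).
rewrite (L2normN (zL2 t0')) (innerNl (zL2 t0') (wxL2 t0')) in zw.
have dP : L2norm (wx t) ^+ 2 <= P.
  by rewrite /P /triple2 -addrA lerDl; apply: addr_ge0; exact: sqr_ge0.
have hP := triple_algebra al0 be0 (ltW rp) P0 (L2norm_ge0 _) (L2norm_ge0 _) dP C W wtw zw.
have E0 := energy0_le hp hc S t0'.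
have nb : L2norm (w t) ^+ 2 <= expR (- 2 * al * t) * N2.
  apply: le_trans E0; rewrite /energy0 lerDl.
  by apply: mulr_ge0; [exact: ltW|exact: sqr_ge0].
have zb : rho p * L2norm (z t) ^+ 2 <= expR (- 2 * al * t) * N2.
  by apply: le_trans E0; rewrite /energy0 lerDr; exact: sqr_ge0.
have hw2 := wwx_L2 S t0'.
have hw3 := L2Z (wd p) (wxL2 t0').
apply: (forcing_algebra be0 rp (expR_decay_le1 t0') P0 (L2norm_ge0 (wt t)) (L2norm_ge0 (w t)) (L2norm_ge0 (z t))
   wt_decay_sqr_ge0 (sqr_ge0 _) hP (wt_decay hp hc S hb0 hb1 t0) nb zb
   (L2norm_ge0 (wt t)) (L2norm_ge0 (fun x => w t x * wx t x))
   (L2norm_ge0 (fun x => wd p * wx t x)) (L2norm_ge0 _)) => //.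
- have q0 := L2norm_ge0 (fun x => w t x * wx t x).
  have sP0 : 0 <= Num.sqrt P := sqrtr_ge0 _.
  have sup x : 0 <= x <= 1 -> `|w t x| <= Num.sqrt P.
    move=> x01; rewrite -ler_sqr ?nnegrE// real_normK ?num_real// (sqr_sqrtr P0).
    exact: triple_bound D x01.
  have h1 := L2norm_mul_le (wxL2 t0') (is_Dx_meas D) sP0 sup.
  have dsP : L2norm (wx t) <= Num.sqrt P.
    by rewrite -ler_sqr ?nnegrE ?L2norm_ge0// (sqr_sqrtr P0).
  have h2 := le_trans h1 (ler_wpM2l sP0 dsP).
  rewrite -expr2 (sqr_sqrtr P0) in h2.
  by rewrite ler_sqr ?nnegrE.
- rewrite (L2normZ _ (wxL2 t0')) exprMn real_normK ?num_real//.
  by apply: ler_wpM2l dP; exact: sqr_ge0.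
- apply: le_trans (L2norm_triangle (L2D (wtL2 t0) hw2) hw3) _.
  by rewrite lerD2r; exact: (L2norm_triangle (wtL2 t0) hw2).
Qed.

Definition memory_rate := de + rho p / nu p.

Lemma memory_rate_gt : 0 < memory_rate - al.
Proof.
have [_ _ [_ h _ _]] := hc.
have q : 0 <= rho p / nu p by apply: divr_ge0; exact: ltW.
by rewrite /memory_rate; move: h al0 be0 q; move: (rho p / nu p) => q; lra.
Qed.

Local Notation Gam := (Num.sqrt (forcing_bound be (rho p) (wd p) K2 N2)).

Lemma forcing_bound_ge0 : 0 <= forcing_bound be (rho p) (wd p) K2 N2.
Proof.
have K0 := wt_decay_sqr_ge0; have N0 : 0 <= N2 := sqr_ge0 _.
have rb : 0 <= rho p / be by apply: divr_ge0; exact: ltW.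
apply: mulr_ge0 => //; apply: addr_ge0.
  apply: addr_ge0 => //; apply: mulr_ge0.
    by apply: mulr_ge0 => //; apply: divr_ge0 => //; exact: sqr_ge0.
  by apply: addr_ge0 => //; apply: mulr_ge0 => //; exact: sqr_ge0.
apply: mulr_ge0; first exact: sqr_ge0.
apply: mulr_ge0; first by apply: divr_ge0 => //; exact: ltW.
apply: addr_ge0; last exact: mulr_ge0.
by apply: divr_ge0 => //; exact: addr_ge0.
Qed.

Lemma forcing_norm t : 0 < t -> L2norm (forcing t) <= expR (- al * t) * Gam.
Proof.
move=> t0; have G0 : 0 <= expR (- al * t) * Gam.
  by apply: mulr_ge0; [exact: expR_ge0|exact: sqrtr_ge0].
rewrite -ler_sqr ?nnegrE ?L2norm_ge0//.
rewrite exprMn (sqr_sqrtr forcing_bound_ge0) -expRM_natl.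
have -> : 2%:R * (- al * t) = - 2 * al * t by ring.
exact: forcing_decay.
Qed.

Lemma weak_H10 phi phix t : is_Dx phi phix -> phi 0 = 0 -> phi 1 = 0 -> 0 < t ->
  nu p * inner (wx t) phix + rho p * inner (z t) phix = - inner (forcing t) phi.
Proof.
move=> D p0 p1 t0; have := rs_weak S t0 D.
have hphi := is_Dx_L2 D; have h1 := wxL2 (ltW t0); have h2 := wwx_L2 S (ltW t0).
have h3 := wtL2 t0.
have -> : inner (forcing t) phi =
    inner (wt t) phi + inner (fun x => w t x * wx t x) phi + wd p * inner (wx t) phi.
  rewrite /forcing innerDl//; [|by apply: L2D|exact: L2Z].
  by rewrite innerDl// innerZl.
rewrite /wform p0 p1 !mulr0 !addr0.
move: (inner (wt t) phi) (inner (wx t) phix) (inner (wx t) phi)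
  (inner (fun x => w t x * wx t x) phi) (inner (z t) phix).
by move=> i1 i2 i3 i4 i5; lra.
Qed.

(** Comparison of [y = (z, phi_x)], which starts from [0], with a multiple of [expR (- al * t)]. The
    rate [memory_rate] exceeds [al] because [delta] is at least [2 al + be], so the forcing sets the
    decay. *)
Lemma memory_H10_upper phi phix t : is_Dx phi phix -> phi 0 = 0 -> phi 1 = 0 -> 0 < t ->
  inner (z t) phix <= expR (- al * t) * (Gam * L2norm phi / (nu p * (memory_rate - al))).
Proof.
move=> D p0 p1 t0; have t0' := ltW t0.
have hphi := is_Dx_L2 D; have hphix := is_Dx_L2' D.
set C := Gam * L2norm phi / (nu p * (memory_rate - al)).
have kap := memory_rate_gt.
have C0 : 0 <= C.
  apply: divr_ge0; first by apply: mulr_ge0; [exact: sqrtr_ge0|exact: L2norm_ge0].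
  by apply: mulr_ge0; exact: ltW.
pose y s := inner (z s) phix.
pose G s := expR (memory_rate * s) * y s - C * expR ((memory_rate - al) * s).
have GG : G t <= G 0.
  apply: dat_nonincr => // [s /andP[s0 _]|].
    eexists.
      apply: datB; first exact: datM (dat_expR _ _) (memory_dat S dp hphix s0).
      exact: datZ (dat_expR _ _).
    have Fb : - inner (forcing s) phi <= expR (- al * s) * Gam * L2norm phi.
      rewrite -innerNl//; last exact: forcing_L2.
      apply: le_trans (ler_norm _) (le_trans (cauchy_schwarz (L2N (forcing_L2 s0)) hphi) _).
      rewrite (L2normN (forcing_L2 s0)); apply: ler_wpM2r; first exact: L2norm_ge0.
      exact: forcing_norm.
    rewrite -(weak_H10 D p0 p1 s0) in Fb.
    have ee : expR ((memory_rate - al) * s) = expR (memory_rate * s) * expR (- al * s).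
      by rewrite -expRD; congr expR; ring.
    rewrite ee /y /C; apply: memory_algebra Fb => //; exact: expR_ge0.
  have [L _ hL] := memory_inner_lipschitz S dp t0'.
  have cy : {within `[0, t], continuous y}.
    apply: (@lipschitz_within _ _ (L * L2norm phix)) => a b ha hb.
    exact: hL.
  move=> s; apply: cvgB.
    apply: cvgM; last exact: cy.
    by apply: continuous_subspaceT => r; exact: dat_cont (dat_expR _ _).
  apply: cvgM; first exact: cvg_cst.
  by apply: continuous_subspaceT => r; exact: dat_cont (dat_expR _ _).
have y0 : y 0 = 0.
  rewrite /y (@eq_inner _ _ (fun x => 0 * phix x) _ phix)//; last by move=> x _; rewrite memory0 mul0r.
  by rewrite innerZl// mul0r.
have {GG} : G t <= 0.
  by apply: le_trans GG _; rewrite /G y0 !mulr0 expR0 mulr1 sub0r oppr_le0.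
rewrite /G subr_le0 => h.
rewrite -(ler_pM2l (expR_gt0 (memory_rate * t))) -/(y t); apply: le_trans h _.
rewrite [leRHS]mulrA -expRD mulrC; apply: ler_wpM2r => //.
by rewrite ler_expR le_eqVlt; apply/orP; left; apply/eqP; ring.
Qed.

Definition wxx_const := (nu p)^-1 * (1 + rho p / (nu p * (memory_rate - al))).

Lemma wxx_const_ge0 : 0 <= wxx_const.
Proof.
apply: mulr_ge0; first by rewrite invr_ge0; exact: ltW.
apply: addr_ge0 => //; apply: divr_ge0; first exact: ltW.
by apply: mulr_ge0; apply: ltW => //; exact: memory_rate_gt.
Qed.

Lemma wxx_decay t : 0 < t ->
  L2norm (wxx t) ^+ 2 <=
  expR (- 2 * al * t) * (wxx_const ^+ 2 * forcing_bound be (rho p) (wd p) K2 N2).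
Proof.
move=> t0; have t0' := ltW t0.
pose M := wxx_const * (expR (- al * t) * Gam).
have M0 : 0 <= M.
  apply: mulr_ge0; first exact: wxx_const_ge0.
  by apply: mulr_ge0; [exact: expR_ge0|exact: sqrtr_ge0].
have hM : H10_bound (wxx t) M.
  move=> phi phix D p0 p1.
  have hphi := is_Dx_L2 D; have hphix := is_Dx_L2' D.
  have e := integration_by_parts_H1 (rs_wxx S t0') D.
  rewrite p0 p1 !mulr0 subrr in e.
  have u1 := memory_H10_upper D p0 p1 t0.
  have p0' : - phi 0 = 0 by rewrite p0 oppr0.
  have p1' : - phi 1 = 0 by rewrite p1 oppr0.
  (* The upper bound for [- phi] is the lower bound for [phi]. *)
  have u2 := memory_H10_upper (is_DxN D) p0' p1' t0.
  rewrite (innerNr (zL2 t0') hphix) (L2normN hphi) in u2.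
  have W := weak_H10 D p0 p1 t0.
  have Fb : `|inner (forcing t) phi| <= expR (- al * t) * Gam * L2norm phi.
    apply: le_trans (cauchy_schwarz (forcing_L2 t0) hphi) _.
    by apply: ler_wpM2r; [exact: L2norm_ge0|exact: forcing_norm].
  exact: wxx_algebra nup (ltW rp) memory_rate_gt e u1 u2 W Fb.
have hx := is_Dx_L2' (rs_wxx S t0').
have h := L2norm_le_H10_bound hx M0 hM.
apply: (@le_trans _ _ (M ^+ 2)); first by rewrite ler_sqr ?nnegrE ?L2norm_ge0.
rewrite /M exprMn [X in _ * X]exprMn (sqr_sqrtr forcing_bound_ge0) -expRM_natl.
have -> : 2%:R * (- al * t) = - 2 * al * t by ring.
by rewrite mulrCA.
Qed.

End wxx_decay.

(** * Constants in terms of the [H^1] norm of the data, and conclusion *)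

Definition data_const {R : realType} (p : params R) (r2 : R) : R :=
  3 * (nu p ^+ 2 + 2 * r2 + wd p ^+ 2) + rho p.

Definition wt_const {R : realType} (p : params R) (b r2 : R) : R :=
  expR 2 * data_const p r2 * expR (64 / b ^+ 2 * r2).

Definition forcing_const {R : realType} (p : params R) (b r2 : R) : R :=
  3 * (wt_const p b r2 + 32 / b ^+ 2 * r2 * (wt_const p b r2 + (rho p / b) ^+ 2)
       + wd p ^+ 2 * (4 / b * ((wt_const p b r2 + 1) / 2 + rho p / b))).

(** Each term of [forcing_bound] has a factor [K] or [N2]. One of them is traded for [W], the
    squared [H^2] norm, and a remaining [N2] for [r2], the squared [H^1] norm, so that [W] occurs
    only linearly. *)
Lemma forcing_bound_le {R : realType} (b r wd K N2 k r2 W : R) :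
  0 < b -> 0 < r -> 0 <= N2 -> N2 <= r2 -> N2 <= W -> 0 <= K -> K <= k * W ->
  forcing_bound b r wd K N2 <=
  3 * (k + 32 / b ^+ 2 * r2 * (k + (r / b) ^+ 2)
       + wd ^+ 2 * (4 / b * ((k + 1) / 2 + r / b))) * W.
Proof.
move=> b0 r0 N0 Nr NW K0 KW.
have rb0 : 0 <= r / b by apply: divr_ge0; exact: ltW.
have b32 : 0 <= 32 / b ^+ 2 by apply: divr_ge0 => //; exact: sqr_ge0.
have b4 : 0 <= 4 / b by apply: divr_ge0 => //; exact: ltW.
rewrite /forcing_bound; move: (r / b) (32 / b ^+ 2) (4 / b) rb0 b32 b4 => q c e q0 c0 e0.
have q2 := sqr_ge0 q; have w2 := sqr_ge0 wd.
have h1 : K + q ^+ 2 * N2 <= (k + q ^+ 2) * W.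
  by rewrite mulrDl; apply: lerD => //; exact: ler_wpM2l.
have h2 : c * N2 * (K + q ^+ 2 * N2) <= c * r2 * ((k + q ^+ 2) * W).
  apply: ler_pM => //; [exact: mulr_ge0| |exact: ler_wpM2l].
  by apply: addr_ge0 => //; exact: mulr_ge0.
have h3 : (K + N2) / 2 + q * N2 <= ((k + 1) / 2 + q) * W.
  have : q * N2 <= q * W by exact: ler_wpM2l.
  have -> : ((k + 1) / 2 + q) * W = (k * W + W) / 2 + q * W by field.
  lra.
have h4 : wd ^+ 2 * (e * ((K + N2) / 2 + q * N2)) <= wd ^+ 2 * (e * (((k + 1) / 2 + q) * W)).
  by apply: ler_wpM2l => //; exact: ler_wpM2l.
have -> : 3 * (k + c * r2 * (k + q ^+ 2) + wd ^+ 2 * (e * ((k + 1) / 2 + q))) * W =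
  3 * (k * W + c * r2 * ((k + q ^+ 2) * W) + wd ^+ 2 * (e * (((k + 1) / 2 + q) * W))) by ring.
by apply: ler_wpM2l => //; apply: lerD => //; exact: lerD.
Qed.

Lemma regroup_mul {R : realType} (e c f W : R) :
  e * (c * (f * W)) = c * f * e * W.
Proof. ring. Qed.

Lemma data_algebra {R : realType} (n r d N D q s F g : R) :
  0 <= n -> 0 <= r -> 0 <= d -> 0 <= N -> 0 <= D -> 0 <= q -> 0 <= g -> 0 <= F ->
  g <= s * D -> s ^+ 2 = 2 * (N ^+ 2 + D ^+ 2) -> F <= n * q + g + d * D ->
  F ^+ 2 + r * D ^+ 2 <=
  (3 * (n ^+ 2 + 2 * (N ^+ 2 + D ^+ 2) + d ^+ 2) + r) * (N ^+ 2 + D ^+ 2 + q ^+ 2).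
Proof.
move=> n0 r0 d0 N0 D0 q0 g0 F0 gs s2 hF.
have F3 : F ^+ 2 <= 3 * ((n * q) ^+ 2 + g ^+ 2 + (d * D) ^+ 2).
  apply: (@le_trans _ _ ((n * q + g + d * D) ^+ 2)); first exact: sqr_homo.
  move: (n * q) (d * D) => x y.
  have := sqr_ge0 (x - g); have := sqr_ge0 (x - y); have := sqr_ge0 (g - y); lra.
have g2 : g ^+ 2 <= 2 * (N ^+ 2 + D ^+ 2) * D ^+ 2.
  by rewrite -s2 -exprMn; exact: sqr_homo.
have N2 := sqr_ge0 N; have D2 := sqr_ge0 D; have q2 := sqr_ge0 q.
have n2 := sqr_ge0 n; have d2 := sqr_ge0 d.
move: g2 F3; rewrite !exprMn.
move: (N ^+ 2) (D ^+ 2) (q ^+ 2) (n ^+ 2) (d ^+ 2) (g ^+ 2) (F ^+ 2) N2 D2 q2 n2 d2.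
move=> N' D' q' n' d' g' F' N0' D0' q0' n0' d0' g2 F3.
have m1 : n' * q' <= n' * (N' + D' + q') by apply: ler_wpM2l => //; lra.
have m2 : 2 * (N' + D') * D' <= 2 * (N' + D') * (N' + D' + q') by apply: ler_wpM2l; lra.
have m3 : d' * D' <= d' * (N' + D' + q') by apply: ler_wpM2l => //; lra.
have m4 : r * D' <= r * (N' + D' + q') by apply: ler_wpM2l => //; lra.
lra.
Qed.

Section conclusion.
Context {R : realType}.

(** In the nonlinear term Agmon's inequality bounds [|w 0 x|] through the [H^1] norm alone, which
    keeps the second derivative out of the constant. *)
Lemma data_norm_le (p : params R) (w wx wxx wt wtx : R -> R -> R) (B : R) :
  admissible p -> regular_solution p w wx wxx wt wtx B ->
  data_norm p w wx wxx <=
  data_const p (L2norm (w 0) ^+ 2 + L2norm (wx 0) ^+ 2) *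
  (L2norm (w 0) ^+ 2 + L2norm (wx 0) ^+ 2 + L2norm (wxx 0) ^+ 2).
Proof.
move=> [[nu0 rho0 de0] [c00 c10 wd0]] S.
have D := rs_wx S (lexx 0); have D' := rs_wxx S (lexx 0).
have h0 := is_Dx_L2 D; have h1 := is_Dx_L2' D; have h2 := is_Dx_L2' D'.
have h3 := wwx_L2 S (lexx 0).
pose s := Num.sqrt (2 * (L2norm (w 0) ^+ 2 + L2norm (wx 0) ^+ 2)).
have s2 : s ^+ 2 = 2 * (L2norm (w 0) ^+ 2 + L2norm (wx 0) ^+ 2).
  apply: sqr_sqrtr; apply: mulr_ge0 => //; apply: addr_ge0; exact: sqr_ge0.
have s0 : 0 <= s := sqrtr_ge0 _.
have sup x : 0 <= x <= 1 -> `|w 0 x| <= s.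
  move=> x01; rewrite -ler_sqr ?nnegrE// real_normK ?num_real// s2.
  apply: le_trans (agmon D x01) _.
  move: (L2norm (w 0)) (L2norm (wx 0)) => n d.
  have := sqr_ge0 (n - d); have := sqr_ge0 d; lra.
have g := L2norm_mul_le h1 (is_Dx_meas D) s0 sup.
apply: (data_algebra (ltW nu0) (ltW rho0) wd0 (L2norm_ge0 _) (L2norm_ge0 _) (L2norm_ge0 _)
  (L2norm_ge0 (fun x => w 0 x * wx 0 x)) (L2norm_ge0 _) g s2).
have z1 : L2norm (fun x => nu p * wxx 0 x) = nu p * L2norm (wxx 0).
  by rewrite (L2normZ _ h2) gtr0_norm.
have z2 : L2norm (fun x => wd p * wx 0 x) = wd p * L2norm (wx 0).
  by rewrite (L2normZ _ h1) ger0_norm.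
rewrite -z1 -z2 -(L2normN h3) -(L2normN (L2Z (wd p) h1)).
apply: le_trans (L2norm_triangle (L2B (L2Z (nu p) h2) h3) (L2N (L2Z (wd p) h1))) _.
by rewrite lerD2r; exact: L2norm_triangle (L2Z (nu p) h2) (L2N h3).
Qed.

Lemma regular_solution_of_assumptions (p : params R) (w0 : R -> R) (w wx wt : R -> R -> R) :
  assumption_A2 p w0 w wx wt -> exists B,
  regular_solution p w wx (fun t => Dx 1 (wx t)) wt (fun t => Dx 1 (wt t)) B.
Proof.
move=> [[[mwx mwt] [[hwx hwt _ hrep] [hweak _]]] _ hwxx [hwtx _] [C C0 hC]].
have Dw t : 0 <= t -> is_Dx (w t) (wx t) by exact: hwx.
have Dwx t : 0 <= t -> is_Dx (wx t) (Dx 1 (wx t)) by move=> /hwxx; exact: in_H1_is_Dx.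
have Dwt t : 0 < t -> is_Dx (wt t) (Dx 1 (wt t)) by move=> /hwtx; exact: in_H1_is_Dx.
pose Q := C * Hnorm 3 w0 ^+ 2.
have Q0 : 0 <= Q by apply: mulr_ge0; [exact: ltW|exact: sqr_ge0].
have bnd t : 0 < t -> Hnorm 2 (w t) ^+ 2 + Hnorm 1 (wt t) ^+ 2 <= Q.
  move=> t0; have := hC t t0; set I := (\int[_]_(s in _) _)%E => hI.
  have I0 : (0 <= I)%E.
    apply: integral_ge0 => s _; rewrite lee_fin.
    by apply: addr_ge0; [apply: addr_ge0|]; exact: sqr_ge0.
  have := le_trans (leeDl _ I0) hI; rewrite lee_fin; apply: le_trans.
  by rewrite lerDl; exact: sqr_ge0.
(* (A2) bounds the norms for [t > 0]; the second term takes care of [t = 0]. *)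
pose B := Num.sqrt (Q + Hnorm 2 (w 0) ^+ 2).
have B0 : 0 <= B := sqrtr_ge0 _.
have B2 : B ^+ 2 = Q + Hnorm 2 (w 0) ^+ 2.
  by apply: sqr_sqrtr; apply: addr_ge0 => //; exact: sqr_ge0.
have bw t : 0 <= t -> Hnorm 2 (w t) ^+ 2 <= B ^+ 2.
  rewrite B2 le_eqVlt => /predU1P[<-|t0]; first by rewrite lerDr.
  apply: (@le_trans _ _ Q); last by rewrite lerDl; exact: sqr_ge0.
  by apply: le_trans (bnd t t0); rewrite lerDl; exact: sqr_ge0.
have le1 (a b : R) : 0 <= b -> a ^+ 2 <= b ^+ 2 -> 0 <= a -> a <= b.
  by move=> b0 ab a0; rewrite -ler_sqr ?nnegrE.
exists B; split => //.
- move=> t t0; apply: le1 => //; last exact: L2norm_ge0.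
  apply: le_trans (bw t t0); rewrite (Hnorm2_sqr (Dw t t0) (Dwx t t0)) -addrA lerDl.
  by apply: addr_ge0; exact: sqr_ge0.
- move=> t t0; apply: le1 => //; last exact: L2norm_ge0.
  apply: le_trans (bw t t0); rewrite (Hnorm2_sqr (Dw t t0) (Dwx t t0)) -addrA addrCA lerDl.
  by apply: addr_ge0; exact: sqr_ge0.
- move=> t t0; apply: le1 => //; last exact: L2norm_ge0.
  apply: le_trans (bw t t0); rewrite (Hnorm2_sqr (Dw t t0) (Dwx t t0)) lerDr.
  by apply: addr_ge0; exact: sqr_ge0.
- move=> t t0; apply: le1 => //; last exact: L2norm_ge0.
  rewrite B2; apply: (@le_trans _ _ Q); last by rewrite lerDl; exact: sqr_ge0.
  apply: le_trans (bnd t t0); rewrite (Hnorm1_sqr (Dwt t t0)) addrCA lerDl.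
  by apply: addr_ge0; exact: sqr_ge0.
- move=> t t0 phi phix D; have := hweak t t0 phi phix D.
  rewrite /wform /bdry; move: (inner (wt t) phi) (inner (wx t) phix) (inner (wx t) phi).
  move: (inner _ phi) (inner _ phix) (_ * phi 0) (_ * phi 1) => i1 i2 b0 b1 i3 i4 i5; lra.
Qed.

Lemma coercive_of_min (p : params R) (al be : R) : 0 <= al ->
  be = Num.min (nu p - 2 * al) (Num.min (delta p - 2 * al)
         (Num.min (c0 p + wd p - 2 * al) (c1 p + wd p - 2 * al))) ->
  0 < be -> coercive p al be.
Proof.
move=> al0 -> be0; split=> //.
set m := Num.min _ _.
have [h1 h2 h3 h4] : [/\ m <= nu p - 2 * al, m <= delta p - 2 * al,
    m <= c0 p + wd p - 2 * al & m <= c1 p + wd p - 2 * al].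
  by rewrite /m !ge_min !lexx !orbT.
split; lra.
Qed.

End conclusion.

Theorem lemma2p5 (R : realType) (p : params R) (alpha beta : R)
    (hp : admissible p)
    (halpha : 0 <= alpha <=
       2^-1 * Num.min (nu p) (Num.min (delta p)
                (Num.min (c0 p + wd p) (c1 p + wd p))))
    (hbeta : beta = Num.min (nu p - 2 * alpha) (Num.min (delta p - 2 * alpha)
                (Num.min (c0 p + wd p - 2 * alpha) (c1 p + wd p - 2 * alpha))))
    (hbeta0 : 0 < beta) :
  exists (C : R) (C1 : R -> R),
    [/\ 0 < C, (forall r, 0 < C1 r) &
      forall (w0 : R -> R) (w wx wt : R -> R -> R),
        assumption_A1 p w0 w wx -> assumption_A2 p w0 w wx wt ->
        forall t : R, 0 < t ->
          L2norm (Dx 2 (w t)) ^+ 2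
          <= C1 (Hnorm 1 w0) * expR (- 2 * alpha * t) * Hnorm 2 w0 ^+ 2
             * expR (C * L2norm w0 ^+ 2)].
Proof.
have /andP[al0 _] := halpha.
have hc := coercive_of_min al0 hbeta hbeta0.
have [[nu0 rho0 de0] [c00 c10 wd0]] := hp.
pose C1 r := wxx_const p alpha ^+ 2 * forcing_const p beta (r ^+ 2).
have data0 r2 : 0 <= r2 -> 0 <= data_const p r2.
  move=> r0; apply: addr_ge0; last exact: ltW.
  apply: mulr_ge0 => //; apply: addr_ge0; last exact: sqr_ge0.
  by apply: addr_ge0; [exact: sqr_ge0|exact: mulr_ge0].
have wt0 r2 : 0 <= r2 -> 0 <= wt_const p beta r2.
  move=> r0; apply: mulr_ge0; last exact: expR_ge0.
  by apply: mulr_ge0; [exact: expR_ge0|exact: data0].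
have rb0 : 0 <= rho p / beta by apply: divr_ge0; exact: ltW.
have C10 r : 0 <= C1 r.
  have r0 := sqr_ge0 r; have k0 := wt0 _ r0.
  apply: mulr_ge0; first exact: sqr_ge0.
  apply: mulr_ge0 => //; apply: addr_ge0.
    apply: addr_ge0 => //; apply: mulr_ge0.
      by apply: mulr_ge0 => //; apply: divr_ge0 => //; exact: sqr_ge0.
    by apply: addr_ge0 => //; exact: sqr_ge0.
  apply: mulr_ge0; first exact: sqr_ge0.
  apply: mulr_ge0; first by apply: divr_ge0 => //; exact: ltW.
  apply: addr_ge0 => //; apply: divr_ge0 => //; exact: addr_ge0.
(* The exponential of the data sits inside [C1], so the last factor only has to be at least [1] and
   any positive [C] serves. The [+ 1] makes the constant strictly positive. *)
exists 1, (fun r => C1 r + 1); split => // [r|]; first by apply: ltr_wpDl.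
move=> w0 w wx wt [_ [hA0 hA1] _ _] A2 t t0.
have [B S] := regular_solution_of_assumptions A2.
have ww0 : forall x, 0 <= x <= 1 -> w 0 x = w0 x by case: A2 => [[_ [_ [_ ?]]]].
set wxx := fun t => Dx 1 (wx t) in S.
have nun0 : nu p != 0 by rewrite gt_eqF.
(* The memory vanishes at [t = 0], so the compatibility conditions become the plain boundary
   conditions of the form. *)
have hb0 : nu p * wx 0 0 = bdry (c0 p) (wd p) (w 0 0).
  by rewrite hA0 /control0 mulVKf// memory0 mulr0 subr0.
have hb1 : nu p * wx 0 1 = - bdry (c1 p) (wd p) (w 0 1).
  by rewrite hA1 /control1 mulrN mulVKf// memory0 mulr0 addr0.
have D0 := eq_is_Dx ww0 (rs_wx S (lexx 0)).
have H1 := Hnorm1_sqr D0; have H2 := Hnorm2_sqr D0 (rs_wxx S (lexx 0)).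
rewrite -(L2norm_eq ww0) in H1 H2 *.
rewrite (L2norm_Dx2 (rs_wx S (ltW t0)) (rs_wxx S (ltW t0))).
apply: le_trans (wxx_decay hp hc S hb0 hb1 t0) _.
set N2 := L2norm (w 0) ^+ 2 in H1 H2 *.
have N0 : 0 <= N2 := sqr_ge0 _.
have d0 : 0 <= L2norm (wx 0) ^+ 2 := sqr_ge0 _.
have q0 : 0 <= L2norm (wxx 0) ^+ 2 := sqr_ge0 _.
have Nr : N2 <= Hnorm 1 w0 ^+ 2 by rewrite H1 lerDl.
have NW : N2 <= Hnorm 2 w0 ^+ 2 by rewrite H2 -addrA lerDl addr_ge0.
have H2' : Hnorm 2 w0 ^+ 2 = Hnorm 1 w0 ^+ 2 + L2norm (wxx 0) ^+ 2 by rewrite H1 H2.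
have dn := data_norm_le hp S; rewrite -/N2 -H1 -H2' in dn.
have K0 := wt_decay_sqr_ge0 w wx wxx beta hp.
have KW : wt_decay_sqr p w wx wxx beta <= wt_const p beta (Hnorm 1 w0 ^+ 2) * Hnorm 2 w0 ^+ 2.
  rewrite /wt_const [leRHS]mulrAC; apply: ler_pM.
  - apply: mulr_ge0; first exact: expR_ge0.
    by apply: addr_ge0; [exact: sqr_ge0|apply: mulr_ge0; [exact: ltW|exact: sqr_ge0]].
  - exact: expR_ge0.
  - by rewrite -[leRHS]mulrA; apply: ler_wpM2l dn; exact: expR_ge0.
  - rewrite ler_expR; apply: ler_wpM2l Nr.
    by apply: divr_ge0 => //; exact: sqr_ge0.
have fb := forcing_bound_le (wd p) hbeta0 rho0 N0 Nr NW K0 KW.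
have W0 : 0 <= Hnorm 2 w0 ^+ 2 := sqr_ge0 _.
have e0 := expR_ge0 (- 2 * alpha * t).
have main := ler_wpM2l e0 (ler_wpM2l (sqr_ge0 (wxx_const p alpha)) fb).
apply: le_trans main _.
rewrite (regroup_mul (expR _)) -/(C1 (Hnorm 1 w0)).
have X0 : 0 <= C1 (Hnorm 1 w0) * expR (- 2 * alpha * t) * Hnorm 2 w0 ^+ 2.
  by apply: mulr_ge0 => //; apply: mulr_ge0.
apply: (@le_trans _ _ ((C1 (Hnorm 1 w0) + 1) * expR (- 2 * alpha * t) * Hnorm 2 w0 ^+ 2)).
  by apply: ler_wpM2r => //; apply: ler_wpM2r => //; rewrite lerDl.
rewrite ler_peMr//.
  by apply: mulr_ge0 => //; apply: mulr_ge0 => //; apply: addr_ge0.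
by rewrite mul1r -[leLHS]expR0 ler_expR; exact: sqr_ge0.
Qed.
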